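(* Let $k \ge 3$ be an integer, and assume the truth of the $abc$-conjecture. For $H \ge 1$ let $N_{k,\mathrm{loc}}(H)$ be the number of pairs $(a,b) \in \mathbb{Z}^2$ with $0<|a|,|b|\le H$ such that the equation $ax^k+by^k=1$ has a solution over $\mathbb{R}$ and a solution over $\mathbb{Z}_p$ for every prime $p$, and let $N_{k,\mathrm{glob}}(H)$ be the number of pairs $(a,b)\in\mathbb{Z}^2$ with $0<|a|,|b|\le H$ such that $ax^k+by^k=1$ has a solution $(x,y)\in\mathbb{Z}^2$. Then \[ \frac{N_{k,\mathrm{glob}}(H)}{N_{k,\mathrm{loc}}(H)} \to 0 \quad (H\to\infty). \]
   Context: The $abc$-conjecture asserts: for every $\varepsilon>0$ there is a constant $C_\varepsilon$ such that whenever $a,b,c\in\mathbb{Z}$ satisfy $a+b=c$ and $\gcd(a,b,c)=1$, we have $\max\{|a|,|b|,|c|\} \le C_\varepsilon P^{1+\varepsilon}$, where $P=\prod_{p\mid abc} p$ is the product of the distinct primes dividing $abc$. Here $\mathbb{Z}_p$ denotes the ring of $p$-adic integers. *)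

(* Defs.v *)
From HB Require Import structures.
From mathcomp Require Import all_boot all_order all_algebra.
From mathcomp Require Import finmap.
From mathcomp Require Import all_classical all_reals all_analysis.

Set Implicit Arguments.
Unset Strict Implicit.
Unset Printing Implicit Defensive.

Import Order.TTheory GRing.Theory Num.Theory.

Local Open Scope ring_scope.

Definition Zpow_red (p n : nat) (x : 'Z_(p ^ n.+2)) : 'Z_(p ^ n.+1) :=
  (x : nat)%:R.

Record padic_seq (p : nat) := PadicSeq {
  padic_coord :> forall n : nat, 'Z_(p ^ n.+1);
  padic_coherent : forall n, Zpow_red (padic_coord n.+1) = padic_coord n }.

(* The ring Z_p as the inverse limit of the rings Z/p^(n+1), n >= 0, with       *)
(* coordinatewise operations.  The primality proof is a parameter of the type  *)
(* because 'Z_m is Z/mZ, and Zpow_red a ring morphism, only when p > 1; the    *)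
(* ring structure is found by unification from this parameter.                 *)
Definition padic_int (p : nat) (p_pr : prime p) : Type := padic_seq p.

Section PadicIntegers.
Variables (p : nat) (p_pr : prime p).
Local Notation padic_int := (padic_int p_pr).

HB.instance Definition _ := gen_eqMixin padic_int.
HB.instance Definition _ := gen_choiceMixin padic_int.

Lemma padic_ext (x y : padic_int) : (forall n, x n = y n) -> x = y.
Proof.
case: x y => [x xP] [y yP] /= xy.
have {}xy : x = y by apply: functional_extensionality_dep.
by case: _ / xy yP => yP; congr PadicSeq; apply: Prop_irrelevance.
Qed.

Let ppow_gt1 n : (1 < p ^ n.+1)%N.
Proof. by rewrite -{1}(exp1n n.+1) ltn_exp2r // prime_gt1. Qed.

Let ppow_dvd n : (p ^ n.+1 %| p ^ n.+2)%N.
Proof. exact: dvdn_exp2l. Qed.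

Let red_nat n m : Zpow_red (m%:R : 'Z_(p ^ n.+2)) = m%:R.
Proof.
rewrite /Zpow_red val_Zp_nat // -Zp_nat_mod // modn_dvdm //.
by rewrite Zp_nat_mod.
Qed.

Let redD n : {morph @Zpow_red p n : x y / x + y}.
Proof.
move=> x y; rewrite -[x]natr_Zp -[y]natr_Zp -natrD !red_nat.
by rewrite natrD.
Qed.

Let redM n : {morph @Zpow_red p n : x y / x * y}.
Proof.
move=> x y; rewrite -[x]natr_Zp -[y]natr_Zp -natrM !red_nat.
by rewrite natrM.
Qed.

Let red0 n : @Zpow_red p n 0 = 0. Proof. exact: (red_nat n 0). Qed.
Let red1 n : @Zpow_red p n 1 = 1. Proof. exact: (red_nat n 1). Qed.

Let redN n : {morph @Zpow_red p n : x / - x}.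
Proof.
by move=> x; apply: (addrI (Zpow_red x)); rewrite -redD !subrr red0.
Qed.

Definition padic_zero : padic_int := @PadicSeq p (fun=> 0) red0.
Definition padic_one : padic_int := @PadicSeq p (fun=> 1) red1.

Definition padic_opp (x : padic_int) : padic_int.
Proof.
exists (fun n => - x n) => n.
by rewrite redN padic_coherent.
Defined.

Definition padic_add (x y : padic_int) : padic_int.
Proof.
exists (fun n => x n + y n) => n.
by rewrite redD !padic_coherent.
Defined.

Definition padic_mul (x y : padic_int) : padic_int.
Proof.
exists (fun n => x n * y n) => n.
by rewrite redM !padic_coherent.
Defined.

Let addA : associative padic_add.
Proof. by move=> x y z; apply: padic_ext => n; apply: addrA. Qed.
Let addC : commutative padic_add.
Proof. by move=> x y; apply: padic_ext => n; apply: addrC. Qed.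
Let add0 : left_id padic_zero padic_add.
Proof. by move=> x; apply: padic_ext => n; apply: add0r. Qed.
Let addN : left_inverse padic_zero padic_opp padic_add.
Proof. by move=> x; apply: padic_ext => n; apply: addNr. Qed.

HB.instance Definition _ :=
  GRing.isZmodule.Build padic_int addA addC add0 addN.

Let mulA : associative padic_mul.
Proof. by move=> x y z; apply: padic_ext => n; apply: mulrA. Qed.
Let mulC : commutative padic_mul.
Proof. by move=> x y; apply: padic_ext => n; apply: mulrC. Qed.
Let mul1 : left_id padic_one padic_mul.
Proof. by move=> x; apply: padic_ext => n; apply: mul1r. Qed.
Let mulD : left_distributive padic_mul padic_add.
Proof. by move=> x y z; apply: padic_ext => n; apply: mulrDl. Qed.
Let oner_neq0 : padic_one != padic_zero.
Proof.
apply/eqP => /(congr1 (fun x : padic_int => x 0%N)) /= /eqP.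
by rewrite GRing.oner_eq0.
Qed.

HB.instance Definition _ :=
  GRing.Zmodule_isComNzRing.Build padic_int mulA mulC mul1 mulD oner_neq0.

End PadicIntegers.

Definition radical (n : nat) : nat := (\prod_(p <- primes n) p)%N.

(* When a * b * c = 0 every prime divides a * b * c, so the product of these   *)
(* primes is infinite and the inequality is void; hence the nonvanishing       *)
(* condition.                                                                  *)
Definition abc_conjecture (R : realType) : Prop :=
  forall eps : R, 0 < eps -> exists C : R,
    forall a b c : int, a + b = c -> gcdz a (gcdz b c) = 1 ->
      a * b * c != 0 ->
      (maxn `|a| (maxn `|b| `|c|))%:R
        <= C * (radical `|a * b * c|)%:R `^ (1 + eps).

Definition solvable_over (A : comNzRingType) (k : nat) (a b : int) : Prop :=
  exists x y : A, a%:~R * x ^+ k + b%:~R * y ^+ k = 1.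

Definition solvable_locally (R : realType) (k : nat) (a b : int) : Prop :=
  solvable_over R k a b /\
  forall (p : nat) (p_pr : prime p), solvable_over (padic_int p_pr) k a b.

Definition coef_box (R : realType) (H : R) : set (int * int) :=
  [set ab | [/\ 0 < `|ab.1|, `|ab.1|%:~R <= H,
                0 < `|ab.2| & `|ab.2|%:~R <= H]].

(* coef_box H is finite, so fset_set below yields the genuine cardinality.     *)
Definition N_loc (R : realType) (k : nat) (H : R) : nat :=
  #|` fset_set (coef_box H `&`
        [set ab | solvable_locally R k ab.1 ab.2])%classic|%fset.

Definition N_glob (R : realType) (k : nat) (H : R) : nat :=
  #|` fset_set (coef_box H `&`
        [set ab | solvable_over int k ab.1 ab.2])%classic|%fset.

(* Main.v *)
Require Import Defs.
From mathcomp Require Import all_boot all_order all_algebra.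
From mathcomp Require Import boolp finfield zify ring lra.

(** A solution of a x^k + b y^k = 1 gives a coprime triple, and abc bounds
    X = max(|x|, |y|) by about H^(1/(k-2)), because the radical of the triple
    divides abxy.  For fixed (x, y) at most 2H/X^k + 1 pairs (a, b) occur.  For
    k >= 4 summation over (x, y) gives N_glob << H^(1+eps), whereas the pairs
    (u^k, b) with u prime and b a k-th power residue modulo u are all locally
    soluble (take (1/u, 0) away from u and lift (0, y) at u), so that
    N_loc >> H^(1+1/k-eps).

    For k = 3 this leaves the range where a, b, x, y all have size about H.
    There x/y is put on a line q x - p y = d by Dirichlet's theorem; on a short
    piece of such a line four solutions (t_i, a_i, b_i) satisfy that the
    cross-ratio of the (a_i : b_i) equals that of the t_i, because the difference
    is an integer that is too small.  Hence (a : b) is a Moebius function of the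
    parameter t, and a quartic equation together with the divisor bound leaves
    H^eps solutions per piece.  This saves a fixed power of H over H^2.  In the
    other direction N_loc >> H^(2-eps): take for b a prime q = 2 mod 3, and for a
    a number 2^i 5^j p = 1 mod 63 with p = 2 mod 3 another prime.  Modulo a prime
    l = 1 mod 3, l > 7, solubility follows from the cyclotomic numbers of order
    three, and the supply of primes is Mertens' theorem for the class 2 mod 3. *)

Set Implicit Arguments.
Unset Strict Implicit.
Unset Printing Implicit Defensive.

Import Order.TTheory GRing.Theory Num.Theory.
Local Open Scope ring_scope.

(** * Four solutions on a short piece of a line *)

(** For k = 3 the conjecture only confines x and y to about H^(1+eps), which leaves as many
    candidates (x, y) as there are pairs (a, b); a power of H has to be saved by other means. The
    cross-ratios agree for this reason: a x^3 + b y^3 = 1 puts (b : a) close to (-x^3 : y^3), and on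
    a line x_i^3 y_j^3 - x_j^3 y_i^3 is d (t_j - t_i) times a form that hardly varies on a short
    piece. So a_i b_j - a_j b_i is nearly a product f_i f_j (t_i - t_j), and the f_i drop out of a
    cross-ratio.

    The comparison of the two counts is done with integer powers: n is placed between h^m and 2^m
    h^m, an H^eps becomes a spare power of h, and constants are absorbed by taking h large. The
    exponents have slack: for k = 3 the upper bound saves n^(1/100) over n^2, and the lower bound
    loses n^(8/1000). *)

Lemma cross_minor_on_line (a1 b1 a2 b2 x0 y0 p q t1 t2 : int) :
  let x1 := x0 + p * t1 in let y1 := y0 + q * t1 in
  let x2 := x0 + p * t2 in let y2 := y0 + q * t2 in
  a1 * x1 ^+ 3 + b1 * y1 ^+ 3 = 1 -> a2 * x2 ^+ 3 + b2 * y2 ^+ 3 = 1 ->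
  y1 ^+ 3 * y2 ^+ 3 * (a1 * b2 - a2 * b1) =
  (a1 * y1 ^+ 3 - a2 * y2 ^+ 3) - a1 * a2 * ((q * x0 - p * y0) * (t1 - t2)
    * (x1 ^+ 2 * y2 ^+ 2 + x1 * x2 * y1 * y2 + x2 ^+ 2 * y1 ^+ 2)).
Proof.
move=> x1 y1 x2 y2 e1 e2.
have -> : y1 ^+ 3 * y2 ^+ 3 * (a1 * b2 - a2 * b1) =
   a1 * y1 ^+ 3 * (b2 * y2 ^+ 3) - a2 * y2 ^+ 3 * (b1 * y1 ^+ 3) by ring.
have -> : b2 * y2 ^+ 3 = 1 - a2 * x2 ^+ 3 by rewrite -e2; ring.
have -> : b1 * y1 ^+ 3 = 1 - a1 * x1 ^+ 3 by rewrite -e1; ring.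
by rewrite /x1 /x2 /y1 /y2; ring.
Qed.

(** The form [S] is the quotient of x^3 y'^3 - x'^3 y^3 by x y' - x' y. The left side vanishes when
    the points 1 and 3, or 2 and 4, are proportional, so these two minors split off. On a line they
    are d times a difference of parameters, which is where the main terms of the cross-ratio
    cancel. *)
Lemma sym_square_identity (x1 y1 x2 y2 x3 y3 x4 y4 : int) :
  let S x y x' y' := x ^+ 2 * y' ^+ 2 + x * x' * y * y' + x' ^+ 2 * y ^+ 2 in
  S x1 y1 x2 y2 * S x3 y3 x4 y4 - S x1 y1 x4 y4 * S x2 y2 x3 y3 =
  - ((x1 * y3 - x3 * y1) * (x2 * y4 - x4 * y2)
     * (x1 * x2 * y3 * y4 + x1 * x3 * y2 * y4 + x1 * x4 * y2 * y3
        + x2 * x3 * y1 * y4 + x2 * x4 * y1 * y3 + x3 * x4 * y1 * y2)).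
Proof. by move=> S; rewrite /S; ring. Qed.

Lemma ler_normM2 (x y A B : int) : `|x| <= A -> `|y| <= B -> `|x * y| <= A * B.
Proof. by move=> *; rewrite normrM ler_pM. Qed.

Lemma ler_normD2 (x y A B : int) : `|x| <= A -> `|y| <= B -> `|x + y| <= A + B.
Proof. by move=> hx hy; apply: (le_trans (ler_normD _ _)); apply: lerD. Qed.

Lemma ler_normB2 (x y A B : int) : `|x| <= A -> `|y| <= B -> `|x - y| <= A + B.
Proof. by move=> hx hy; apply: (le_trans (ler_normB _ _)); apply: lerD. Qed.

Lemma ler_normX2 (x A : int) n : `|x| <= A -> `|x ^+ n| <= A ^+ n.
Proof. by move=> hx; rewrite normrX lerXn2r // nnegrE; apply: le_trans hx. Qed.

Ltac bound_norm := repeat first [ assumption |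
  lazymatch goal with
  | |- is_true (`|_ - _| <= _) => apply: ler_normB2
  | |- is_true (`|- _| <= _) => rewrite normrN
  | |- is_true (`|_ + _| <= _) => apply: ler_normD2
  | |- is_true (`|_ * _| <= _) => apply: ler_normM2
  | |- is_true (`|_ ^+ _| <= _) => apply: ler_normX2
  end ].

(* Up to sign the determinant of the rows (a_i, b_i, t_i a_i, t_i b_i); it vanishes when
   the points (a_i : b_i) and t_i have the same cross-ratio. *)
Definition cross_det (t1 a1 b1 t2 a2 b2 t3 a3 b3 t4 a4 b4 : int) : int :=
  (a1 * b2 - a2 * b1) * (a3 * b4 - a4 * b3) * ((t1 - t4) * (t2 - t3))
  - (a1 * b4 - a4 * b1) * (a2 * b3 - a3 * b2) * ((t1 - t2) * (t3 - t4)).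

(** Each minor times y_i^3 y_j^3 is an error of size n Y^3 minus a main term of size n^2 D tau Y^4.
    In [cross_det] the products of two main terms share the factor a1 a2 a3 a4 d^2 times four
    differences of the t_i, and the cofactor is given by [sym_square_identity]. The three summands
    of the last hypothesis bound error times error, error times main term, and this remainder. *)
Lemma cross_det_eq0 (n D tau Y y_min x0 y0 p q : int)
    (t1 a1 b1 t2 a2 b2 t3 a3 b3 t4 a4 b4 : int) :
  let pt t a b :=
    [/\ a * (x0 + p * t) ^+ 3 + b * (y0 + q * t) ^+ 3 = 1, `|a| <= n,
        `|x0 + p * t| <= Y, `|y0 + q * t| <= Y & y_min <= y0 + q * t] in
  let nearby t t' := `|t - t'| <= tau in
  0 < y_min -> `|q * x0 - p * y0| <= D ->
  pt t1 a1 b1 -> pt t2 a2 b2 -> pt t3 a3 b3 -> pt t4 a4 b4 ->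
  nearby t1 t2 -> nearby t1 t3 -> nearby t1 t4 ->
  nearby t2 t3 -> nearby t2 t4 -> nearby t3 t4 ->
  8 * n ^+ 2 * Y ^+ 6 * tau ^+ 2 + 24 * n ^+ 3 * D * tau ^+ 3 * Y ^+ 7
    + 6 * n ^+ 4 * D ^+ 4 * tau ^+ 6 * Y ^+ 4 < y_min ^+ 12 ->
  cross_det t1 a1 b1 t2 a2 b2 t3 a3 b3 t4 a4 b4 = 0.
Proof.
move=> pt nearby ym0 hd [e1 n1 X1 Y1 m1] [e2 n2 X2 Y2 m2] [e3 n3 X3 Y3 m3]
  [e4 n4 X4 Y4 m4] h12 h13 h14 h23 h24 h34 hlt.
have E12 := cross_minor_on_line e1 e2; have E34 := cross_minor_on_line e3 e4.
have E14 := cross_minor_on_line e1 e4; have E23 := cross_minor_on_line e2 e3.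
set d := q * x0 - p * y0 in hd E12 E34 E14 E23.
pose S (x y x' y' : int) := x ^+ 2 * y' ^+ 2 + x * x' * y * y' + x' ^+ 2 * y ^+ 2.
have D13 : (x0 + p * t1) * (y0 + q * t3) - (x0 + p * t3) * (y0 + q * t1)
  = - d * (t1 - t3) by rewrite /d; ring.
have D24 : (x0 + p * t2) * (y0 + q * t4) - (x0 + p * t4) * (y0 + q * t2)
  = - d * (t2 - t4) by rewrite /d; ring.
have HS := sym_square_identity (x0 + p * t1) (y0 + q * t1) (x0 + p * t2) (y0 + q * t2)
  (x0 + p * t3) (y0 + q * t3) (x0 + p * t4) (y0 + q * t4).
rewrite /= D13 D24 in HS.
move: e1 e2 e3 e4 X1 X2 X3 X4 Y1 Y2 Y3 Y4 m1 m2 m3 m4 E12 E34 E14 E23 HS => _ _ _ _.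
clear D13 D24 pt.
move: (x0 + p * t1) (x0 + p * t2) (x0 + p * t3) (x0 + p * t4)
  (y0 + q * t1) (y0 + q * t2) (y0 + q * t3) (y0 + q * t4) => x1 x2 x3 x4 y1 y2 y3 y4.
move=> X1 X2 X3 X4 Y1 Y2 Y3 Y4 m1 m2 m3 m4.
rewrite -![_ ^+ 2 * _ ^+ 2 + _ + _]/(S _ _ _ _) => E12 E34 E14 E23 HS.
have S3 x y x' y' : `|x| <= Y -> `|y| <= Y -> `|x'| <= Y -> `|y'| <= Y ->
    `|S x y x' y'| <= Y ^+ 2 * Y ^+ 2 + Y * Y * Y * Y + Y ^+ 2 * Y ^+ 2.
  by move=> *; rewrite /S; bound_norm.
have M3 a y a' y' : `|a| <= n -> `|y| <= Y -> `|a'| <= n -> `|y'| <= Y ->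
    `|a * y ^+ 3 - a' * y' ^+ 3| <= n * Y ^+ 3 + n * Y ^+ 3.
  by move=> *; bound_norm.
set e2 := (x1 * x2 * y3 * y4 + _ + _ + _ + _ + _) in HS.
have e2b : `|e2| <= Y * Y * Y * Y + Y * Y * Y * Y + Y * Y * Y * Y + Y * Y * Y * Y
   + Y * Y * Y * Y + Y * Y * Y * Y.
  by rewrite /e2; bound_norm.
have : y1 ^+ 3 * y2 ^+ 3 * y3 ^+ 3 * y4 ^+ 3 *
    cross_det t1 a1 b1 t2 a2 b2 t3 a3 b3 t4 a4 b4 =
   (y1 ^+ 3 * y2 ^+ 3 * (a1 * b2 - a2 * b1)) * (y3 ^+ 3 * y4 ^+ 3 * (a3 * b4 - a4 * b3))
     * ((t1 - t4) * (t2 - t3))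
   - (y1 ^+ 3 * y4 ^+ 3 * (a1 * b4 - a4 * b1)) * (y2 ^+ 3 * y3 ^+ 3 * (a2 * b3 - a3 * b2))
     * ((t1 - t2) * (t3 - t4)).
  by rewrite /cross_det; ring.
rewrite E12 E34 E14 E23.
set M12 := a1 * y1 ^+ 3 - _; set M34 := a3 * y3 ^+ 3 - _.
set M14 := a1 * y1 ^+ 3 - _; set M23 := a2 * y2 ^+ 3 - _.
have -> : (M12 - a1 * a2 * (d * (t1 - t2) * S x1 y1 x2 y2)) *
   (M34 - a3 * a4 * (d * (t3 - t4) * S x3 y3 x4 y4)) * ((t1 - t4) * (t2 - t3)) -
   (M14 - a1 * a4 * (d * (t1 - t4) * S x1 y1 x4 y4)) *
   (M23 - a2 * a3 * (d * (t2 - t3) * S x2 y2 x3 y3)) * ((t1 - t2) * (t3 - t4)) =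
   (M12 * M34 * ((t1 - t4) * (t2 - t3)) - M14 * M23 * ((t1 - t2) * (t3 - t4)))
   - ((M12 * (a3 * a4 * (d * (t3 - t4) * S x3 y3 x4 y4))
       + a1 * a2 * (d * (t1 - t2) * S x1 y1 x2 y2) * M34) * ((t1 - t4) * (t2 - t3))
     - (M14 * (a2 * a3 * (d * (t2 - t3) * S x2 y2 x3 y3))
       + a1 * a4 * (d * (t1 - t4) * S x1 y1 x4 y4) * M23) * ((t1 - t2) * (t3 - t4)))
   + a1 * a2 * a3 * a4 * d ^+ 2 * ((t1 - t2) * (t3 - t4) * ((t1 - t4) * (t2 - t3)))
     * (S x1 y1 x2 y2 * S x3 y3 x4 y4 - S x1 y1 x4 y4 * S x2 y2 x3 y3) by ring.
rewrite HS.
set C := cross_det _ _ _ _ _ _ _ _ _ _ _ _ => Ceq.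
have Cle : `|y1 ^+ 3 * y2 ^+ 3 * y3 ^+ 3 * y4 ^+ 3 * C| < y_min ^+ 12.
  apply: le_lt_trans hlt; rewrite Ceq.
  have -> : 8 * n ^+ 2 * Y ^+ 6 * tau ^+ 2 + 24 * n ^+ 3 * D * tau ^+ 3 * Y ^+ 7
      + 6 * n ^+ 4 * D ^+ 4 * tau ^+ 6 * Y ^+ 4 =
   let M := n * Y ^+ 3 + n * Y ^+ 3 in
   let K := n * n * (D * tau * (Y ^+ 2 * Y ^+ 2 + Y * Y * Y * Y + Y ^+ 2 * Y ^+ 2)) in
   (M * M * (tau * tau) + M * M * (tau * tau))
   + ((M * K + K * M) * (tau * tau) + (M * K + K * M) * (tau * tau))
   + n * n * n * n * D ^+ 2 * (tau * tau * (tau * tau)) *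
     (D * tau * (D * tau) * (Y * Y * Y * Y + Y * Y * Y * Y + Y * Y * Y * Y + Y * Y * Y * Y
   + Y * Y * Y * Y + Y * Y * Y * Y)) by rewrite /=; ring.
  have [SS12 SS34 SS14 SS23] := And4 (S3 _ _ _ _ X1 Y1 X2 Y2) (S3 _ _ _ _ X3 Y3 X4 Y4)
    (S3 _ _ _ _ X1 Y1 X4 Y4) (S3 _ _ _ _ X2 Y2 X3 Y3).
  have [MM12 MM34 MM14 MM23] := And4 (M3 _ _ _ _ n1 Y1 n2 Y2) (M3 _ _ _ _ n3 Y3 n4 Y4)
    (M3 _ _ _ _ n1 Y1 n4 Y4) (M3 _ _ _ _ n2 Y2 n3 Y3).
  rewrite -/M12 -/M34 -/M14 -/M23 in MM12 MM34 MM14 MM23.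
  move: Ceq MM12 MM34 MM14 MM23 SS12 SS34 SS14 SS23 e2b; clearbody M12 M34 M14 M23 e2 => _.
  move: (S _ _ _ _) (S _ _ _ _) (S _ _ _ _) (S _ _ _ _) => S12 S34 S14 S23 *.
  rewrite /=; bound_norm.
apply/eqP; apply: contraT => C0.
suff : y_min ^+ 12 <= `|y1 ^+ 3 * y2 ^+ 3 * y3 ^+ 3 * y4 ^+ 3 * C| by rewrite leNgt Cle.
have C1 : 1 <= `|C| by rewrite -gtz0_ge1 normr_gt0.
have yy i : y_min <= i -> y_min ^+ 3 <= `|i ^+ 3|.
  move=> hi; rewrite normrX; apply: lerXn2r; rewrite ?nnegrE; try exact: ltW.
    by apply: normr_ge0.
  by apply: le_trans hi (ler_norm _).
have y30 : 0 <= y_min ^+ 3 by apply: exprn_ge0; exact: ltW.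
have -> : y_min ^+ 12 = y_min ^+ 3 * y_min ^+ 3 * y_min ^+ 3 * y_min ^+ 3 * 1 by ring.
have y60 := mulr_ge0 y30 y30; have y90 := mulr_ge0 y60 y30; have y120 := mulr_ge0 y90 y30.
have k2 := ler_pM y30 y30 (yy _ m1) (yy _ m2).
have k4 := ler_pM y90 y30 (ler_pM y60 y30 k2 (yy _ m3)) (yy _ m4).
by apply: (le_trans (ler_pM y120 ler01 k4 C1)); rewrite -!normrM.
Qed.

(** * Bounds for the number of elements of a predicate *)

(** The bound is witnessed by a covering list, which may contain repetitions and foreign elements;
    so predicates in [Prop] can be combined without deciding them or first proving them finite. *)
Definition at_most (T : eqType) (A : T -> Prop) (n : nat) :=
  exists s : seq T, (size s <= n)%N /\ forall z, A z -> z \in s.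

Lemma at_mostW (T : eqType) (A B : T -> Prop) m n :
  at_most A m -> (forall z, B z -> A z) -> (m <= n)%N -> at_most B n.
Proof.
move=> [s [sm sA]] BA mn; exists s; split; first exact: leq_trans mn.
by move=> z /BA /sA.
Qed.

Lemma at_mostU (T : eqType) (A B : T -> Prop) m n :
  at_most A m -> at_most B n -> at_most (fun z => A z \/ B z) (m + n).
Proof.
move=> [s [sm sA]] [r [rn rB]]; exists (s ++ r); rewrite size_cat leq_add //.
by split=> // z [/sA|/rB]; rewrite mem_cat => -> //; rewrite orbT.
Qed.

Lemma at_most_sum (I T : eqType) (r : seq I) (A : I -> T -> Prop) (N : I -> nat) :
  (forall i, i \in r -> at_most (A i) (N i)) ->
  at_most (fun z => exists2 i, i \in r & A i z) (\sum_(i <- r) N i).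
Proof.
elim: r => [_|i r IH hA]; first by exists [::]; split=> // z [].
have [s [ss sA]] := hA i (mem_head _ _).
have [r' [rs rA]] : at_most (fun z => exists2 i, i \in r & A i z) (\sum_(i <- r) N i).
  by apply: IH => j jr; apply: hA; rewrite inE jr orbT.
exists (s ++ r'); rewrite size_cat big_cons leq_add //; split=> // z [j].
rewrite inE mem_cat => /orP[/eqP-> /sA->//|jr Aj].
by rewrite (rA z) ?orbT //; exists j.
Qed.

Lemma at_most_bigcup (I T : eqType) (r : seq I) (A : I -> T -> Prop) (N : nat) :
  (forall i, i \in r -> at_most (A i) N) ->
  at_most (fun z => exists2 i, i \in r & A i z) (size r * N).
Proof.
move=> hA; have := at_most_sum hA; rewrite big_const_seq count_predT iter_addn_0.
by rewrite mulnC.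
Qed.

Lemma at_most_image (I T : eqType) (f : I -> T) (A : I -> Prop) n :
  at_most A n -> at_most (fun z => exists2 i, A i & z = f i) n.
Proof.
move=> [s [sn sA]]; exists (map f s); rewrite size_map; split=> // z [i /sA si ->].
exact: map_f.
Qed.

Lemma at_most_or_uniq (T : eqType) (A : T -> Prop) n :
  at_most A n \/ exists s : seq T, [/\ uniq s, size s = n.+1 & forall z, z \in s -> A z].
Proof.
elim: n => [|n IH].
  have [[z Az]|nA] := EM (exists z, A z).
    by right; exists [:: z]; split=> // z'; rewrite inE => /eqP->.
  by left; exists [::]; split=> // z Az; case: nA; exists z.
case: IH => [h|[s [us ss sA]]]; first by left; apply: at_mostW h _ _.
have [[z Az zs]|nA] := EM (exists2 z, A z & z \notin s).
  right; exists (z :: s); rewrite /= zs us ss; split=> // z'.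
  by rewrite inE => /orP[/eqP->//|/sA].
left; exists s; rewrite ss; split=> // z Az; apply: contraT => zs.
by case: nA; exists z.
Qed.

Lemma poly4_eq0 (c0 c1 c2 c3 c4 : int) (s : seq int) : uniq s -> size s = 5 ->
  (forall t, t \in s -> c0 + c1 * t + c2 * t ^+ 2 + c3 * t ^+ 3 + c4 * t ^+ 4 = 0) ->
  [/\ c0 = 0, c1 = 0, c2 = 0, c3 = 0 & c4 = 0].
Proof.
move=> us ss h; pose P := Poly [:: c0; c1; c2; c3; c4].
have P0 : P = 0.
  apply/eqP; apply: contraT => Pn0.
  have : (size s < size P)%N.
    apply: max_poly_roots => //; apply/allP => t ts; rewrite /root horner_Poly /=.
    by apply/eqP; rewrite -[RHS](h t ts); ring.
  by rewrite ss ltnNge (leq_trans (size_Poly _)).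
have cP i : nth 0 [:: c0; c1; c2; c3; c4] i = 0 by rewrite -coef_Poly -/P P0 coef0.
by split; [exact: (cP 0)|exact: (cP 1%N)|exact: (cP 2%N)|exact: (cP 3%N)|exact: (cP 4%N)].
Qed.

(* The x^2 y^2 coefficient, in the basis of quartic forms in the linear
   polynomials x = x0 + p t and y = y0 + q t, kills L2 x^3 - L1 y^3 for linear
   L1, L2 but not a nonzero constant. *)
Lemma quartic_nonconstant (x0 y0 p q al be ga de g : int) (s : seq int) :
  p != 0 -> q != 0 -> g != 0 -> uniq s -> size s = 5 ->
  (forall t, t \in s ->
    (ga * t + de) * (x0 + p * t) ^+ 3 - (al * t + be) * (y0 + q * t) ^+ 3 = g) -> False.
Proof.
move=> p0 q0 g0 us ss h.
pose c0 := de * x0 ^+ 3 - be * y0 ^+ 3 - g.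
pose c1 := ga * x0 ^+ 3 + 3 * de * x0 ^+ 2 * p - al * y0 ^+ 3 - 3 * be * y0 ^+ 2 * q.
pose c2 := 3 * ga * x0 ^+ 2 * p + 3 * de * x0 * p ^+ 2
  - 3 * al * y0 ^+ 2 * q - 3 * be * y0 * q ^+ 2.
pose c3 := 3 * ga * x0 * p ^+ 2 + de * p ^+ 3 - 3 * al * y0 * q ^+ 2 - be * q ^+ 3.
pose c4 := ga * p ^+ 3 - al * q ^+ 3.
have [z0 z1 z2 z3 z4] : [/\ c0 = 0, c1 = 0, c2 = 0, c3 = 0 & c4 = 0].
  apply: (poly4_eq0 us ss) => t /h ht; rewrite -[RHS](subrr g) -{1}ht.
  by rewrite /c0 /c1 /c2 /c3 /c4; ring.
have : c0 * (6 * p ^+ 2 * q ^+ 2) + c1 * (- (3 * p * q * (q * x0 + p * y0)))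
   + c2 * (x0 ^+ 2 * q ^+ 2 + 4 * x0 * y0 * p * q + y0 ^+ 2 * p ^+ 2)
   + c3 * (- (3 * x0 * y0 * (q * x0 + p * y0))) + c4 * (6 * x0 ^+ 2 * y0 ^+ 2)
   = - (6 * g * p ^+ 2 * q ^+ 2) by rewrite /c0 /c1 /c2 /c3 /c4; ring.
rewrite z0 z1 z2 z3 z4 !mul0r !addr0 => /eqP; rewrite eq_sym oppr_eq0 !mulf_eq0.
by rewrite (negPf g0) (negPf p0) (negPf q0).
Qed.

(** * Soluble pairs on one block of a line *)

Lemma coprime_of_form (a b x y : int) k : (0 < k)%N -> a * x ^+ k + b * y ^+ k = 1 ->
  coprimez (x ^+ k) (y ^+ k) /\ coprimez a b.
Proof.
move=> k0 e; split; apply/coprimezP.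
  by exists (a, b).
by exists (x ^+ k, y ^+ k); rewrite /= -e; ring.
Qed.

(** For fixed (x, y) two solutions (a, b) differ by a multiple of (y^k, -x^k), and a - a' is too
    small for a nonzero one. *)
Lemma form_eq_determines (a b a' b' x y n : int) k : (0 < k)%N ->
  a * x ^+ k + b * y ^+ k = 1 -> a' * x ^+ k + b' * y ^+ k = 1 ->
  `|a| <= n -> `|a'| <= n -> 2 * n < y ^+ k -> a = a' /\ b = b'.
Proof.
move=> k0 e e' an an' hy.
have [co _] := coprime_of_form k0 e.
have dv : (y ^+ k %| (a - a') * x ^+ k)%Z.
  have -> : (a - a') * x ^+ k = (b' - b) * y ^+ k.
    have -> : (a - a') * x ^+ k = (a * x ^+ k + b * y ^+ k)
       - (a' * x ^+ k + b' * y ^+ k) + (b' - b) * y ^+ k by ring.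
    by rewrite e e' subrr add0r.
  exact: dvdz_mull.
have dva : (y ^+ k %| a - a')%Z by rewrite -(@Gauss_dvdzl _ _ (x ^+ k)) // coprimez_sym.
have aa : a = a'.
  apply/eqP; rewrite -subr_eq0; apply: contraT => nz.
  have [c hc] := dvdzP dva.
  have c0 : c != 0 by apply: contraNneq nz => c0; rewrite hc c0 mul0r.
  have : y ^+ k <= `|a - a'|.
    rewrite hc normrM; have y0 : 0 < y ^+ k by apply: le_lt_trans hy; move: an; lia.
    by rewrite (gtr0_norm y0) ler_peMl ?(ltW y0) // -gtz0_ge1 normr_gt0.
  have : `|a - a'| <= n + n by apply: ler_normB2.
  by move: hy; lia.
split=> //; have : (b - b') * y ^+ k = 0.
  have -> : (b - b') * y ^+ k = (a * x ^+ k + b * y ^+ k)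
       - (a' * x ^+ k + b' * y ^+ k) + (a' - a) * x ^+ k by ring.
  by rewrite e e' aa !subrr mul0r addr0.
move/eqP; rewrite mulf_eq0 => /orP[/eqP|/eqP y0]; first by move=> h; lia.
by move: hy; rewrite y0; move: an; lia.
Qed.


Lemma coprime_parallel (a b a' b' : int) : a != 0 -> coprimez a b -> coprimez a' b' ->
  a * b' = a' * b -> (a' = a /\ b' = b) \/ (a' = - a /\ b' = - b).
Proof.
move=> a0 co co' e.
have d1 : (a %| a')%Z by rewrite -(@Gauss_dvdzl _ _ b) // -e dvdz_mulr.
have d2 : (a' %| a)%Z by rewrite -(@Gauss_dvdzl _ _ b') // e dvdz_mulr.
have h : `|a|%N = `|a'|%N by apply/eqP; rewrite eqn_dvd -!dvdzE d1 d2.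
have [aa|aa] : a' = a \/ a' = - a by lia.
  by left; split=> //; apply: (mulfI a0); rewrite e aa.
by right; split=> //; apply: (mulfI a0); rewrite e aa; ring.
Qed.

(** Coprime pairs on one line through the origin agree up to sign. Without three pairwise
    independent elements, two such lines cover everything, hence the 4. *)
Lemma at_most_cross (A : int * int -> Prop) :
  (forall z, A z -> z.1 != 0 /\ coprimez z.1 z.2) ->
  let E (z z' : int * int) := z.1 * z'.2 - z'.1 * z.2 in
  at_most A 4 \/ exists z1 z2 z3, [/\ A z1, A z2, A z3 &
    [/\ E z1 z2 != 0, E z1 z3 != 0 & E z2 z3 != 0]].
Proof.
move=> hA E.
have par z z' : A z -> A z' -> E z z' = 0 -> z' \in [:: z; (- z.1, - z.2)].
  move=> /hA[z0 cz] /hA[_ cz'] /eqP; rewrite subr_eq0 => /eqP e.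
  rewrite !inE; case: z z0 cz e => a b /= a0 cz; case: z' cz' => a' b' /= cz' e.
  by case: (coprime_parallel a0 cz cz' e) => [][-> ->]; rewrite eqxx ?orbT.
have [[z1 A1]|nA] := EM (exists z, A z); last first.
  by left; exists [::]; split=> // z Az; case: nA; exists z.
have [[z2 A2 E12]|nA] := EM (exists2 z, A z & E z1 z != 0); last first.
  left; exists [:: z1; (- z1.1, - z1.2)]; split=> // z Az; apply: par => //.
  by apply/eqP; apply: contraT => h; case: nA; exists z.
have [[z3 A3 [E13 E23]]|nA] := EM (exists2 z, A z & E z1 z != 0 /\ E z2 z != 0).
  by right; exists z1, z2, z3.
left; exists ([:: z1; (- z1.1, - z1.2)] ++ [:: z2; (- z2.1, - z2.2)]); split=> // z Az.
rewrite mem_cat; have [/(par _ _ A1 Az)->//|E1] := eqVneq (E z1 z) 0.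
have [/(par _ _ A2 Az)->|E2] := eqVneq (E z2 z) 0; first by rewrite orbT.
by case: nA; exists z.
Qed.

Lemma window_dist (t0 tau t t' : int) :
  t0 <= t <= t0 + tau -> t0 <= t' <= t0 + tau -> `|t - t'| <= tau.
Proof. lia. Qed.

Section LineBlock.
Variables (n Y y_min tau D x0 y0 p q t0 : int) (K : nat).
Hypotheses (p0 : p != 0) (q0 : q != 0) (ym0 : 0 < y_min) (n_small : 2 * n < y_min ^+ 3).
Hypotheses (d_le : `|q * x0 - p * y0| <= D).
Hypothesis small : 8 * n ^+ 2 * Y ^+ 6 * tau ^+ 2 + 24 * n ^+ 3 * D * tau ^+ 3 * Y ^+ 7
    + 6 * n ^+ 4 * D ^+ 4 * tau ^+ 6 * Y ^+ 4 < y_min ^+ 12.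
Hypothesis K_div : forall m : nat, (0 < m)%N ->
  m%:Z <= (2 * n ^+ 2) ^+ 3 * tau ^+ 3 -> (size (divisors m) <= K)%N.

Definition block_pt (t a b : int) :=
  [/\ t0 <= t <= t0 + tau, a * (x0 + p * t) ^+ 3 + b * (y0 + q * t) ^+ 3 = 1,
      `|a| <= n /\ `|b| <= n, a != 0 &
      [/\ `|x0 + p * t| <= Y, `|y0 + q * t| <= Y & y_min <= y0 + q * t]].

Lemma block_pt_inj t a b a' b' : block_pt t a b -> block_pt t a' b' -> a = a' /\ b = b'.
Proof.
move=> [_ e [an _] _ [_ _ hy]] [_ e' [an' _] _ _].
apply: (form_eq_determines (k := 3) (n := n) (x := x0 + p * t) (y := y0 + q * t)) => //.
apply: (lt_le_trans n_small); apply: lerXn2r => //; rewrite nnegrE.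
  exact: ltW.
by apply: le_trans hy; apply: ltW.
Qed.

Lemma block_cross t1 a1 b1 t2 a2 b2 t3 a3 b3 t4 a4 b4 :
  block_pt t1 a1 b1 -> block_pt t2 a2 b2 -> block_pt t3 a3 b3 -> block_pt t4 a4 b4 ->
  cross_det t1 a1 b1 t2 a2 b2 t3 a3 b3 t4 a4 b4 = 0.
Proof.
move=> [h1 e1 [an1 _] _ [X1 Y1 m1]] [h2 e2 [an2 _] _ [X2 Y2 m2]].
move=> [h3 e3 [an3 _] _ [X3 Y3 m3]] [h4 e4 [an4 _] _ [X4 Y4 m4]].
by apply: (cross_det_eq0 (n := n) (D := D) (tau := tau) (Y := Y) (y_min := y_min)
  (x0 := x0) (y0 := y0) (p := p) (q := q)) => //; apply: window_dist; eassumption.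
Qed.

(** Once three points with nonzero minors are fixed, coprimality of a and b turns the linear
    relation for a further point into L2(t) = g a and L1(t) = - g b, with g dividing a fixed nonzero
    integer. There are at most 2 K such g, counted with sign, and each leaves a quartic equation for
    t, with at most 4 roots. The summand 4 is the case without three such points. *)
Lemma block_few : at_most (fun z : int * int => exists t, block_pt t z.1 z.2) (8 * K + 4).
Proof.
set A := fun z => _.
have Aco z : A z -> z.1 != 0 /\ coprimez z.1 z.2.
  by move=> [t [_ e _ a0 _]]; split=> //; have [] := coprime_of_form (k := 3) isT e.
have [h|] := at_most_cross Aco; first by apply: at_mostW h _ _ => //; rewrite leq_addl.
move=> [[a1 b1] [[a2 b2] [[a3 b3] [[t1 P1] [t2 P2] [t3 P3] /= [E12 E13 E23]]]]].
have tneq t a b t' a' b' : block_pt t a b -> block_pt t' a' b' ->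
    a * b' - a' * b != 0 -> t - t' != 0.
  move=> Pt Pt' /negP E; apply/negP; rewrite subr_eq0 => /eqP tt; rewrite -tt in Pt'.
  by apply: E; have [-> ->] := block_pt_inj Pt Pt'; rewrite subrr.
have T12 := tneq _ _ _ _ _ _ P1 P2 E12; have T13 := tneq _ _ _ _ _ _ P1 P3 E13.
have T23 := tneq _ _ _ _ _ _ P2 P3 E23.
set e12 := a1 * b2 - a2 * b1 in E12; set e13 := a1 * b3 - a3 * b1 in E13.
set e23 := a2 * b3 - a3 * b2 in E23.
(* For a fourth point (t, a, b) the vanishing of [cross_det] reads a L1(t) + b L2(t) = 0; this is
   the Moebius function carrying t to (a : b). *)
pose U := e12 * (t2 - t3); pose V := e23 * (t1 - t2).
pose L1 t := - (U * b3 * (t1 - t)) + V * b1 * (t3 - t).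
pose L2 t := U * a3 * (t1 - t) - V * a1 * (t3 - t).
(* Up to sign this is the resultant of the linear polynomials [L1] and [L2], so a common divisor of
   their values at an integer divides it. *)
pose W := U * V * e13 * (t1 - t3).
have W0 : W != 0 by rewrite /W /U /V !mulf_neq0.
have Wle : (`|W|%N)%:Z <= (2 * n ^+ 2) ^+ 3 * tau ^+ 3.
  have near t a b t' a' b' : block_pt t a b -> block_pt t' a' b' ->
     `|t - t'| <= tau /\ `|a * b' - a' * b| <= 2 * n ^+ 2.
    move=> [h _ [an bn] _ _] [h' _ [an' bn'] _ _]; split; first exact: window_dist h h'.
    have -> : 2 * n ^+ 2 = n * n + n * n by ring.
    by bound_norm.
  have [h12 g12] := near _ _ _ _ _ _ P1 P2; have [h13 g13] := near _ _ _ _ _ _ P1 P3.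
  have [h23 g23] := near _ _ _ _ _ _ P2 P3.
  rewrite abszE.
  have -> : (2 * n ^+ 2) ^+ 3 * tau ^+ 3 = (2 * n ^+ 2) * tau * ((2 * n ^+ 2) * tau)
    * (2 * n ^+ 2) * tau by ring.
  by rewrite /W /U /V /e12 /e13 /e23; bound_norm.
have Wpos : (0 < `|W|)%N by rewrite absz_gt0.
have Kd := K_div Wpos Wle.
pose gs := [seq (d : nat)%:Z | d <- divisors `|W|%N] ++ [seq - (d : nat)%:Z | d <- divisors `|W|%N].
have key : forall z, A z -> exists2 g, g \in gs &
   g != 0 /\ exists2 t, block_pt t z.1 z.2 & L2 t = g * z.1 /\ L1 t = - (g * z.2).
  move=> [a b] [t Pt] /=.
  have C0 := block_cross P1 P2 P3 Pt.
  have rel : a * L1 t + b * L2 t = 0.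
    rewrite -C0 /cross_det /L1 /L2 /U /V /e12 /e23; ring.
  have [_ e _ a0 _] := Pt.
  have co : coprimez a b by have [] := coprime_of_form (k := 3) isT e.
  have [g hg] : exists g, L2 t = g * a.
    apply/dvdzP; rewrite -(@Gauss_dvdzr _ b) //.
    by apply/dvdzP; exists (- L1 t); apply/eqP; rewrite -subr_eq0; apply/eqP; rewrite -rel; ring.
  have hg1 : L1 t = - (g * b).
    apply: (mulfI a0); apply/eqP; rewrite -subr_eq0; apply/eqP; rewrite -rel hg; ring.
  have gW : (g %| W)%Z.
    have d1 : (g %| V * e13 * (t3 - t))%Z.
      have -> : V * e13 * (t3 - t) = - (a3 * L1 t + b3 * L2 t).
        by rewrite /L1 /L2 /e13; ring.
      rewrite hg hg1; apply/dvdzP; exists (a3 * b - b3 * a); ring.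
    have d2 : (g %| U * e13 * (t1 - t))%Z.
      have -> : U * e13 * (t1 - t) = - (a1 * L1 t + b1 * L2 t).
        by rewrite /L1 /L2 /e13; ring.
      rewrite hg hg1; apply/dvdzP; exists (a1 * b - b1 * a); ring.
    have -> : W = V * (U * e13 * (t1 - t)) - U * (V * e13 * (t3 - t)) by rewrite /W; ring.
    by rewrite rpredB // dvdz_mull.
  have gn : g != 0 by apply: contraNneq W0 => g0; move: gW; rewrite g0 dvd0z.
  exists g; last by split=> //; exists t.
  have gd : `|g|%N \in divisors `|W|%N by rewrite -dvdn_divisors // -dvdzE.
  rewrite mem_cat; have [gp|gm] := leP 0 g.
    by apply/orP; left; apply/mapP; exists `|g|%N => //; rewrite gez0_abs.
  by apply/orP; right; apply/mapP; exists `|g|%N => //; rewrite ltz0_abs // opprK.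
pose B g z := g != 0 /\ exists2 t, block_pt t z.1 z.2 & L2 t = g * z.1 /\ L1 t = - (g * z.2).
have Bfew g : at_most (B g) 4.
  have [//|[s [us ss sB]]] := at_most_or_uniq (B g) 4.
  exfalso.
  have g0 : g != 0 by case: s us ss sB => // z s _ _ /(_ z (mem_head _ _)) [].
  have tP z : exists t, z \in s -> block_pt t z.1 z.2 /\ (L2 t = g * z.1 /\ L1 t = - (g * z.2)).
    have [zs|zs] := boolP (z \in s); last by exists 0.
    by have [_ [t h h']] := sB z zs; exists t.
  have [tf tfP] := choice tP.
  (* Substituting a = L2(t)/g and b = -L1(t)/g into the cubic equation gives the quartic; five pairs
     have five different parameters because t determines (a, b). *)
  apply: (@quartic_nonconstant x0 y0 p q (U * b3 - V * b1) (V * b1 * t3 - U * b3 * t1)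
     (V * a1 - U * a3) (U * a3 * t1 - V * a1 * t3) g (map tf s)) => //.
  - rewrite map_inj_in_uniq // => z z' /tfP[Pz _] /tfP[Pz' _] tt; rewrite tt in Pz.
    by have [h1 h2] := block_pt_inj Pz Pz'; rewrite [z]surjective_pairing [z']surjective_pairing h1 h2.
  - by rewrite size_map.
  move=> t /mapP[z /tfP[[_ e _ _ _] [l2 l1]] ->].
  have -> : (V * a1 - U * a3) * tf z + (U * a3 * t1 - V * a1 * t3) = g * z.1.
    by rewrite -l2 /L2; ring.
  have -> : (U * b3 - V * b1) * tf z + (V * b1 * t3 - U * b3 * t1) = - (g * z.2).
    by rewrite -l1 /L1; ring.
  by rewrite -[RHS]mulr1 -e; ring.
apply: (at_mostW (at_most_bigcup (r := gs) (fun g _ => Bfew g)) (m := (size gs * 4)%N)) => //.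
by rewrite size_cat !size_map; move: Kd; clear; lia.
Qed.
End LineBlock.

(** * Divisor bound, Dirichlet approximation and the middle range *)

Lemma size_divisors_pfactor p e m : prime p -> (0 < m)%N -> coprime p m ->
  (size (divisors (p ^ e * m)) <= e.+1 * size (divisors m))%N.
Proof.
move=> pp m0 co; have p0 := prime_gt0 pp.
have -> : (e.+1 * size (divisors m) =
  size [seq (p ^ i * d)%N | i <- iota 0 e.+1, d <- divisors m])%N.
  by rewrite size_allpairs size_iota.
apply: uniq_leq_size (divisors_uniq _) _ => d.
rewrite -dvdn_divisors ?muln_gt0 ?expn_gt0 ?p0 // => dd.
have d0 : (0 < d)%N by apply: dvdn_gt0 dd; rewrite muln_gt0 expn_gt0 p0.
have [d' co' dE] := pfactor_coprime pp d0.
apply/allpairsP; exists (logn p d, d'); split; last by rewrite /= mulnC.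
  rewrite mem_iota /= add0n ltnS.
  have : (p ^ logn p d %| p ^ e * m)%N by apply: dvdn_trans dd; rewrite {2}dE dvdn_mull.
  by rewrite Gauss_dvdl ?dvdn_Pexp2l ?prime_gt1 // coprimeXl.
rewrite -dvdn_divisors //.
have : (d' %| p ^ e * m)%N by apply: dvdn_trans dd; rewrite {1}dE dvdn_mulr.
by rewrite Gauss_dvdr // coprime_sym coprimeXl.
Qed.

Lemma expn_le_pow2 E e : (0 < E)%N -> (e.+1 ^ E <= 2 * E ^ E * 2 ^ e)%N.
Proof.
move=> E0.
have h : (e.+1 <= E * 2 ^ (e.+1 %/ E))%N.
  apply: (@leq_trans (E * (e.+1 %/ E).+1)); first by rewrite ltnW // mulnC ltn_ceil.
  by rewrite leq_mul2l ltn_expl ?orbT.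
apply: (@leq_trans ((E * 2 ^ (e.+1 %/ E)) ^ E)); first by rewrite leq_exp2r.
rewrite expnMn -expnM -mulnA [(2 * _)%N]mulnCA leq_mul2l -expnS leq_exp2l //.
by rewrite leq_trunc_div orbT.
Qed.

(** An exponent e at a prime p >= 2^E costs nothing, since (e+1)^E <= 2^(eE) <= p^e; each of the
    fewer than 2^E smaller primes costs at most a factor [K], by [expn_le_pow2]. *)
Lemma divisor_bound E : (0 < E)%N ->
  exists C, forall n, (0 < n)%N -> (size (divisors n) ^ E <= C * n)%N.
Proof.
move=> E0; pose K := (2 * E ^ E)%N.
have K0 : (0 < K)%N by rewrite muln_gt0 expn_gt0 E0.
have step c p n m : prime p -> (0 < m)%N -> coprime p m -> n = (m * p ^ logn p n)%N ->
    (size (divisors m) ^ E <= c * m)%N ->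
    ((p < 2 ^ E)%N -> (size (divisors n) ^ E <= K * c * n)%N) /\
    ((2 ^ E <= p)%N -> (size (divisors n) ^ E <= c * n)%N).
  move=> pp m0 co; set e := logn p n => nE hm.
  have h1 : (size (divisors n) ^ E <= e.+1 ^ E * (c * m))%N.
    rewrite nE mulnC; apply: (@leq_trans ((e.+1 * size (divisors m)) ^ E)).
      by rewrite leq_exp2r // size_divisors_pfactor.
    by rewrite expnMn leq_mul2l hm orbT.
  split=> pE; apply: (leq_trans h1); rewrite {1}nE.
    have : (e.+1 ^ E <= K * p ^ e)%N.
      apply: (leq_trans (expn_le_pow2 e E0)); rewrite leq_mul2l.
      have -> : (2 ^ e <= p ^ e)%N by case: (e) => [|e'] //; rewrite leq_exp2r // prime_gt1.
      by rewrite orbT.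
    by move=> h; rewrite (_ : (K * c * (m * p ^ e) = K * p ^ e * (c * m))%N) ?leq_mul2r ?h ?orbT //; ring.
  have : (e.+1 ^ E <= p ^ e)%N.
    apply: (@leq_trans ((2 ^ e) ^ E)); first by rewrite leq_exp2r // ltn_expl.
    rewrite -expnM mulnC expnM; case: (e) => // e'; by rewrite leq_exp2r.
  by move=> h; rewrite (_ : (c * (m * p ^ e) = p ^ e * (c * m))%N) ?leq_mul2r ?h ?orbT //; ring.
have big n : (0 < n)%N -> (forall p, prime p -> (p %| n)%N -> (2 ^ E <= p)%N) ->
    (size (divisors n) ^ E <= n)%N.
  elim/ltn_ind: n => n IH n0 hp.
  have [n1|n1] := leqP n 1; first by have -> : n = 1%N; [lia|rewrite (_ : divisors 1 = [:: 1%N]) ?exp1n].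
  have pp := pdiv_prime n1; have pn := pdiv_dvd n.
  have [m co mE] := pfactor_coprime pp n0.
  have m0 : (0 < m)%N by move: n0; rewrite mE; case: (m).
  have mn : (m < n)%N.
    rewrite {1}mE -{1}[m]muln1 ltn_mul2l m0 -{1}(expn0 (pdiv n)) ltn_exp2l ?prime_gt1 //.
    by rewrite logn_gt0 mem_primes pp n0.
  have hm : (size (divisors m) ^ E <= 1 * m)%N.
    rewrite mul1n; apply: IH => // p pr pm; apply: hp => //.
    by rewrite mE dvdn_mulr.
  by have [_ /(_ (hp _ pp pn))] := step _ _ _ _ pp m0 co mE hm; rewrite mul1n.
have main P : (P <= 2 ^ E)%N -> forall n, (0 < n)%N ->
    (forall p, prime p -> (p %| n)%N -> (2 ^ E - P <= p)%N) ->
    (size (divisors n) ^ E <= K ^ P * n)%N.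
  elim: P => [_ n n0|P IH hP n n0 hp]; first by rewrite subn0 mul1n; apply: big.
  set p := (2 ^ E - P.+1)%N in hp.
  have pS : p.+1 = (2 ^ E - P)%N by rewrite /p; lia.
  have [pp|npp] := boolP (prime p); last first.
    apply: (@leq_trans (K ^ P * n)); last by rewrite leq_mul2r expnS leq_pmull ?orbT.
    apply: IH => //; first exact: ltnW.
    move=> r rp rn; rewrite -pS ltn_neqAle hp // andbT.
    by apply: contraNneq npp => ->.
  have [m co mE] := pfactor_coprime pp n0.
  have m0 : (0 < m)%N by move: n0; rewrite mE; case: (m).
  have hm : (size (divisors m) ^ E <= K ^ P * m)%N.
    apply: IH => //; first exact: ltnW.
    move=> r rp rm; rewrite -pS ltn_neqAle hp //; last by rewrite mE dvdn_mulr.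
    rewrite andbT; apply: contraTneq co => ->.
    by rewrite prime_coprime // rm.
  have [/(_ _)] := step _ _ _ _ pp m0 co mE hm; rewrite expnS => h _; apply: h.
  by rewrite /p; lia.
exists (K ^ 2 ^ E)%N => n n0; apply: main => // p _ _.
by rewrite subnn.
Qed.

(** Pigeonhole: the residues of x i modulo y, for i from 0 to Q, fall into Q classes of length y/Q.
    Dividing p and q by their gcd preserves the inequality. *)
Lemma dirichlet_approx (x y Q : nat) : (0 < y)%N -> (0 < Q)%N ->
  exists p q : nat, [/\ (0 < q <= Q)%N, coprime p q &
    `|q%:Z * x%:Z - p%:Z * y%:Z| * Q%:Z < y%:Z].
Proof.
move=> y0 Q0.
have flt (i : 'I_Q.+1) : ((Q * (x * i %% y)) %/ y < Q)%N.
  by rewrite ltn_divLR // ltn_mul2l Q0 ltn_pmod.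
pose f i := Ordinal (flt i).
have : ~~ injectiveb f.
  by apply/negP => /injectiveP /leq_card; rewrite !card_ord ltnn.
case/injectivePn => i [j ij fij].
wlog lt_ij : i j ij fij / (i < j)%N.
  move=> wl; have [|] := ltnP i j; first exact: wl.
  rewrite leq_eqVlt => /orP[/eqP h|]; last by apply: wl; rewrite // eq_sym.
  by move: ij; rewrite -(inj_eq val_inj) /= h eqxx.
have {}fij : ((Q * (x * i %% y)) %/ y = (Q * (x * j %% y)) %/ y)%N.
  by have := congr1 (fun k : 'I_Q => nat_of_ord k) fij.
pose q := (j - i)%N; pose p := (x * j %/ y - x * i %/ y)%N.
have hq : (0 < q <= Q)%N by have := ltn_ord j; rewrite /q; lia.
have le_ij : (x * i %/ y <= x * j %/ y)%N by rewrite leq_div2r // leq_mul2l (ltnW lt_ij) orbT.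
have hd : `|q%:Z * x%:Z - p%:Z * y%:Z| * Q%:Z < y%:Z.
  have ei := divn_eq (Q * (x * i %% y)) y; have ej := divn_eq (Q * (x * j %% y)) y.
  have mi := ltn_pmod (Q * (x * i %% y)) y0; have mj := ltn_pmod (Q * (x * j %% y)) y0.
  have -> : q%:Z * x%:Z - p%:Z * y%:Z = (x * j %% y)%N%:Z - (x * i %% y)%N%:Z.
    have := divn_eq (x * i) y; have := divn_eq (x * j) y.
    move: le_ij lt_ij; rewrite /q /p; move: (x * i %/ y)%N (x * j %/ y)%N => u v uv lij ej' ei'.
    rewrite -(subzn uv) -(subzn (ltnW lij)).
    have : (x * j)%N%:Z = v%:Z * y%:Z + (x * j %% y)%N%:Z by rewrite {1}ej' PoszD PoszM.
    have : (x * i)%N%:Z = u%:Z * y%:Z + (x * i %% y)%N%:Z by rewrite {1}ei' PoszD PoszM.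
    rewrite !PoszM => h1 h2.
    have -> : (x * j %% y)%N%:Z = x%:Z * j%:Z - v%:Z * y%:Z by rewrite h2; ring.
    have -> : (x * i %% y)%N%:Z = x%:Z * i%:Z - u%:Z * y%:Z by rewrite h1; ring.
    ring.
  rewrite -(ger0_norm (le0z_nat Q)) -normrM mulrBl.
  move: ei ej mi mj; rewrite fij.
  move: (x * i %% y)%N (x * j %% y)%N => ri rj.
  move: (Q * ri %% y)%N (Q * rj %% y)%N (Q * rj %/ y)%N => si sj w ei ej mi mj.
  have : (Q * ri)%N%:Z = (w * y)%N%:Z + si%:Z by rewrite ei.
  have : (Q * rj)%N%:Z = (w * y)%N%:Z + sj%:Z by rewrite ej.
  rewrite !(PoszM Q) [rj%:Z * _]mulrC [ri%:Z * _]mulrC => -> ->.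
  by move: mi mj; clear; lia.
have g0 : (0 < gcdn p q)%N by rewrite gcdn_gt0; case/andP: hq => ->; rewrite orbT.
exists (p %/ gcdn p q)%N, (q %/ gcdn p q)%N; split.
- case/andP: hq => q0 qQ; rewrite divn_gt0 // dvdn_leq ?dvdn_gcdr //=.
  by apply: leq_trans qQ; apply: leq_div.
- have := g0; rewrite /coprime -(eqn_pmul2r g0) mul1n muln_gcdl !divnK ?dvdn_gcdl ?dvdn_gcdr //.
apply: le_lt_trans hd; apply: ler_wpM2r => //.
have qE : q%:Z = (q %/ gcdn p q)%N%:Z * (gcdn p q)%:Z by rewrite -PoszM divnK ?dvdn_gcdr.
have pE : p%:Z = (p %/ gcdn p q)%N%:Z * (gcdn p q)%:Z by rewrite -PoszM divnK ?dvdn_gcdl.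
rewrite qE pE.
set q' := (q %/ _)%N; set p' := (p %/ _)%N; set g := gcdn p q.
rewrite (_ : q'%:Z * g%:Z * x%:Z - p'%:Z * g%:Z * y%:Z = g%:Z *
  (q'%:Z * x%:Z - p'%:Z * y%:Z)); last by ring.
by rewrite normrM ler_peMl // ger0_norm.
Qed.

(** * Summation over all lines *)

Lemma PoszX m e : (m ^ e)%N%:Z = m%:Z ^+ e.
Proof. by elim: e => // e IH; rewrite expnS PoszM IH exprS. Qed.

Definition int_range (D : nat) : seq int := [seq (i : nat)%:Z - D%:Z | i <- iota 0 (2 * D + 1)].

Lemma mem_int_range D (d : int) : `|d| <= D%:Z -> d \in int_range D.
Proof.
move=> h; apply/mapP; exists `|(d + D%:Z)%R|%N; last by lia.
by rewrite mem_iota; lia.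
Qed.

Lemma size_int_range D : size (int_range D) = (2 * D + 1)%N.
Proof. by rewrite size_map size_iota. Qed.

Section MiddleRange.
Variables (n Y ym tau Q K : nat).
Hypotheses (ym0 : (0 < ym)%N) (n_small : (2 * n < ym ^ 3)%N) (Q0 : (0 < Q)%N).
Hypotheses (tau0 : (0 < tau)%N) (Y_lt : (Y < ym * Q)%N).
Let D := (Y %/ Q)%N.
Let W := (Y %/ ym).+1.
Hypothesis small : (8 * n ^ 2 * Y ^ 6 * tau ^ 2 + 24 * n ^ 3 * D * tau ^ 3 * Y ^ 7
    + 6 * n ^ 4 * D ^ 4 * tau ^ 6 * Y ^ 4 < ym ^ 12)%N.
Hypothesis K_div : forall m : nat, (0 < m)%N ->
  (m <= (2 * n ^ 2) ^ 3 * tau ^ 3)%N -> (size (divisors m) <= K)%N.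

Definition middle_pt (z : int * int) (x y : nat) :=
  [/\ (ym <= x <= Y)%N /\ (ym <= y <= Y)%N, z.1 * x%:Z ^+ 3 + z.2 * y%:Z ^+ 3 = 1,
      `|z.1| <= n%:Z /\ `|z.2| <= n%:Z & z.1 != 0].

(** The parameter on the line is y / q up to a shift, and j numbers its windows of length [tau]. *)
Definition on_line (p q : nat) (d : int) (j : nat) (z : int * int) :=
  exists x y, [/\ middle_pt z x y, q%:Z * x%:Z - p%:Z * y%:Z = d & ((y %/ q) %/ tau)%N = j].

Lemma line_block_few p q d j : (0 < p)%N -> (0 < q)%N -> coprime p q -> `|d| <= D%:Z ->
  at_most (on_line p q d j) (8 * K + 4).
Proof.
move=> p0 q0 co dD.
have [[z1 [x1 [y1 [P1 d1 j1]]]]|nA] := EM (exists z, on_line p q d j z); last first.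
  by exists [::]; split=> // z Az; case: nA; exists z.
(* Parameters are counted from the point (x1, y1), so window j starts at j tau - y1 / q. *)
have := @block_few n%:Z Y%:Z ym%:Z tau%:Z D%:Z x1%:Z y1%:Z p%:Z q%:Z
  ((j * tau)%N%:Z - (y1 %/ q)%N%:Z) K.
have p0z : p%:Z != 0 by rewrite eqz_nat -lt0n.
have q0z : q%:Z != 0 by rewrite eqz_nat -lt0n.
move=> /(_ p0z q0z) h; apply: at_mostW (h _ _ _ _ _) _ _ => //.
  by rewrite d1.
move=> z [x [y [[[/andP[xm xY] /andP[ym' yY]] e zn z0] dE jE]]].
have yq : (q%:Z %| y%:Z - y1%:Z)%Z.
  rewrite -(@Gauss_dvdzr _ p%:Z); last by rewrite coprimezE /= coprime_sym.
  apply/dvdzP; exists (x%:Z - x1%:Z); move: dE; rewrite -d1 => /eqP.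
  rewrite -subr_eq0 => /eqP E; apply/eqP; rewrite -subr_eq0 -oppr_eq0; apply/eqP.
  by rewrite -E; ring.
have [t tE] := dvdzP yq.
have tq : t = (y %/ q)%N%:Z - (y1 %/ q)%N%:Z.
  have : (y %% q = y1 %% q)%N.
    apply/eqP; rewrite -eqz_nat -!modz_nat eqz_mod_dvd //.
  have := divn_eq y q; have := divn_eq y1 q.
  move: (y %/ q)%N (y1 %/ q)%N (y %% q)%N (y1 %% q)%N => u v r r' ey1 ey rr.
  move: tE; rewrite ey ey1 rr !PoszD !PoszM => tE.
  apply: (mulIf q0z); rewrite -tE; ring.
have xE : x1%:Z + p%:Z * t = x%:Z.
  apply: (mulfI q0z); apply/eqP; rewrite -subr_eq0; apply/eqP.
  have : q%:Z * x%:Z - p%:Z * y%:Z - (q%:Z * x1%:Z - p%:Z * y1%:Z) = 0 by rewrite dE d1 subrr.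
  have -> : y%:Z = t * q%:Z + y1%:Z by rewrite -tE subrK.
  by move=> E; apply/eqP; rewrite -oppr_eq0 -[X in _ == X]E; apply/eqP; ring.
have yE : y1%:Z + q%:Z * t = y%:Z by rewrite mulrC -tE; ring.
exists t; split; rewrite ?xE ?yE //.
  rewrite tq -jE.
  have := divn_eq (y %/ q) tau; have := ltn_pmod (y %/ q) tau0.
  move: ((y %/ q) %/ tau)%N ((y %/ q) %% tau)%N => a b hb ->.
  by move: (y1 %/ q)%N hb; clear; lia.
Qed.

(** For given q there are at most W q numerators p, and on each line at most Y / (q tau) + 1
    windows: the factor q cancels, up to the summand Q. As D is Y / Q, the bound has the order W K
    Y^2 / tau when Q tau <= Y, so what is saved is [tau]. *)
Lemma middle_range_few :
  at_most (fun z => exists x y, middle_pt z x y)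
    (Q * (W * ((2 * D + 1) * ((Y %/ tau + Q) * (8 * K + 4)))))%N.
Proof.
pose B := ((Y %/ tau + Q) * (8 * K + 4))%N.
pose A4 q p d z := exists2 j, j \in iota 0 (Y %/ (q * tau)).+1 & on_line p q d j z.
pose A3 q p z := exists2 d, d \in int_range D & A4 q p d z.
pose A2 q z := exists2 p, p \in [seq p <- iota 1 (W * q) | coprime p q] & A3 q p z.
have h4 q p d : (0 < p)%N -> (0 < q)%N -> coprime p q -> `|d| <= D%:Z ->
   at_most (A4 q p d) ((Y %/ (q * tau)).+1 * (8 * K + 4)).
  move=> p0 q0 co dD.
  have := @at_most_bigcup _ _ (iota 0 (Y %/ (q * tau)).+1) (on_line p q d) (8 * K + 4).
  by rewrite size_iota; apply=> j _; apply: line_block_few.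
have h3 q p : (0 < p)%N -> (0 < q)%N -> coprime p q ->
   at_most (A3 q p) ((2 * D + 1) * ((Y %/ (q * tau)).+1 * (8 * K + 4))).
  move=> p0 q0 co; rewrite -size_int_range; apply: at_most_bigcup => d.
  by move/mapP => [i]; rewrite mem_iota => hi ->; apply: h4 => //; move: D hi; clear; lia.
have h2 q : (0 < q <= Q)%N -> at_most (A2 q) (W * ((2 * D + 1) * B)).
  move=> /andP[q0 qQ].
  have : at_most (A2 q) (size [seq p <- iota 1 (W * q) | coprime p q] *
    ((2 * D + 1) * ((Y %/ (q * tau)).+1 * (8 * K + 4)))).
    apply: at_most_bigcup => p; rewrite mem_filter mem_iota => /and3P[co p0 _].
    exact: h3.
  move=> h; apply: at_mostW h _ _ => //.
  apply: (@leq_trans (W * q * ((2 * D + 1) * ((Y %/ (q * tau)).+1 * (8 * K + 4))))).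
    rewrite leq_mul2r; apply/orP; right; rewrite size_filter.
    by apply: leq_trans (count_size _ _) _; rewrite size_iota.
  rewrite -mulnA leq_mul2l; apply/orP; right.
  rewrite mulnCA leq_mul2l; apply/orP; right; rewrite /B mulnA leq_mul2r; apply/orP; right.
  rewrite mulnS addnC leq_add // [(q * tau)%N]mulnC divnMA.
  by rewrite mulnC leq_trunc_div.
have := @at_most_bigcup _ _ (iota 1 Q) A2 (W * ((2 * D + 1) * B)).
rewrite size_iota => /(_ _) h; apply: at_mostW (h _) _ _ => //.
  by move=> q; rewrite mem_iota => hq; apply: h2; move: hq; clear; lia.
move=> z [x [y P]]; have [[/andP[xm xY] /andP[yl yY]] e zn z0] := P.
have y0 : (0 < y)%N by apply: leq_trans yl.
have [p [q [/andP[q0 qQ] co hd]]] := dirichlet_approx x y0 Q0.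
have dy : `|q%:Z * x%:Z - p%:Z * y%:Z| < y%:Z.
  by apply: le_lt_trans hd; rewrite ler_peMr.
(* For p = 0 the approximation would give q x Q < y, against [Y_lt]. *)
have p0 : (0 < p)%N.
  rewrite lt0n; apply/negP => /eqP p0; move: hd; rewrite p0 mul0r subr0 -PoszM -abszE.
  rewrite -PoszM ltz_nat /= ltnNge => /negP; apply.
  apply: (leq_trans yY); apply: (leq_trans (ltnW Y_lt)); rewrite leq_mul2r; apply/orP; right.
  by apply: (leq_trans xm); rewrite leq_pmull.
exists q; first by rewrite mem_iota; move: q0 qQ; clear; lia.
exists p.
  rewrite mem_filter co mem_iota p0 /= add1n ltnS.
  have xW : (x <= W * y)%N.
    apply: (leq_trans xY); apply: (@leq_trans (W * ym)); first by rewrite ltnW // ltn_ceil.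
    by rewrite leq_mul2l yl orbT.
  have : (p * y < q * x + y)%N.
    by move: dy; rewrite -ltz_nat PoszD !PoszM; move: (q%:Z * _) (p%:Z * _) => u v; clear; lia.
  move=> py; have : (p * y < (W * q).+1 * y)%N.
    apply: (leq_trans py); rewrite mulSn addnC leq_add2l mulnAC mulnC leq_mul2r.
    by rewrite xW orbT.
  by rewrite ltn_mul2r => /andP[_]; rewrite ltnS.
exists (q%:Z * x%:Z - p%:Z * y%:Z).
  apply: mem_int_range; rewrite -abszE lez_nat leq_divRL //.
  apply: (leq_trans _ yY); rewrite -lez_nat PoszM abszE; exact: ltW.
exists ((y %/ q) %/ tau)%N; last by exists x, y.
by rewrite mem_iota /= add0n ltnS -divnMA leq_div2r.
Qed.
End MiddleRange.

(** * Pairs with a solution of bounded size *)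

Definition solves (k n : nat) (z : int * int) (x y : nat) :=
  [/\ `|z.1| <= n%:Z, `|z.2| <= n%:Z, z.1 != 0 /\ z.2 != 0 &
      z.1 * x%:Z ^+ k + z.2 * y%:Z ^+ k = 1].

Lemma solves_swap k n a b x y : solves k n (a, b) x y -> solves k n (b, a) y x.
Proof. by move=> [/= an bn [a0 b0] e]; split; rewrite //= addrC. Qed.

Lemma at_most_residue (n m : nat) (A : int -> Prop) : (0 < m)%N ->
  (forall a, A a -> `|a| <= n%:Z) -> (forall a a', A a -> A a' -> (m%:Z %| a - a')%Z) ->
  at_most A ((2 * n) %/ m).+1.
Proof.
move=> m0 An Am.
have [[a0 A0]|nA] := EM (exists a, A a); last first.
  by exists [::]; split=> // a Aa; case: nA; exists a.
have m0z : m%:Z != 0 by rewrite eqz_nat -lt0n.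
exists [seq (i : nat)%:Z * m%:Z + ((a0 + n%:Z) %% m%:Z)%Z - n%:Z | i <- iota 0 ((2 * n) %/ m).+1].
rewrite size_map size_iota; split=> // a Aa.
have an := An a Aa.
have nn : 0 <= a + n%:Z by move: an; clear; lia.
apply/mapP; exists `|((a + n%:Z) %/ m%:Z)%Z|%N.
  rewrite mem_iota /= add0n ltnS.
  have -> : (a + n%:Z) = `|(a + n%:Z)%R|%N%:Z by rewrite gez0_abs.
  by rewrite divz_nat /= leq_div2r //; move: an; clear; lia.
have -> : ((a0 + n%:Z) %% m%:Z)%Z = ((a + n%:Z) %% m%:Z)%Z.
  apply/eqP; rewrite eqz_mod_dvd.
  by rewrite (_ : a0 + n%:Z - (a + n%:Z) = a0 - a) ?Am //; ring.
rewrite gez0_abs; last by rewrite divz_ge0 // ltz_nat.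
by rewrite -divz_eq; ring.
Qed.

Lemma solves_few_y k n x y : (0 < k)%N -> (0 < y)%N ->
  at_most (fun z => solves k n z x y) ((2 * n) %/ y ^ k).+1.
Proof.
move=> k0 y0; have yk0 : (0 < y ^ k)%N by rewrite expn_gt0 y0.
have ykz : (y%:Z ^+ k) != 0 by rewrite -PoszX eqz_nat -lt0n.
have h : at_most (fun a => exists b, solves k n (a, b) x y) ((2 * n) %/ y ^ k).+1.
  apply: at_most_residue => //; first by move=> a [b []].
  move=> a a' [b [_ _ _ /= e]] [b' [_ _ _ /= e']].
  have [co _] := coprime_of_form k0 e; rewrite PoszX.
  rewrite -(@Gauss_dvdzl _ _ (x%:Z ^+ k)); last by rewrite coprimez_sym.
  apply/dvdzP; exists (b' - b); apply/eqP; rewrite -subr_eq0; apply/eqP.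
  by rewrite -(subrr 1) -{1}e -e'; ring.
pose f a := (a, ((1 - a * x%:Z ^+ k) %/ y%:Z ^+ k)%Z).
apply: at_mostW (at_most_image f h) _ _ => // -[a b] s.
exists a; first by exists b.
have [_ _ _ /= e] := s.
by rewrite /f -e addrC addKr mulzK.
Qed.

(** If y is the larger coordinate, a is fixed modulo y^k and then determines b. *)
Lemma solves_few k n x y : (0 < k)%N -> (0 < x)%N -> (0 < y)%N ->
  at_most (fun z => solves k n z x y) ((2 * n) %/ (maxn x y) ^ k).+1.
Proof.
move=> k0 x0 y0; have [xy|yx] := leqP x y; first exact: solves_few_y.
have h := at_most_image (fun z : int * int => (z.2, z.1)) (solves_few_y n y k0 x0).
by apply: at_mostW h _ _ => // -[a b] /solves_swap s; exists (b, a).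
Qed.

Lemma sum_div_square N T : (\sum_(1 <= X < T.+1) N %/ X ^ 2 <= 2 * N)%N.
Proof.
(* The term N / T strengthens the claim for the induction, which is 1/T^2 <= 1/(T-1) - 1/T. *)
suff h : (0 < T)%N -> ((\sum_(1 <= X < T.+1) N %/ X ^ 2)%N%:R + N%:R / T%:R <= 2 * N%:R :> rat).
  case: T h => [_|T h]; first by rewrite big_geq.
  have {}h := h isT; rewrite -(ler_nat rat) natrM; apply: le_trans h.
  by rewrite lerDl divr_ge0.
elim: T => // T IH _; case: T IH => [_|T /(_ isT) IH].
  by rewrite big_nat1 exp1n divn1 divr1 mulr_natl mulr2n.
rewrite big_nat_recr //= natrD.
apply: le_trans IH; rewrite -addrA lerD2l.
have hd : (N %/ T.+2 ^ 2)%N%:R <= N%:R / T.+2%:R ^+ 2 :> rat.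
  rewrite ler_pdivlMr ?exprn_gt0 // -natrX -natrM ler_nat leq_trunc_div //.
apply: (le_trans (lerD hd (lexx _))).
have t1 : T.+1%:R != 0 :> rat by rewrite pnatr_eq0.
have t2 : T.+1%:R + 1 != 0 :> rat by rewrite natr1 pnatr_eq0.
have -> : T.+2%:R = T.+1%:R + 1 :> rat by rewrite natr1.
rewrite -subr_ge0 [X in 0 <= X](_ : _ = N%:R / (T.+1%:R * (T.+1%:R + 1) ^+ 2)).
  by rewrite divr_ge0 // mulr_ge0 // exprn_ge0 // addr_ge0.
by move: (T.+1%:R) (N%:R) t1 t2 => u v t1 t2; field; rewrite t1 t2.
Qed.

(** There are at most 2 X pairs (x, y) with maximum X, each with at most 2 n / X^k + 1 pairs (a, b).
    For k >= 3 the sum of X n / X^k is O(n), and the ones add up to 2 T^2. *)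
Lemma solves_small_few k n T : (2 < k)%N ->
  at_most (fun z => exists x y, [/\ (0 < x <= T)%N, (0 < y <= T)%N & solves k n z x y])
    (8 * n + 2 * T ^ 2).
Proof.
move=> k2; have k0 : (0 < k)%N by lia.
pose A2 X z := exists2 u : nat, u \in iota 1 X &
  (solves k n z u X \/ solves k n z X u).
have h2 X : (0 < X)%N -> at_most (A2 X) (X * (((2 * n) %/ X ^ k).+1 + ((2 * n) %/ X ^ k).+1)).
  move=> X0; rewrite -{2}(size_iota 1 X); apply: at_most_bigcup => u.
  rewrite mem_iota add1n ltnS => /andP[u0 uX]; apply: at_mostU.
    by have := solves_few n k0 u0 X0; rewrite (maxn_idPr uX).
  by have := solves_few n k0 X0 u0; rewrite (maxn_idPl uX).
have := @at_most_sum _ _ (index_iota 1 T.+1) A2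
   (fun X => X * (((2 * n) %/ X ^ k).+1 + ((2 * n) %/ X ^ k).+1))%N.
move=> /(_ _) h; apply: at_mostW (h _) _ _.
- by move=> X; rewrite mem_index_iota => /andP[X0 _]; apply: h2.
- move=> z [x [y [/andP[x0 xT] /andP[y0 yT] s]]].
  have [xy|yx] := leqP x y.
    exists y; first by rewrite mem_index_iota y0 ltnS.
    by exists x; [rewrite mem_iota x0 add1n ltnS|left].
  exists x; first by rewrite mem_index_iota x0 ltnS.
  by exists y; [rewrite mem_iota y0 add1n ltnS ltnW|right].
apply: (@leq_trans (\sum_(1 <= X < T.+1) (2 * ((2 * n) %/ X ^ 2) + 2 * T))).
  rewrite [leqLHS]big_nat [leqRHS]big_nat; apply: leq_sum => X /andP[X0 XT].
  rewrite addnn -mul2n mulnCA -mulnDr leq_mul2l /= mulnS addnC leq_add //.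
  rewrite leq_divRL ?expn_gt0 ?X0 //.
  apply: (@leq_trans ((2 * n) %/ X ^ k * X ^ k)); last exact: leq_trunc_div.
  move: ((2 * n) %/ X ^ k)%N => w; rewrite (_ : (X * w * X ^ 2 = w * X ^ 3)%N).
    by rewrite leq_mul2l leq_pexp2l ?orbT.
  by rewrite !expnS expn0; clear; ring.
rewrite big_split /= -big_distrr /= sum_nat_const_nat subn1 /=.
have := sum_div_square (2 * n) T; move: (\sum_(1 <= X < T.+1) _)%N => S hS.
by rewrite expnS expn1 mulnCA leq_add2r; move: hS; clear; lia.
Qed.

Definition soluble_over_int (k n : nat) (z : int * int) :=
  [/\ `|z.1| <= n%:Z, `|z.2| <= n%:Z, z.1 != 0 /\ z.2 != 0 &
      exists x y : int, z.1 * x ^+ k + z.2 * y ^+ k = 1].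

Lemma unit_of_mulX (b y : int) k : (0 < k)%N -> b * y ^+ k = 1 -> b \in [:: 1; -1].
Proof.
move=> k0 e; have : `|b|%N = 1%N.
  by have /eqP := congr1 absz e; rewrite abszM muln_eq1 => /andP[/eqP].
by rewrite !inE; clear; lia.
Qed.

(** If x or y is 0, a coefficient is 1 or -1, which accounts for 4 (2 n + 1). Otherwise the signs of
    x^k and y^k are moved into a and b, in one of 4 ways. *)
Lemma soluble_over_int_few k n m : (0 < k)%N ->
  at_most (fun z => exists x y, [/\ (0 < x)%N, (0 < y)%N & solves k n z x y]) m ->
  at_most (soluble_over_int k n) (4 * (2 * n + 1) + 4 * m).
Proof.
move=> k0 hm; set P := fun z => _ in hm.
have hs (s t : int) := at_most_image (fun z : int * int => (s * z.1, t * z.2)) hm.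
have h1 : at_most (fun z : int * int => z.1 \in [:: 1; -1] /\ `|z.2| <= n%:Z) (2 * (2 * n + 1)).
  rewrite -[X in (X * _)%N]/(size [:: 1%:Z; -1]) -size_int_range.
  exists [seq (i, j) | i <- [:: 1; -1], j <- int_range n]; rewrite size_allpairs; split=> //.
  move=> [a b] [ha hb]; apply/allpairsP; exists (a, b); split=> //=.
  exact: mem_int_range.
have h2 := at_most_image (fun z : int * int => (z.2, z.1)) h1.
apply: at_mostW (at_mostU (at_mostU h1 h2)
   (at_mostU (at_mostU (hs 1 1) (hs 1 (-1))) (at_mostU (hs (-1) 1) (hs (-1) (-1))))) _ _;
  last by clear; lia.
move=> [a b] [/= an bn [a0 b0] [x [y e]]].
have [x0|x0] := eqVneq x 0.
  left; right; exists (b, a) => //=; split=> //.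
  by apply: (@unit_of_mulX b y k) => //; rewrite -e x0 expr0n gtn_eqF // mulr0 add0r.
have [y0|y0] := eqVneq y 0.
  left; left => /=; split=> //.
  by apply: (@unit_of_mulX a x k) => //; rewrite -e y0 expr0n gtn_eqF // mulr0 addr0.
right.
have sgn (u : int) : u != 0 -> exists2 s : int, (s = 1 \/ s = -1) &
     (u ^+ k = s * (`|u|%N)%:Z ^+ k).
  move=> u0; have [up|um] := leP 0 u; first by exists 1; [left|rewrite mul1r gez0_abs].
  exists ((-1) ^+ k); first by rewrite -signr_odd; case: (odd k); rewrite ?expr1 ?expr0; [right|left].
  by rewrite ltz0_abs // -exprMn mulN1r opprK.
have [s hs' ex] := sgn x x0; have [t ht ey] := sgn y y0.
have ss : s * s = 1 by case: hs' => ->.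
have tt : t * t = 1 by case: ht => ->.
have Pst : P (s * a, t * b).
  exists `|x|%N, `|y|%N; rewrite !absz_gt0 x0 y0; split=> //.
  split=> /=.
  - by case: hs' => ->; rewrite ?mul1r ?mulN1r ?normrN.
  - by case: ht => ->; rewrite ?mul1r ?mulN1r ?normrN.
  - by case: hs' => ->; case: ht => ->; rewrite ?mul1r ?mulN1r ?oppr_eq0.
  by rewrite -e ex ey; ring.
have zE : (a, b) = (s * (s * a), t * (t * b)) by rewrite !mulrA ss tt !mul1r.
by case: hs' zE Pst => -> zE Pst; case: ht zE Pst => -> zE Pst; [left; left|left; right|right; left|right; right];
  eexists; eauto.
Qed.

(** * Cyclotomic numbers of order three *)

Lemma card_le_fibers (T U : finType) (g : T -> U) (D : {set T}) m :
  (forall y, #|[set x in D | g x == y]| <= m)%N -> (#|D| <= m * #|g @: D|)%N.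
Proof.
move=> fib; rewrite -sum1_card (partition_big g (mem (g @: D))) /=; last first.
  by move=> x xD; apply: imset_f.
rewrite mulnC -sum_nat_const; apply: leq_sum => y _.
by apply: leq_trans (fib y); rewrite sum1dep_card subset_leq_card.
Qed.

Lemma card_roots (F : finFieldType) (P : {poly F}) : P != 0 ->
  (#|[set x | root P x]| < size P)%N.
Proof.
move=> P0; rewrite cardE; apply: max_poly_roots => //; last exact: enum_uniq.
by apply/allP => x; rewrite mem_enum inE.
Qed.

Section Cyclotomic.
Variables (F : finFieldType) (f : nat).
Hypotheses (cardF : #|F| = (3 * f).+1) (f3 : (2 < f)%N).

Let f0 : (0 < f)%N. Proof. exact: leq_trans f3. Qed.

Lemma expf3f (x : F) : x != 0 -> x ^+ (3 * f) = 1.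
Proof.
by move=> x0; apply: (mulfI x0); rewrite -exprS -cardF expf_card mulr1.
Qed.

Lemma cube_expf (x : F) : x != 0 -> (x ^+ f) ^+ 3 = 1.
Proof. by move=> x0; rewrite -exprM mulnC expf3f. Qed.

Lemma expf_class (c : F) : (#|[set x : F | x ^+ f == c]| <= f)%N.
Proof.
have P0 : ('X^f - c%:P : {poly F}) != 0 by rewrite -size_poly_eq0 size_XnsubC.
have := card_roots P0; rewrite size_XnsubC // ltnS.
congr (_ <= _)%N; apply: eq_card => x; rewrite !inE /root !hornerE.
by rewrite subr_eq0.
Qed.

Section Class.
Variable w : F.
Hypotheses (w1 : w != 1) (w3 : w ^+ 3 = 1).

Lemma w_neq0 : w != 0.
Proof. by apply: contraTneq (oner_neq0 F) => w0; rewrite -w3 w0 expr0n eqxx. Qed.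

Lemma w2_neq1 : w ^+ 2 != 1.
Proof. by apply: contraNneq w1 => h; rewrite -w3 exprS h mulr1. Qed.

Lemma w2_neqw : w ^+ 2 != w.
Proof. by apply: contraNneq w1 => h; apply/eqP/(mulfI w_neq0); rewrite mulr1 -expr2 h. Qed.

Lemma classP (x : F) : x != 0 -> [\/ x ^+ f = 1, x ^+ f = w | x ^+ f = w ^+ 2].
Proof.
move=> x0; have e := cube_expf x0; set y := x ^+ f in e *.
have s : w ^+ 2 + w + 1 = 0.
  apply: (mulfI (_ : w - 1 != 0)); first by rewrite subr_eq0.
  rewrite mulr0 (_ : _ * _ = w ^+ 3 - 1); first by rewrite w3 subrr.
  by ring.
have : (y - 1) * ((y - w) * (y - w ^+ 2)) = 0.
  have -> : (y - 1) * ((y - w) * (y - w ^+ 2)) = y ^+ 3 - (w ^+ 2 + w + 1) * y ^+ 2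
     + (w * w ^+ 2 + (w ^+ 2 + w)) * y - w * w ^+ 2 by ring.
  have -> : w ^+ 2 + w = -1 by apply/eqP; rewrite -subr_eq0 opprK s.
  by rewrite -exprS w3 e; ring.
move/eqP; rewrite !mulf_eq0 !subr_eq0 => /orP[/eqP|/orP[/eqP|/eqP]] h.
- by apply: Or31.
- by apply: Or32.
- by apply: Or33.
Qed.

(** With x^f as the cubic character these are the cyclotomic numbers of order three; the classes are
    named by cube roots of unity, so no generator of the multiplicative group is chosen. *)
Definition ncyc (c d : F) := #|[set x : F | (x ^+ f == c) && ((1 - x) ^+ f == d)]|.
Arguments ncyc (c d)%_R.

Lemma ncycC c d : ncyc c d = ncyc d c.
Proof.
rewrite /ncyc -(card_imset _ (_ : injective (fun x : F => 1 - x))); last first.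
  by move=> x y /addrI /oppr_inj.
apply: eq_card => x; rewrite inE; apply/imsetP/idP.
  by move=> [y]; rewrite inE => /andP[h1 h2] ->; rewrite subKr h1 h2.
by move=> /andP[h1 h2]; exists (1 - x); rewrite ?subKr // inE subKr h1 h2.
Qed.

Lemma expN1f : (-1 : F) ^+ f = 1.
Proof.
have -> : -1 = (-1) ^+ 3 :> F by rewrite exprS sqrrN expr1n mulr1.
by rewrite -exprM expf3f // oppr_eq0 oner_neq0.
Qed.

Lemma expfN (x : F) : (- x) ^+ f = x ^+ f.
Proof. by rewrite -mulN1r exprMn expN1f mul1r. Qed.

Definition nsum (c d n : F) := #|[set x : F | (x ^+ f == c) && ((n - x) ^+ f == d)]|.
Arguments nsum (c d n)%_R.

Lemma nsumE c d n : n != 0 -> nsum c d n = ncyc (c / n ^+ f) (d / n ^+ f).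
Proof.
move=> n0; have nf : n ^+ f != 0 by rewrite expf_neq0.
rewrite /nsum /ncyc -[RHS](card_imset _ (mulfI n0)); apply: eq_card => x.
rewrite inE; apply/idP/imsetP.
  move=> /andP[/eqP h1 /eqP h2]; exists (x / n); last by rewrite mulrC divfK.
  rewrite inE expr_div_n h1 eqxx /=.
  by rewrite -h2 -expr_div_n mulrBl mulfV.
move=> [y]; rewrite inE => /andP[/eqP h1 /eqP h2] ->.
rewrite exprMn h1 mulrC divfK // eqxx /=.
by rewrite -{1}(mulr1 n) -mulrBr exprMn h2 mulrC divfK.
Qed.

(** Substitute 1/x for x; -1 is a cube and does not change the class. *)
Lemma ncycV c d : c != 0 -> ncyc c d = ncyc (c^-1) (d / c).
Proof.
move=> c0.
have nz x : x ^+ f = c -> x != 0 by move=> h; apply: contraNneq c0 => x0; rewrite -h x0 expr0n gtn_eqF.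
have inj : {in [set x : F | (x ^+ f == c) && ((1 - x) ^+ f == d)] &, injective (@GRing.inv F)}.
  by move=> x y _ _; apply: invr_inj.
rewrite /ncyc -(card_in_imset inj); apply: eq_card => x; rewrite inE; apply/imsetP/idP.
  move=> [y]; rewrite inE => /andP[/eqP h1 /eqP h2] ->.
  have y0 := nz _ h1; rewrite exprVn h1 eqxx /= -h2 -h1 -expr_div_n mulrBl mulfV // mul1r.
  by rewrite -expfN opprB.
move=> /andP[/eqP h1 /eqP h2]; exists (x^-1); last by rewrite invrK.
have x0 : x != 0 by apply: contraTneq (invr_neq0 c0) => x0; rewrite -h1 x0 expr0n gtn_eqF // negbK.
rewrite inE exprVn h1 invrK eqxx /=.
have -> : 1 - x^-1 = - ((1 - x) / x) by rewrite mulrBl mulfV // mul1r opprB.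
by rewrite expfN expr_div_n h2 h1 invrK divfK.
Qed.

Lemma expf_eq_w_neq0 (x : F) : x ^+ f = w -> x != 0.
Proof. by move=> h; apply: contraTneq w_neq0 => x0; rewrite -h x0 expr0n gtn_eqF // negbK. Qed.

Let wV : w^-1 = w ^+ 2.
Proof. by apply: (mulfI w_neq0); rewrite mulfV ?w_neq0 // -exprS w3. Qed.
Let w2V : (w ^+ 2)^-1 = w.
Proof. by rewrite -wV invrK. Qed.
Let w20 : w ^+ 2 != 0. Proof. by rewrite expf_neq0 // w_neq0. Qed.
Let ww2 : w * w ^+ 2 = 1. Proof. by rewrite -exprS. Qed.
Let w2w : w ^+ 2 * w = 1. Proof. by rewrite mulrC. Qed.

Lemma ncyc_w2_1 : ncyc (w ^+ 2) 1 = ncyc w w.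
Proof. by rewrite [RHS]ncycV ?w_neq0 // wV ww2. Qed.
Lemma ncyc_w2_w2 : ncyc (w ^+ 2) (w ^+ 2) = ncyc 1 w.
Proof. by rewrite [RHS]ncycC [RHS]ncycV ?w_neq0 // wV mul1r. Qed.

Lemma card_class c : c \in [:: 1; w; w ^+ 2] -> #|[set x : F | x ^+ f == c]| = f.
Proof.
have le1 := expf_class 1; have le2 := expf_class w; have le3 := expf_class (w ^+ 2).
have : (3 * f <= #|[set x : F | x ^+ f == 1%R]| + #|[set x : F | x ^+ f == w]|
   + #|[set x : F | x ^+ f == w ^+ 2]|)%N.
  have -> : (3 * f = #|~: [set (0%R : F)]|)%N by rewrite cardsC1 cardF.
  apply: leq_trans (leq_add (leq_card_setU _ _) (leqnn _)).
  apply: leq_trans (leq_card_setU _ _); apply: subset_leq_card.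
  apply/subsetP => x; rewrite !inE => /classP [->|->|->]; rewrite eqxx ?orbT //.
by move=> h; rewrite !inE => /or3P[] /eqP->; move: h le1 le2 le3; clear; lia.
Qed.

Lemma sum_by_class (G : F -> nat) (D : {set F}) : 0 \notin D ->
  (\sum_(x in D) G x = \sum_(x in D | x ^+ f == 1%R) G x + \sum_(x in D | x ^+ f == w) G x
    + \sum_(x in D | x ^+ f == w ^+ 2) G x)%N.
Proof.
move=> D0; rewrite (bigID (fun x : F => x ^+ f == 1)) /= -addnA; congr (_ + _)%N.
rewrite (bigID (fun x : F => x ^+ f == w)) /=; congr (_ + _)%N; apply: eq_bigl => x.
  have [xw|] := eqVneq (x ^+ f) w; rewrite ?andbF ?andbT //.
  by rewrite xw w1 andbT.
have [xD|//] := boolP (x \in D); rewrite /=.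
have /classP [->|->|->] : x != 0 by apply: contraNneq D0 => <-.
- by rewrite eqxx [RHS]eq_sym (negPf w2_neq1).
- by rewrite eqxx andbF [RHS]eq_sym (negPf w2_neqw).
- by rewrite w2_neq1 w2_neqw eqxx.
Qed.

Lemma card_by_class (c : F) :
  #|[set x : F | (x ^+ f == c) && (x != 1)]| = (ncyc c 1 + ncyc c w + ncyc c (w ^+ 2))%N.
Proof.
set D := [set x : F | _].
have h (e : F) : e != 0 -> ncyc c e = #|[set x in D | (1 - x) ^+ f == e]|.
  move=> e0; apply: eq_card => x; rewrite !inE; have [->|_] := eqVneq x 1; last by rewrite andbT.
  by rewrite subrr expr0n gtn_eqF // mulr0n [0 == e]eq_sym (negPf e0) !andbF.
rewrite !h ?oner_neq0 ?w_neq0 //.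
have -> : #|D| = (\sum_(y in [set (1 - x)%R | x in D]) 1)%N.
  by rewrite sum1_card card_imset // => x y /addrI /oppr_inj.
rewrite sum_by_class; last first.
  apply/imsetP => -[x]; rewrite inE => /andP[_ x1] /eqP.
  by rewrite eq_sym subr_eq0 eq_sym (negPf x1).
have im (e : F) : (\sum_(y in [set (1 - x)%R | x in D] | y ^+ f == e) 1)%N =
    #|[set x in D | (1 - x) ^+ f == e]|.
  rewrite sum1dep_card -[RHS](card_imset _ (_ : injective (fun x : F => 1 - x))); last first.
    by move=> x y /addrI /oppr_inj.
  apply: eq_card => y; rewrite inE; apply/andP/imsetP.
    by move=> [/imsetP[x xD ->] e1]; exists x => //; rewrite inE xD.
  by move=> [x]; rewrite inE => /andP[xD e1] ->; split=> //; apply: imset_f.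
by rewrite !im.
Qed.

(** The successor accounts for x = 1, where 1 - x = 0 lies in no class. *)
Lemma row1 : (ncyc 1 1 + ncyc 1 w + ncyc 1 (w ^+ 2)).+1 = f.
Proof.
rewrite -card_by_class -[RHS](@card_class 1) ?inE ?eqxx //.
rewrite [RHS](cardsD1 1) inE expr1n eqxx add1n; congr _.+1; apply: eq_card => x.
by rewrite !inE andbC.
Qed.

Lemma roww : (ncyc w 1 + ncyc w w + ncyc w (w ^+ 2))%N = f.
Proof.
rewrite -card_by_class -[RHS](@card_class w) ?inE ?eqxx ?orbT //.
apply: eq_card => x; rewrite !inE; have [xw|//] := eqVneq (x ^+ f) w.
by rewrite /=; apply: contraNneq w1 => x1; rewrite -xw x1 expr1n.
Qed.

(** By the symmetries (1, w^2) = (w, w) and (1, w) = (w, 1), the two row sums give (w, w^2) = (1, 1)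
    + 1. *)
Lemma ncyc_w_w2_gt0 : (0 < ncyc w (w ^+ 2))%N.
Proof.
have := row1; have := roww; rewrite (ncycC 1 (w ^+ 2)) ncyc_w2_1 (ncycC w 1).
by clear; lia.
Qed.

(* Write A, B, C, D for the cyclotomic numbers (1,1), (1,w), (w,w), (w,w^2).  Counting
   k + k' + x = n, with k, k' cubes and x in the class of w, in two ways gives
   A D + B^2 = B D if C = 0, and the row sums then force f <= 2. *)
Lemma ncyc_w_w_gt0 : (0 < ncyc w w)%N.
Proof.
rewrite lt0n; apply/eqP => C0.
have C0' : ncyc 1 (w ^+ 2) = 0%N by rewrite ncycC ncyc_w2_1.
have C0'' : ncyc (w ^+ 2) 1 = 0%N by rewrite ncyc_w2_1.
have r1 := row1; have rw := roww; rewrite C0' addn0 in r1; rewrite C0 addn0 (ncycC w 1) in rw.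
(* The total n is taken in the class of w^2: then in both ways of grouping k + k' + x = n some
   products contain C and vanish. *)
have [x0 x00 x0w] : exists2 n : F, n != 0 & n ^+ f = w ^+ 2.
  have : (0 < #|[set x : F | x ^+ f == w ^+ 2]|)%N by rewrite card_class ?inE ?eqxx ?orbT.
  case/card_gt0P => n; rewrite inE => /eqP h; exists n => //.
  by apply: contraTneq w20 => n0; rewrite -h n0 expr0n gtn_eqF // negbK.
move: x0 x00 x0w => n n0 nw.
pose K c := [set x : F | x ^+ f == c].
have K0 c : c != 0 -> 0 \notin K c by move=> c0; rewrite inE expr0n gtn_eqF // eq_sym.
pose S (g : F -> nat) (c d : F) := (\sum_(x in K c | (n - x)%R ^+ f == d) g x)%N.
have Sconst (g : F -> nat) c d m : (forall x, x ^+ f = c -> (n - x) ^+ f = d -> g x = m) ->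
    S g c d = (nsum c d n * m)%N.
  move=> gm; rewrite /S /nsum -sum_nat_const; apply: eq_big => x; first by rewrite !inE.
  by rewrite !inE => /andP[/eqP h1 /eqP h2]; apply: gm.
pose T := (\sum_(k in K 1%R) nsum 1 w (n - k))%N.
have T1 : T = (ncyc 1 w * ncyc w (w ^+ 2))%N.
  have nk0 k : k \in K 1%R -> n - k != 0.
    rewrite inE => k1; rewrite subr_eq0; apply: contraNneq w2_neq1 => nk.
    by rewrite -nw nk.
  rewrite /T (bigID (fun k => (n - k) ^+ f == 1%R)) /=.
  rewrite [X in (_ + X)%N](bigID (fun k => (n - k) ^+ f == w)) /=.
  rewrite -/(S (fun k => nsum 1 w (n - k)) 1 1) (@Sconst _ 1 1 (ncyc 1 w)); last first.
    move=> k k1 nk1; rewrite nsumE ?nk1 ?divr1 // nk0 // inE k1 //.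
  rewrite nsumE // nw w2V !mul1r C0 mul0n add0n.
  rewrite big1 ?add0n; last first.
    move=> k /andP[/andP[kK _] /eqP nkw]; rewrite nsumE ?nk0 // nkw mul1r wV.
    by rewrite ww2 C0''.
  transitivity (S (fun k => nsum 1 w (n - k)) 1 (w ^+ 2)).
    apply: eq_bigl => k; have [kK|//] := boolP (k \in K 1%R); rewrite /=.
    have /classP [->|->|->] := nk0 k kK.
    - by rewrite eqxx [RHS]eq_sym (negPf w2_neq1).
    - by rewrite eqxx andbF [RHS]eq_sym (negPf w2_neqw).
    - by rewrite w2_neq1 w2_neqw eqxx.
  rewrite (@Sconst _ 1 (w ^+ 2) (ncyc w (w ^+ 2))); last first.
    by move=> k k1 nk1; rewrite nsumE ?nk0 ?inE ?k1 // nk1 w2V mul1r -expr2.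
  by rewrite nsumE // nw w2V mul1r w2w ncycC.
have T2 : T = (ncyc 1 1 * ncyc w (w ^+ 2) + ncyc 1 w * ncyc 1 w)%N.
  (* The second grouping is by s = k + k', which is n minus an element of the class of w. *)
  pose Q := [set s : F | (n - s) ^+ f == w].
  have TQ : T = (\sum_(s in Q) nsum 1 1 s)%N.
    transitivity (\sum_(k in K 1%R) \sum_(s in Q) ((s - k)%R ^+ f == 1%R))%N.
      apply: eq_bigr => k kK; rewrite /nsum -big_mkcondr /= sum1dep_card.
      rewrite -(card_imset _ (@addrI _ k)); apply: eq_card => s; rewrite inE; apply/imsetP/andP.
        move=> [x]; rewrite inE => /andP[x1 x2] ->; rewrite inE addrAC subrr add0r x1; split=> //.
        by rewrite opprD addrA.
      rewrite inE => -[h1 h2]; exists (s - k); last by rewrite addrC subrK.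
      by rewrite inE h2 opprB addrA subrK.
    rewrite exchange_big /=; apply: eq_bigr => s sQ.
    rewrite /nsum -big_mkcondr /= sum1dep_card; apply: eq_card => k.
    by rewrite !inE.
  rewrite TQ sum_by_class; last first.
    by rewrite inE subr0 nw w2_neqw.
  have St (g : F -> nat) c : (\sum_(x in Q | x ^+ f == c) g x)%N = S g c w.
    by apply: eq_bigl => x; rewrite !inE andbC.
  rewrite !St (@Sconst _ 1 w (ncyc 1 1)); last first.
    move=> s s1 _; rewrite nsumE ?s1 ?divr1 //.
    by apply: contraTneq (oner_neq0 F) => s0; rewrite -s1 s0 expr0n gtn_eqF // eqxx.
  rewrite (@Sconst _ w w (ncyc 1 w)); last first.
    move=> s s1 _; rewrite nsumE ?(expf_eq_w_neq0 s1) // s1 mul1r wV; exact: ncyc_w2_w2.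
  rewrite (@Sconst _ (w ^+ 2) w 0%N); last first.
    move=> s s1 _; rewrite nsumE ?s1 ?w2V ?mul1r //.
    by apply: contraTneq w20 => s0; rewrite -s1 s0 expr0n gtn_eqF // negbK.
  rewrite muln0 addn0 !nsumE // nw w2V mul1r -expr2 ncyc_w2_w2 mulnC; congr (_ + _)%N.
have E : (ncyc 1 1 * ncyc w (w ^+ 2) + ncyc 1 w * ncyc 1 w = ncyc 1 w * ncyc w (w ^+ 2))%N.
  by rewrite -T2 T1.
move: r1 rw E f3; move: (ncyc 1 1) (ncyc 1 w) (ncyc w (w ^+ 2)) => A B D; clear => r1 rw E f3.
(* With D = A + 1 the relation is quadratic in B with discriminant (A + 1)(1 - 3 A); so A = 0, B <=
   1 and f = B + 1 <= 2. *)
have DA : D = A.+1 by lia.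
have B1 : (B <= 1)%N by nia.
nia.
Qed.
End Class.

(** Cubing has fibres of at most 3 elements on the 3 f units, so its image has at least f elements
    and fills the set x^f = 1, which has at most f. *)
Lemma cubeP (x : F) : x != 0 -> x ^+ f = 1 -> exists y, x = y ^+ 3.
Proof.
move=> x0 xf; pose D := ~: [set (0%R : F)].
have fib y : (#|[set x in D | x ^+ 3 == y]| <= 3)%N.
  have P0 : ('X^3 - y%:P : {poly F}) != 0 by rewrite -size_poly_eq0 size_XnsubC.
  have := card_roots P0; rewrite size_XnsubC // ltnS; apply: leq_trans.
  apply: subset_leq_card; apply/subsetP => z; rewrite !inE /root !hornerE.
  by rewrite subr_eq0 => /andP[].
have := card_le_fibers fib; rewrite cardsC1 cardF /= leq_pmul2l // => h.
have sub : [set x ^+ 3 | x in D] \subset [set x : F | x ^+ f == 1%R].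
  apply/subsetP => z /imsetP[y]; rewrite !inE => y0 ->.
  by rewrite -exprM expf3f.
have := expf_class 1 => h1.
have /eqP E : [set x ^+ 3 | x in D] == [set x : F | x ^+ f == 1%R].
  by rewrite eqEcard sub (leq_trans h1).
have : x \in [set x : F | x ^+ f == 1%R] by rewrite inE xf.
by rewrite -E => /imsetP[y _ ->]; exists y.
Qed.

(** If a or b is a cube, one term suffices. Otherwise a^f is a primitive cube root of unity and can
    serve as [w]; then b is in the class of w or of w^2, and both cyclotomic numbers are
    positive. *)
Lemma diagonal_cubic_solvable (a b : F) : a != 0 -> b != 0 ->
  exists x y, a * x ^+ 3 + b * y ^+ 3 = 1.
Proof.
move=> a0 b0.
have key (u c : F) : c != 0 -> u ^+ f = c ^+ f -> exists z, u = c * z ^+ 3.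
  move=> c0 uc; have u0 : u != 0.
    apply: contraNneq c0 => u0; move: uc; rewrite u0 expr0n gtn_eqF // mulr0n => /esym/eqP.
    by rewrite expf_eq0 => /andP[].
  have uc0 : u / c != 0 by rewrite mulf_neq0 // invr_eq0.
  have [z zE] : exists z, u / c = z ^+ 3.
    by apply: cubeP => //; rewrite expr_div_n uc mulfV // expf_neq0.
  by exists z; rewrite -zE mulrC divfK.
have z3 : 0 ^+ 3 = 0 :> F by rewrite expr0n.
have [a1|a1] := eqVneq (a ^+ f) 1.
  have [|z zE] := key 1 a a0; first by rewrite expr1n a1.
  by exists z, 0; rewrite z3 mulr0 addr0.
have [b1|b1] := eqVneq (b ^+ f) 1.
  have [|z zE] := key 1 b b0; first by rewrite expr1n b1.
  by exists 0, z; rewrite z3 mulr0 add0r.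
have : (0 < ncyc (a ^+ f) (b ^+ f))%N.
  have [e|e|e] := classP a1 (cube_expf a0) b0.
  - by rewrite e eqxx in b1.
  - rewrite e; exact: ncyc_w_w_gt0 (cube_expf a0).
  - rewrite e; exact: ncyc_w_w2_gt0 (cube_expf a0).
case/card_gt0P => u; rewrite inE => /andP[/eqP ua /eqP ub].
have [x xE] := key _ _ a0 ua; have [y yE] := key _ _ b0 ub.
by exists x, y; rewrite -xE -yE addrC subrK.
Qed.
End Cyclotomic.

(** * Power residues in an interval *)

(** The integers b = (w^k mod u) + u m with m < n / u do not exceed n. At most k pairs (w, m) yield
    the same b, since w is a root of X^k - b and w and b determine m. The 4 comes from (u - 1)
    floor(n / u) >= n / 4. *)
Lemma power_residues_many k n u : (0 < k)%N -> prime u -> (u <= n)%N ->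
  exists bs : seq nat, [/\ uniq bs, (n <= 4 * k * size bs)%N &
    forall b, b \in bs -> (0 < b <= n)%N /\ exists2 w : 'F_u, w != 0 & b%:R = w ^+ k].
Proof.
move=> k0 up un; have u1 := prime_gt1 up; have u0 := prime_gt0 up.
pose T := ('F_u * 'I_(n %/ u))%type.
pose bval (z : T) : nat := (nat_of_ord (z.1 ^+ k) + u * z.2)%N.
have lt_u (w : 'F_u) : (nat_of_ord w < u)%N.
  by have := ltn_ord w; rewrite [X in (_ < X)%N](_ : _ = u) // Fp_cast.
have bv_lt z : (bval z < n.+1)%N.
  rewrite ltnS /bval; apply: (@leq_trans (u * (n %/ u))); last by rewrite mulnC leq_trunc_div.
  apply: (@leq_trans (u * z.2.+1)); last by rewrite leq_mul2l ltn_ord orbT.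
  by rewrite mulnS leq_add2r ltnW.
pose g z := Ordinal (bv_lt z).
pose D := [set z : T | z.1 != 0].
have castF (z : T) : (bval z)%:R = z.1 ^+ k :> 'F_u.
  rewrite /bval natrD natrM natr_Zp.
  by have -> : u%:R = 0 :> 'F_u; [apply/eqP; rewrite (pcharf0 (pchar_Fp up))|rewrite mul0r addr0].
have fib y : (#|[set z in D | g z == y]| <= k)%N.
  set A := [set z in D | _].
  have inj : {in A &, injective (fun z : T => z.1)}.
    move=> [w m] [w' m']; rewrite !inE => /andP[_ /eqP h1] /andP[_ /eqP h2] /= ww; subst w'.
    have := congr1 (fun i : 'I_n.+1 => nat_of_ord i) (etrans h1 (esym h2)); rewrite /= /bval /=.
    move/addnI/eqP; rewrite eqn_pmul2l // => /eqP mm.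
    by congr pair; apply: val_inj.
  rewrite -(card_in_imset inj).
  have P0 : ('X^k - ((nat_of_ord y)%:R)%:P : {poly 'F_u}) != 0 by rewrite -size_poly_eq0 size_XnsubC.
  have := card_roots P0; rewrite size_XnsubC // ltnS; apply: leq_trans.
  apply: subset_leq_card; apply/subsetP => w /imsetP[z]; rewrite !inE => /andP[_ /eqP <-] ->.
  by rewrite /root !hornerE /= castF subrr.
have cD : #|D| = ((u - 1) * (n %/ u))%N.
  have -> : D = setX (~: [set 0]) setT by apply/setP => -[w m]; rewrite !inE andbT.
  by rewrite cardsX cardsC1 card_Fp // cardsT card_ord subn1.
have le := card_le_fibers fib; rewrite cD in le.
exists [seq nat_of_ord y | y <- enum (g @: D)]; split.
- by rewrite map_inj_uniq ?enum_uniq //; apply: val_inj.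
- rewrite size_map -cardE.
  have lt := ltn_ceil n u0; have q1 : (0 < n %/ u)%N by rewrite divn_gt0.
  have aux q : (n < q.+1 * u)%N -> (0 < q)%N -> (n <= 4 * ((u - 1) * q))%N.
    by move=> ltq q0; apply: (leq_trans (ltnW ltq)); rewrite mulSn; move: u1 q0; clear; nia.
  by apply: (leq_trans (aux _ lt q1)); rewrite -mulnA leq_mul2l le.
move=> b /mapP[y]; rewrite mem_enum => /imsetP[z zD ->] ->.
split; last by exists z.1; [move: zD; rewrite inE|rewrite castF].
have bn : (bval z <= n)%N by rewrite -ltnS.
rewrite [nat_of_ord _]/(bval z) bn andbT lt0n; apply: contraTneq zD => b0; rewrite inE negbK.
have := castF z; rewrite /bval b0 => /esym/eqP; rewrite expf_eq0 => /andP[_ //].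
Qed.

From mathcomp Require Import finmap.
From mathcomp Require Import all_classical all_reals all_analysis.
Import numFieldNormedType.Exports.
Local Open Scope classical_set_scope.

(** * The abc conjecture and globally soluble pairs *)

(** This is the case eps = 1/E, raised to the power E so that only natural numbers occur. *)
Definition abc_nat (E C : nat) := forall a b c : int, a + b = c ->
  gcdz a (gcdz b c) = 1 -> a * b * c != 0 ->
  (maxn `|a| (maxn `|b| `|c|) ^ E <= C * radical `|(a * b * c)%R| ^ E.+1)%N.

Lemma abc_conjecture_nat (R : realType) E : abc_conjecture R -> (0 < E)%N ->
  exists C, abc_nat E C.
Proof.
move=> abc E0; have e0 : 0 < E%:R^-1 :> R by rewrite invr_gt0 ltr0n.
have [C hC] := abc _ e0.
(* The constant supplied by the conjecture has no prescribed sign, and taking E-th powers needs a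
   nonnegative one. *)
pose C1 := Num.max C 0; have C10 : 0 <= C1 by rewrite le_max lexx orbT.
exists (Num.truncn (C1 ^+ E)).+1 => a b c abc' g nz.
have {hC}h := hC a b c abc' g nz.
set M := maxn _ _ in h *; set r := radical _ in h *.
rewrite -(ler_nat R) natrM !natrX.
have r0 : 0 <= r%:R :> R by [].
have h1 : M%:R <= C1 * r%:R `^ (1 + E%:R^-1).
  by apply: (le_trans h); rewrite ler_wpM2r ?powR_ge0 // le_max lexx.
have h2 : M%:R ^+ E <= (C1 * r%:R `^ (1 + E%:R^-1)) ^+ E.
  by apply: lerXn2r => //; rewrite nnegrE ?mulr_ge0 ?powR_ge0.
apply: (le_trans h2); rewrite exprMn -(powR_mulrn E (powR_ge0 _ _)) -powRrM.
have -> : (1 + E%:R^-1) * E%:R = E.+1%:R :> R.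
  by rewrite mulrDl mul1r mulVf ?pnatr_eq0 -?lt0n // natr1.
rewrite powR_mulrn // ler_wpM2r ?exprn_ge0 //.
by apply: ltW; rewrite truncnS_gt.
Qed.

Lemma radical_leq n : (0 < n)%N -> (radical n <= n)%N.
Proof.
move=> n0; rewrite /radical {2}(prod_prime_decomp n0) prime_decompE big_map /=.
rewrite big_seq [leqRHS]big_seq; apply: leq_prod => p pn.
have pp : prime p by move: pn; rewrite mem_primes => /andP[].
have l0 : (0 < logn p n)%N by rewrite logn_gt0.
by rewrite -{1}(expn1 p) leq_pexp2l // prime_gt0.
Qed.

Lemma eq_radical m n : (primes m =i primes n) -> radical m = radical n.
Proof. by move=> /eq_primes; rewrite /radical => ->. Qed.

(** If x is the larger coordinate, the radical is at most |a| n x^2, while the left side of abc is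
    at least |a|^E x^(kE). Cancelling |a|^E leaves one factor |a| <= n on the right, hence n^(E+2);
    estimating |a| from below by 1 would give n^(2E+2). *)
Lemma abc_solves_bound E C k n z x y : abc_nat E C -> (0 < k)%N ->
  (0 < x)%N -> (0 < y)%N -> solves k n z x y ->
  (maxn x y ^ (k * E) <= C * n ^ (E + 2) * maxn x y ^ (2 * E + 2))%N.
Proof.
move=> abc k0; case: z => a b.
wlog yx : a b x y / (y <= x)%N.
  move=> wl x0 y0 s; case/orP: (leq_total y x) => h; first exact: (wl a b x y h).
  by rewrite maxnC; apply: (wl b a y x h) => //; exact: solves_swap.
move=> x0 y0 [/= an bn [a0 b0] e]; rewrite (maxn_idPl yx).
have xk0 : x%:Z ^+ k != 0 by rewrite -PoszX eqz_nat -lt0n expn_gt0 x0.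
have yk0 : y%:Z ^+ k != 0 by rewrite -PoszX eqz_nat -lt0n expn_gt0 y0.
have := abc _ _ _ e; rewrite !gcdz1 mulr1 => /(_ erefl).
have nz : a * x%:Z ^+ k * (b * y%:Z ^+ k) != 0 by rewrite !mulf_neq0.
move=> /(_ nz).
have -> : radical (absz (a * x%:Z ^+ k * (b * y%:Z ^+ k))) = radical (`|a| * x * (`|b| * y))%N.
  apply: eq_radical => p; rewrite -!PoszX !abszM !absz_nat.
  rewrite !primesM ?muln_gt0 ?absz_gt0 ?expn_gt0 ?a0 ?b0 ?x0 ?y0 //.
  by rewrite !primesX.
have A0 : (0 < `|a|)%N by rewrite absz_gt0.
have B0 : (0 < `|b|)%N by rewrite absz_gt0.
have An : (`|a| <= n)%N by rewrite -lez_nat abszE.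
have Bn : (`|b| <= n)%N by rewrite -lez_nat abszE.
rewrite -!PoszX !abszM !absz_nat.
move: `|a|%N `|b|%N A0 B0 An Bn => A B A0 B0 An Bn h.
have r : (radical (A * x * (B * y)) <= A * x * (B * y))%N.
  by apply: radical_leq; rewrite !muln_gt0 A0 B0 x0 y0.
have h1 : ((A * x ^ k) ^ E <= C * (A * x * (B * y)) ^ E.+1)%N.
  apply: (@leq_trans (C * radical (A * x * (B * y)) ^ E.+1)); last first.
    by rewrite leq_mul2l leq_exp2r ?r ?orbT.
  apply: leq_trans h; case: (E) => // E'; rewrite leq_exp2r // leq_max leqnn //.
have h2 : (A * x * (B * y) <= A * (n * x ^ 2))%N.
  by rewrite -mulnA leq_mul2l mulnCA leq_mul ?orbT // expnS expn1 leq_mul.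
have h3 : (A ^ E * x ^ (k * E) <= A ^ E * (C * n ^ (E + 2) * x ^ (2 * E + 2)))%N.
  rewrite expnM -expnMn; apply: (leq_trans h1).
  apply: (@leq_trans (C * (A * (n * x ^ 2)) ^ E.+1)); first by rewrite leq_mul2l leq_exp2r ?h2 ?orbT.
  rewrite expnMn expnMn -expnM (_ : 2 * E.+1 = 2 * E + 2)%N; last by rewrite mulnS addnC.
  rewrite (_ : C * (A ^ E.+1 * (n ^ E.+1 * x ^ (2 * E + 2))) =
    A * (A ^ E * (C * n ^ E.+1 * x ^ (2 * E + 2))))%N; last by rewrite expnS; ring.
  rewrite (_ : A ^ E * (C * n ^ (E + 2) * x ^ (2 * E + 2)) =
    n * (A ^ E * (C * n ^ E.+1 * x ^ (2 * E + 2))))%N.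
    by rewrite leq_mul2r An orbT.
  by rewrite addn2 (expnS n E.+1); ring.
by move: h3; rewrite leq_pmul2l // expn_gt0 A0.
Qed.

Lemma pow_absorb c h a b : (c <= h)%N -> (a < b)%N -> (c * h ^ a <= h ^ b)%N.
Proof.
move=> ch ab; case: h ch => [|h] ch; first by move: ch; rewrite leqn0 => /eqP->.
by apply: (@leq_trans (h.+1 ^ a.+1)); [rewrite expnS leq_mul2r ch orbT|rewrite leq_pexp2l].
Qed.

(* The bound X^((k-2)E-2) <= C n^(E+2) on X = max(x, y), solved for X in powers of h. *)
Lemma abc_confines E C k n h e A c z x y : abc_nat E C -> (2 < k)%N ->
  (0 < x)%N -> (0 < y)%N -> solves k n z x y -> (n <= A * h ^ c)%N -> (0 < h)%N ->
  (C * A ^ (E + 2) < h)%N -> (c * (E + 2) + e * (2 * E + 2) < e * (k * E))%N ->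
  (2 * E + 2 <= k * E)%N -> (maxn x y <= h ^ e)%N.
Proof.
move=> abc k2 x0 y0 s nA h0 hC hexp hE; rewrite leqNgt; apply/negP => lt.
have b := abc_solves_bound abc (leq_trans (isT : (0 < 3)%N) k2) x0 y0 s.
move: lt b; set X := maxn x y => lt b.
have {}b : (X ^ (k * E - (2 * E + 2)) <= C * n ^ (E + 2))%N.
  by move: b; rewrite -{1}(subnK hE) expnD leq_pmul2r // expn_gt0 (leq_ltn_trans _ lt).
have : (h ^ (e * (k * E - (2 * E + 2))) <= C * A ^ (E + 2) * h ^ (c * (E + 2)))%N.
  rewrite expnM; apply: leq_trans (leq_trans b _).
    by case: (_ - _)%N => // i; rewrite leq_exp2r // ltnW.
  by rewrite -mulnA leq_mul2l expnM -expnMn leq_exp2r ?addn2 // nA orbT.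
rewrite leqNgt => /negP; apply.
apply: (@leq_trans (h * h ^ (c * (E + 2)))).
  by rewrite ltn_pmul2r // expn_gt0 h0.
rewrite -expnS leq_pexp2l // mulnBr ltn_subRL addnC //.
Qed.

(** * Upper bounds for the number of globally soluble pairs *)

(** With n about h^(6k), abc confines x and y to h^(3k+1), slightly above n^(1/2), so that T^2 in
    [solves_small_few] is h^(6k+2). The value of [E] is the least that [abc_confines] admits at k =
    4, the tightest case. *)
Lemma soluble_over_int_upper_ge4 (R : realType) k : abc_conjecture R -> (3 < k)%N ->
  exists C h0, forall h n, (h0 <= h)%N -> (n <= 2 ^ (6 * k) * h ^ (6 * k))%N ->
    at_most (soluble_over_int k n) (C * h ^ (6 * k + 2)).
Proof.
move=> abc k3; pose E := (9 * k + 2)%N.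
have E0 : (0 < E)%N by rewrite /E addn2.
have [C hC] := abc_conjecture_nat abc E0.
set A := (2 ^ (6 * k))%N.
exists (40 * A + 12)%N, (C * A ^ (E + 2)).+1 => h n h0 nA.
have hpos : (0 < h)%N by apply: leq_trans h0.
have k2 : (2 < k)%N by apply: ltnW.
have hs := solves_small_few n (h ^ (3 * k + 1)) k2.
have := soluble_over_int_few (k := k) (n := n) (m := 8 * n + 2 * (h ^ (3 * k + 1)) ^ 2).
move=> /(_ _ _) hg; apply: at_mostW (hg _ _) _ _ => //.
- by apply: leq_trans k2.
- apply: at_mostW hs _ _ => // z [x [y [x0 y0 s]]].
  have := abc_confines hC k2 x0 y0 s nA hpos h0 (e := 3 * k + 1).
  move=> /(_ _ _) hX; exists x, y; rewrite x0 y0 /=.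
  suff : (maxn x y <= h ^ (3 * k + 1))%N by rewrite geq_max => /andP[-> ->].
  by apply: hX; rewrite /E; move: k3; clear; nia.
rewrite -expnM.
have -> : ((3 * k + 1) * 2 = 6 * k + 2)%N by clear; lia.
have p1 : (h ^ (6 * k) <= h ^ (6 * k + 2))%N by rewrite leq_pexp2l // leq_addr.
have p2 : (0 < h ^ (6 * k + 2))%N by rewrite expn_gt0 hpos.
have p3 : (n <= A * h ^ (6 * k + 2))%N by apply: (leq_trans nA); rewrite leq_mul2l p1 orbT.
move: p2 p3; move: (h ^ (6 * k + 2))%N (A) => H B; clear; nia.
Qed.

Lemma pow_term c A h n i a j b l d m e : (n <= A * h ^ i)%N ->
  (c * n ^ a * (h ^ j) ^ b * (h ^ l) ^ d * (h ^ m) ^ e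
   <= c * A ^ a * h ^ (i * a + j * b + l * d + m * e))%N.
Proof.
move=> nA; apply: (@leq_trans (c * (A * h ^ i) ^ a * (h ^ j) ^ b * (h ^ l) ^ d * (h ^ m) ^ e)).
  rewrite !leq_mul2r leq_mul2l; case: a => [|a]; first by rewrite !expn0 leqnn !orbT.
  by rewrite leq_exp2r // nA !orbT.
by rewrite expnMn -!expnM !expnD !mulnA.
Qed.

Lemma swap_few (A : int * int -> Prop) m : at_most A m ->
  at_most (fun z => A (z.2, z.1)) m.
Proof.
move=> /(at_most_image (fun z : int * int => (z.2, z.1))) h.
by apply: at_mostW h _ _ => // -[a b] Az; exists (b, a).
Qed.

Lemma box_few m n : at_most (fun z : int * int => `|z.1| <= m%:Z /\ `|z.2| <= n%:Z)
  ((2 * m + 1) * (2 * n + 1)).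
Proof.
exists [seq (i, j) | i <- int_range m, j <- int_range n].
rewrite size_allpairs !size_int_range; split=> // -[a b] [ha hb].
by apply/allpairsP; exists (a, b); split=> //; apply: mem_int_range.
Qed.

(** From |a| x^3 <= n y^3 + 1: the left side exceeds h^396, whereas y < h^98 keeps the right side
    below A h^394 + 1. *)
Lemma coord_lower A h n a b x y : (A.+1 < h)%N -> (n <= A * h ^ 100)%N ->
  solves 3 n (a, b) x y -> (h ^ 99 < x)%N -> (h ^ 99 < `|a|)%N -> (h ^ 98 <= y)%N.
Proof.
move=> hA nA [_ /= bn _ e] hx ha; rewrite leqNgt; apply/negP => hy.
have h1 : (`|a| * x ^ 3 <= n * y ^ 3 + 1)%N.
  have -> : (`|a| * x ^ 3 = `|(1 - b * y%:Z ^+ 3)%R|)%N.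
    by rewrite -e addrK abszM -PoszX absz_nat.
  apply: (@leq_trans (`|b| * y ^ 3 + 1)).
    by rewrite -[(y ^ 3)%N]absz_nat PoszX -abszM; move: (b * _) => u; clear; lia.
  by rewrite leq_add2r leq_mul2r -lez_nat abszE bn orbT.
have h2 : (h ^ 99 * (h ^ 99) ^ 3 <= `|a| * x ^ 3)%N.
  by rewrite leq_mul ?leq_exp2r // ltnW.
have h3 : (n * y ^ 3 <= A * h ^ 100 * (h ^ 98) ^ 3)%N.
  by rewrite leq_mul ?leq_exp2r // ltnW.
have hp : (0 < h)%N by apply: leq_trans hA.
have h4 : (0 < h ^ 394)%N by rewrite expn_gt0 hp.
move: (leq_trans h2 (leq_trans h1 (leq_add h3 (leqnn 1)))).
rewrite -mulnA -!expnM -!expnD leqNgt => /negP; apply.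
rewrite [in ltnRHS](_ : 99 + 99 * 3 = 1 + (1 + 394))%N // [in ltnLHS](_ : 100 + 98 * 3 = 394)%N //.
rewrite !expnD !expn1; move: (h ^ 394)%N h4 => u u0.
apply: (@leq_ltn_trans (A.+1 * u)); first by rewrite mulSn addnC leq_add2r.
by apply: (@leq_trans (h * u)); rewrite ?ltn_pmul2r // leq_pmull // muln_gt0 hp.
Qed.

(** Solutions up to h^99, and pairs with a coefficient up to h^99, contribute O(h^199). All others
    have h^98 <= x, y <= h^102 and fall under [middle_range_few]; there Q, W, D, Y / tau and K have
    the exponents 50, 4, 52, 77 and 1, with sum 184. *)
Lemma soluble_over_int_upper_3 (R : realType) A : abc_conjecture R -> (0 < A)%N ->
  exists C h0, forall h n, (h0 <= h)%N -> (n <= A * h ^ 100)%N ->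
    at_most (soluble_over_int 3 n) (C * h ^ 199).
Proof.
move=> abc A0.
(* 203 is the least E with 100 (E + 2) < 102 (E - 2), the condition of [abc_confines] for the bound
   h^102. *)
have [C hC] := abc_conjecture_nat (E := 203) abc isT.
(* Divisors are counted of integers up to (2 n^2)^3 tau^3 <= 8 A^6 h^675; the exponent 1/676 makes
   their number at most h. *)
have [Cd hCd] := divisor_bound (E := 676) isT.
exists (1000 * A.+1)%N, (C * A ^ (203 + 2) + 100 * A ^ 4 + Cd * (8 * A ^ 6) + 100).+1.
move=> h n hh nA.
have A14 : (A <= A ^ 4)%N by rewrite -{1}(expn1 A) leq_pexp2l.
have A24 : (A ^ 2 <= A ^ 4)%N by rewrite leq_pexp2l.
have A34 : (A ^ 3 <= A ^ 4)%N by rewrite leq_pexp2l.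
have hC1 : (C * A ^ (203 + 2) < h)%N.
  by move: hh; move: (C * _)%N (100 * _)%N (Cd * _)%N => u v w; clear; lia.
have hA4 : (100 * A ^ 4 + 100 < h)%N.
  by move: hh; move: (C * _)%N (100 * _)%N (Cd * _)%N => u v w; clear; lia.
have hCd1 : (Cd * (8 * A ^ 6) <= h)%N.
  by move: hh; move: (C * _)%N (100 * _)%N (Cd * _)%N => u v w; clear; lia.
have [c8 c24 c6 cA] : [/\ (8 * A ^ 2 <= h)%N, (24 * A ^ 3 <= h)%N, (6 * A ^ 4 <= h)%N & (A.+1 < h)%N].
  by move: hA4 A14 A24 A34; move: (A ^ 2)%N (A ^ 3)%N (A ^ 4)%N => u v w; clear; split; lia.
have c4 : (4 <= h)%N by apply: leq_trans (ltnW hA4); rewrite ltn_addl.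
have h0 : (0 < h)%N by apply: leq_trans c4.
have hp e : (0 < h ^ e)%N by rewrite expn_gt0 h0.
clear hh hA4 A14 A24 A34.
have divE i j : (h ^ (i + j) %/ h ^ j = h ^ i)%N by rewrite expnD mulnK.
have DE : (h ^ 102 %/ h ^ 50 = h ^ 52)%N by rewrite -[in RHS](divE 52 50).
have WE : (h ^ 102 %/ h ^ 98 = h ^ 4)%N by rewrite -[in RHS](divE 4 98).
have tE : (h ^ 102 %/ h ^ 25 = h ^ 77)%N by rewrite -[in RHS](divE 77 25).
have mid := @middle_range_few n (h ^ 102) (h ^ 98) (h ^ 25) (h ^ 50) h.
rewrite DE WE tE in mid.
have {}mid : at_most (fun z => exists x y, middle_pt n (h ^ 102) (h ^ 98) z x y) (144 * h ^ 199).
  apply: at_mostW (mid _ _ _ _ _ _ _) _ _ => //.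
  - rewrite -expnM; apply: (leq_ltn_trans (leq_mul (leqnn 2) nA)).
    apply: (@leq_trans (4 * (A * h ^ 100))).
      by rewrite ltn_mul2r muln_gt0 A0 hp.
    apply: (@leq_trans (h ^ 1 * (h ^ 1 * h ^ 100))).
      by rewrite leq_mul ?leq_mul ?expn1 // ltnW // ltnW.
    by rewrite -!expnD leq_pexp2l.
  - by rewrite -expnD ltn_exp2l // (leq_trans _ c4).
  (* The three summands have exponents 862, 1141 and 1166, against 12 * 98 = 1176 on the right. *)
  - have t1 := @pow_term 8 A h n 100 2 102 6 25 2 0 0 nA.
    have t2 := @pow_term 24 A h n 100 3 52 1 25 3 102 7 nA.
    have t3 := @pow_term 6 A h n 100 4 52 4 25 6 102 4 nA.
    rewrite !expn0 muln1 in t1; rewrite (expn1 (h ^ 52)) in t2.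
    have {}t1 : (8 * n ^ 2 * (h ^ 102) ^ 6 * (h ^ 25) ^ 2 <= h ^ 1170)%N.
      by apply: (leq_trans t1); apply: pow_absorb.
    have {}t2 : (24 * n ^ 3 * h ^ 52 * (h ^ 25) ^ 3 * (h ^ 102) ^ 7 <= h ^ 1170)%N.
      by apply: (leq_trans t2); apply: pow_absorb.
    have {}t3 : (6 * n ^ 4 * (h ^ 52) ^ 4 * (h ^ 25) ^ 6 * (h ^ 102) ^ 4 <= h ^ 1170)%N.
      by apply: (leq_trans t3); apply: pow_absorb.
    apply: (leq_ltn_trans (leq_add (leq_add t1 t2) t3)).
    rewrite -expnM; apply: (@leq_trans (4 * h ^ 1170)); last by apply: pow_absorb.
    by move: (h ^ 1170)%N (hp 1170%N) => u; clear; lia.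
  - move=> m m0 mle; rewrite -(@leq_exp2r _ _ 676) //.
    apply: (leq_trans (hCd m m0)); apply: (@leq_trans (Cd * (8 * A ^ 6 * h ^ 675))).
      rewrite leq_mul2l; apply/orP; right; apply: (leq_trans mle).
      have := @pow_term 8 A h n 100 6 25 3 0 0 0 0 nA.
      by rewrite !expn0 !muln1 expnMn -(expnM n).
    by rewrite mulnA; apply: pow_absorb.
  apply: (@leq_trans (h ^ 50 * (2 * h ^ 4 * (3 * h ^ 52 * (2 * h ^ 77 * (12 * h ^ 1)))))).
    do ?apply: leq_mul => //.
    - by move: (hp 4%N); move: (h ^ 4)%N => u; clear; lia.
    - by move: (hp 52%N); move: (h ^ 52)%N => u; clear; lia.
    - by rewrite mul2n -addnn leq_add2l leq_pexp2l.
    - by rewrite expn1; move: h0; clear; lia.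
  rewrite (_ : h ^ 50 * _ = 144 * (h ^ 50 * (h ^ 4 * (h ^ 52 * (h ^ 77 * h ^ 1)))))%N.
    by rewrite -!expnD leq_mul2l leq_pexp2l.
  by move: (h ^ 50)%N (h ^ 4)%N (h ^ 52)%N (h ^ 77)%N (h ^ 1)%N; clear => *; ring.
have sm := @solves_small_few 3 n (h ^ 99) isT.
have bx := box_few (h ^ 99) n.
have all := at_mostU (at_mostU sm mid) (at_mostU bx (swap_few bx)).
apply: at_mostW (soluble_over_int_few (k := 3) (n := n) isT (at_mostW all _ (leqnn _))) _ _ => //.
  move=> z [x [y [x0 y0 s]]].
  have xyY : (maxn x y <= h ^ 102)%N.
    by apply: (abc_confines hC _ x0 y0 s nA h0 hC1); rewrite //; clear; lia.
  have [mx|mx] := leqP (maxn x y) (h ^ 99).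
    left; left; exists x, y; rewrite x0 y0 /=; move: mx; rewrite geq_max => /andP[-> ->].
    by split.
  have [an bn [a0 b0] e] := s.
  have [ha|ha] := leqP `|z.1|%N (h ^ 99).
    by right; left; rewrite -abszE lez_nat.
  have [hb|hb] := leqP `|z.2|%N (h ^ 99).
    by right; right; rewrite /= -abszE lez_nat.
  left; right; exists x, y; split=> //.
  move: xyY; rewrite geq_max => /andP[xY yY]; rewrite xY yY !andbT.
  have h98 : (h ^ 98 <= h ^ 99)%N by rewrite leq_pexp2l.
  case: z s an bn a0 b0 e ha hb => a b /= s an bn a0 b0 e ha hb.
  move: mx; rewrite leq_max => /orP[hx|hy].
    by split; [apply: leq_trans h98 (ltnW hx)|apply: coord_lower cA nA s hx ha].
  by split; [apply: coord_lower cA nA (solves_swap s) hy hb|apply: leq_trans h98 (ltnW hy)].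
have n199 : (n <= A * h ^ 199)%N.
  by apply: (leq_trans nA); rewrite leq_mul2l leq_pexp2l ?orbT.
have h198 : ((h ^ 99) ^ 2 <= h ^ 199)%N by rewrite -expnM leq_pexp2l.
have bxle : ((2 * h ^ 99 + 1) * (2 * n + 1) <= 9 * A * h ^ 199)%N.
  apply: (@leq_trans (3 * h ^ 99 * (3 * (A * h ^ 100)))).
    apply: leq_mul; first by move: (hp 99%N); move: (h ^ 99)%N => u; clear; lia.
    have : (0 < A * h ^ 100)%N by rewrite muln_gt0 A0 hp.
    by move: (A * _)%N nA => u; clear; lia.
  rewrite (_ : 3 * _ * _ = 9 * A * (h ^ 99 * h ^ 100))%N.
    by rewrite -expnD.
  by move: (h ^ 99)%N (h ^ 100)%N; clear => *; ring.
move: bxle h198 n199 (hp 199%N); move: ((_ + 1) * (_ + 1))%N ((h ^ 99) ^ 2)%N (h ^ 199)%N => u v w.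
move: A0; clear; nia.
Qed.

(** * Primes congruent to 2 modulo 3 *)

Section Mertens.
Variable R : realType.

Definition chi3 (n : nat) : R :=
  if (n %% 3 == 1)%N then 1 else if (n %% 3 == 2)%N then -1 else 0.

Lemma chi3M m n : chi3 (m * n) = chi3 m * chi3 n.
Proof.
rewrite /chi3 -modnMm.
have := ltn_pmod m (isT : (0 < 3)%N); have := ltn_pmod n (isT : (0 < 3)%N).
case: (n %% 3)%N => [|[|[|?]]] // _; case: (m %% 3)%N => [|[|[|?]]] // _ /=;
  by rewrite ?mul1r ?mulr1 ?mul0r ?mulr0 ?mulrNN ?mulr1.
Qed.

Lemma chi3_norm n : `|chi3 n| <= 1.
Proof.
by rewrite /chi3; case: ifP => _; [rewrite normr1|case: ifP => _; rewrite ?normrN ?normr1 ?normr0].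
Qed.

(** The nonzero values of [chi3] alternate in sign, so the first of them decides; the sum from a
    multiple of 3 behaves like the one from the following class 1. *)
Lemma alternating_chi3 (f : nat -> R) s N :
  (forall m, (s <= m)%N -> 0 <= f m.+1 <= f m) -> (forall m, (s <= m)%N -> 0 <= f m) ->
  let S := \sum_(s <= m < N) chi3 m * f m in
  if (s %% 3 == 2)%N then - f s <= S <= 0 else 0 <= S <= f s.
Proof.
move=> /=; have [d] := ubnP (N - s); elim: d s => // d IH s dN fdec f0.
have [Ns|sN] := leqP N s.
  by rewrite big_geq //; case: ifP => _; rewrite lexx ?andbT ?oppr_le0 f0.
rewrite big_ltn //.
have dN' : (N - s.+1 < d)%N by lia.
have := IH s.+1 dN' (fun m sm => fdec m (ltnW sm)) (fun m sm => f0 m (ltnW sm)).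
have /andP[f1 f2] := fdec s (leqnn s).
rewrite /chi3.
have : [\/ ((s %% 3 = 0) /\ (s.+1 %% 3 = 1))%N, ((s %% 3 = 1) /\ (s.+1 %% 3 = 2))%N |
   ((s %% 3 = 2) /\ (s.+1 %% 3 = 0))%N].
  have [h|[h|h]] : (s %% 3 = 0 \/ s %% 3 = 1 \/ s %% 3 = 2)%N by lia.
  - by apply: Or31; lia.
  - by apply: Or32; lia.
  - by apply: Or33; lia.
by case=> [][-> ->] /=; move: (\sum_(_ <= _ < _) _) => S; lra.
Qed.

(** * Chebyshev and Mertens estimates over all primes *)

Lemma ln_nat_ge0 n : 0 <= ln n%:R :> R.
Proof. by case: n => [|n]; [rewrite ln0|rewrite ln_ge0 // ler1n]. Qed.

Lemma ler_ln_nat m n : (0 < m <= n)%N -> ln m%:R <= ln n%:R :> R.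
Proof. by move=> /andP[m0 mn]; rewrite ler_ln ?posrE ?ltr0n ?ler_nat // (leq_trans m0). Qed.

Lemma ln2_le1 : ln 2 <= 1 :> R.
Proof. by have := @le_ln1Dx R 1; rewrite -[1 + 1]/(2%:R); apply; lra. Qed.

(* Sums over prime powers d = p^j weighted by ln p, i.e. by the von Mangoldt function. *)
Definition mangoldt_sum B (F : nat -> R) : R :=
  \sum_(1 <= p < B.+1 | prime p) \sum_(1 <= j < B.+1) ln p%:R * F (p ^ j)%N.
Local Notation V := mangoldt_sum.

Lemma mangoldt_sum_le B F G : (forall d, (0 < d)%N -> F d <= G d) -> V B F <= V B G.
Proof.
move=> FG; apply: ler_sum => p pp; apply: ler_sum => j _.
by apply: ler_wpM2l; rewrite ?ln_nat_ge0 // FG // expn_gt0 prime_gt0.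
Qed.

Lemma eq_mangoldt_sum B F G : (forall d, (0 < d)%N -> F d = G d) -> V B F = V B G.
Proof.
by move=> FG; apply: le_anti; rewrite !mangoldt_sum_le // => d d0; rewrite FG.
Qed.

Lemma mangoldt_sumD B F G : V B (fun d => F d + G d) = V B F + V B G.
Proof.
rewrite /V -big_split; apply: eq_bigr => p _; rewrite -big_split.
by apply: eq_bigr => j _; rewrite mulrDr.
Qed.

Lemma mangoldt_sumZ B c F : V B (fun d => c * F d) = c * V B F.
Proof.
rewrite /V mulr_sumr; apply: eq_bigr => p _; rewrite mulr_sumr.
by apply: eq_bigr => j _; rewrite mulrCA.
Qed.

Lemma mangoldt_sumB B F G : V B (fun d => F d - G d) = V B F - V B G.
Proof.
rewrite (eq_mangoldt_sum B (G := fun d => F d + -1 * G d)) ?mangoldt_sumD ?mangoldt_sumZ ?mulN1r //.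
by move=> d _; rewrite mulN1r.
Qed.

Lemma mangoldt_sum_sum B m n (c : nat -> R) (F : nat -> nat -> R) :
  \sum_(m <= i < n) c i * V B (F i) = V B (fun d => \sum_(m <= i < n) c i * F i d).
Proof.
under eq_bigr do rewrite -mangoldt_sumZ.
rewrite /V exchange_big /=; apply: eq_bigr => p _.
rewrite exchange_big /=; apply: eq_bigr => j _.
by rewrite mulr_sumr.
Qed.

Lemma ln_nat_logn B n : (0 < n <= B)%N ->
  ln n%:R = \sum_(1 <= p < B.+1 | prime p) ln p%:R * (logn p n)%:R :> R.
Proof.
elim/ltn_ind: n => n IH /andP[n0 nB].
have [n1|n1] := leqP n 1.
  have -> : n = 1%N by lia.
  by rewrite ln1 big1 // => p _; rewrite logn1 mulr0.
have pp := pdiv_prime n1; have pn := pdiv_dvd n; have [m mE] := dvdnP pn.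
move: (pdiv n) pp pn mE => p pp pn mE.
have m0 : (0 < m)%N by move: n0; rewrite mE muln_gt0 => /andP[].
have mn : (m < n)%N by rewrite mE -{1}(muln1 m) ltn_pmul2l // prime_gt1.
have pB : (p <= B)%N by apply: leq_trans nB; apply: dvdn_leq.
rewrite mE natrM lnM ?posrE ?ltr0n ?(prime_gt0 pp) // (IH m mn); last first.
  by rewrite m0 (leq_trans (ltnW mn)).
have -> : ln p%:R = \sum_(1 <= q < B.+1 | prime q) ln q%:R * (logn q p)%:R :> R.
  rewrite big_mkcond (bigD1_seq p) ?iota_uniq //=; last by rewrite mem_index_iota prime_gt0.
  rewrite pp logn_prime // eqxx mulr1 big1 ?addr0 // => q qn; case: ifP => // qp.
  by rewrite logn_prime // (negPf qn) mulr0.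
rewrite -big_split; apply: eq_bigr => q qp /=.
by rewrite lognM ?(prime_gt0 pp) // natrD mulrDr.
Qed.

Lemma ln_nat_mangoldt B n : (0 < n <= B)%N -> ln n%:R = V B (fun d => (d %| n)%N%:R).
Proof.
move=> nB; rewrite (ln_nat_logn nB) /V; apply: eq_bigr => p pp.
rewrite -mulr_sumr -natr_sum logn_count_dvd //.
case/andP: nB => n0 nB; congr (_ * _%:R).
rewrite [RHS](big_cat_nat _ (n := n)) //=; last by apply: leqW.
rewrite [X in (_ = _ + X)%N]big_nat_cond [X in (_ = _ + X)%N]big1 ?addn0 // => j /andP[/andP[nj _] _].
rewrite gtnNdvd //; apply: leq_trans (ltn_expl j (prime_gt1 pp)).
by rewrite ltnS.
Qed.

Definition log_fact N : R := \sum_(1 <= n < N.+1) ln n%:R.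

Lemma log_factE N : log_fact N = ln (N`!)%:R.
Proof.
elim: N => [|N IH]; first by rewrite /log_fact big_geq // fact0 ln1.
rewrite /log_fact big_nat_recr //= -/(log_fact N) IH factS natrM lnM ?posrE ?ltr0n ?fact_gt0 //.
by rewrite addrC.
Qed.

Lemma log_fact_mangoldt B N : (N <= B)%N -> log_fact N = V B (fun d => (N %/ d)%N%:R).
Proof.
move=> NB; transitivity (\sum_(1 <= n < N.+1) (fun=> 1) n * V B (fun d => (d %| n)%N%:R)).
  apply: eq_big_nat => n /andP[n0 nN]; rewrite mul1r; apply: ln_nat_mangoldt.
  by rewrite n0 (leq_trans _ NB).
rewrite mangoldt_sum_sum; apply: eq_mangoldt_sum => d d0.
by rewrite divn_count_dvd natr_sum; apply: eq_bigr => i _; rewrite mul1r.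
Qed.

(** Chebyshev's psi function when N <= B. One cut-off [B] for all N lets sums with different N be
    compared term by term. *)
Definition psi_sum B N : R := V B (fun d => (d <= N)%N%:R).

(** floor(2M/d) - 2 floor(M/d) is never negative, and is 1 for M < d <= 2M. Summation compares psi
    with the logarithm of the central binomial coefficient. *)
Lemma psi_sum_double B M : (2 * M <= B)%N -> psi_sum B (2 * M) <= psi_sum B M + (2 * M)%:R.
Proof.
move=> MB.
have h : psi_sum B (2 * M) - psi_sum B M <= log_fact (2 * M) - 2 * log_fact M.
  rewrite !(@log_fact_mangoldt B) //; last by apply: leq_trans MB; lia.
  rewrite -mangoldt_sumZ -!mangoldt_sumB; apply: mangoldt_sum_le => d d0.
  have e1 := divn_eq (2 * M) d; have e2 := divn_eq M d.
  have l1 := ltn_pmod (2 * M) d0; have l2 := ltn_pmod M d0.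
  have key : (2 * (M %/ d) + (d <= 2 * M) <= (2 * M) %/ d + (d <= M))%N.
    have [dM|dM] := leqP d M.
      have -> : (d <= 2 * M)%N by lia.
      by rewrite leq_add2r leq_divRL // -mulnA leq_mul2l leq_trunc_div orbT.
    rewrite divn_small // muln0 addn0 add0n.
    by case: (leqP d (2 * M)) => // dM'; rewrite divn_gt0.
  move: key; rewrite -(ler_nat R) natrD [X in _ <= X]natrD natrM.
  by move: ((M %/ d)%N%:R : R) (((2 * M) %/ d)%N%:R : R) ((d <= M)%N%:R : R) ((d <= 2 * M)%N%:R : R) => *; lra.
have l2 : log_fact (2 * M) - 2 * log_fact M <= (2 * M)%:R.
  rewrite !log_factE.
  have C0 : (0 < 'C(2 * M, M))%N by rewrite bin_gt0; lia.
  have E : ('C(2 * M, M) * (M`! * M`!) = (2 * M)`!)%N.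
    have ML : (M <= 2 * M)%N by lia.
    by have := bin_fact ML; rewrite (_ : 2 * M - M = M)%N //; lia.
  rewrite -E !natrM !lnM ?posrE ?mulr_gt0 ?ltr0n ?fact_gt0 //.
  have : ln ('C(2 * M, M))%:R <= (2 * M)%:R :> R.
    have C2 : ('C(2 * M, M) <= 2 ^ (2 * M))%N.
      have := expnDn 1 1 (2 * M); rewrite addn1 => ->.
      have MM : (M < (2 * M).+1)%N by lia.
      rewrite (bigD1 (Ordinal MM)) //= !exp1n !muln1; exact: leq_addr.
    apply: (@le_trans _ _ (ln (2 ^ (2 * M))%N%:R)).
      by apply: ler_ln_nat; rewrite C0.
    rewrite natrX lnXn // (_ : ln 2 *+ (2 * M) = ln 2 * (2 * M)%:R); last by rewrite mulr_natr.
    by rewrite ler_piMl // ln2_le1.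
  by move: (ln ('C(2 * M, M))%:R) (ln (M`!)%:R) => *; lra.
by move: (psi_sum _ _) (psi_sum _ _) h l2 => u v; lra.
Qed.

Lemma psi_sum_le B m n : (m <= n)%N -> psi_sum B m <= psi_sum B n.
Proof.
move=> mn; apply: mangoldt_sum_le => d _; rewrite ler_nat.
by have [dm|//] := leqP d m; rewrite (leq_trans dm mn).
Qed.

Lemma psi_sum_le1 B N : (N <= 1)%N -> psi_sum B N = 0.
Proof.
move=> N1; rewrite /psi_sum /mangoldt_sum big1 // => p pp; rewrite big_nat big1 // => j /andP[j0 _].
suff -> : (p ^ j <= N)%N = false by rewrite mulr0.
apply/negbTE; rewrite -ltnNge; apply: (leq_ltn_trans N1).
by rewrite -(exp1n j) ltn_exp2r // prime_gt1.
Qed.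

(** Halving with M = ceil(N/2), where 4 M + 2 M <= 4 N for N >= 2. As 2 M can be N + 1, N stays
    strictly below [B]. *)
Lemma psi_sum_bound B N : (N < B)%N -> psi_sum B N <= (4 * N)%:R.
Proof.
elim/ltn_ind: N => N IH NB.
have [N1|N1] := leqP N 1; first by rewrite psi_sum_le1.
pose M := uphalf N.
have NM : (N <= 2 * M)%N by rewrite /M; lia.
have MN : (M < N)%N by rewrite /M; lia.
apply: (le_trans (psi_sum_le B NM)).
apply: (le_trans (psi_sum_double _)); first by rewrite /M; lia.
apply: (@le_trans _ _ ((4 * M)%:R + (2 * M)%:R)).
  by rewrite lerD2r IH // (ltn_trans MN).
by rewrite -natrD ler_nat /M; lia.
Qed.

Lemma log_fact_lower N : (0 < N)%N -> N%:R * ln N%:R - N%:R <= log_fact N.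
Proof.
elim: N => // -[_ _|N IH _]; first by rewrite /log_fact big_nat1 ln1; lra.
rewrite /log_fact big_nat_recr //= -/(log_fact N.+1); have {}IH := IH isT.
have n0 : 0 < N.+1%:R :> R by rewrite ltr0n.
have : N.+1%:R * (ln N.+2%:R - ln N.+1%:R) <= 1 :> R.
  rewrite -ln_div ?posrE ?ltr0n // -(natr1 N.+1) mulrDl mul1r mulfV ?gt_eqF //.
  have := @le_ln1Dx R (N.+1%:R^-1).
  rewrite (lt_trans _ (_ : 0 < _)) ?invr_gt0 ?ltrN10 // => /(_ isT) h.
  by rewrite mulrC -ler_pdivlMr // div1r.
move: (ln N.+2%:R) (ln N.+1%:R) (log_fact N.+1) IH => a b c IH h.
have -> : N.+2%:R = N.+1%:R + 1 :> R by rewrite natr1.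
rewrite mulrDl mul1r; rewrite mulrBr in h.
by move: (N.+1%:R * a) (N.+1%:R * b) (N.+1%:R : R) IH h => u v w; lra.
Qed.

Lemma log_fact_upper N : log_fact N <= N%:R * ln N%:R.
Proof.
rewrite /log_fact big_nat; apply: (@le_trans _ _ (\sum_(1 <= n < N.+1) ln N%:R)).
  rewrite [leRHS]big_nat; apply: ler_sum => n /andP[n0 nN]; apply: ler_ln_nat.
  by rewrite n0.
by rewrite sumr_const_nat subn1 /= mulr_natl.
Qed.

Definition below N (d : nat) : R := (d <= N)%N%:R.

(** Mertens' argument: N times the sum differs from ln N! by the fractional parts of N/d, in total
    between 0 and psi(N). The lower and the upper bound use one side each. *)
Lemma mertens_lower B N : (0 < N <= B)%N -> ln N%:R - 1 <= V B (fun d => below N d / d%:R).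
Proof.
move=> /andP[N0 NB]; have n0 : 0 < N%:R :> R by rewrite ltr0n.
rewrite -(ler_pM2l n0) -mangoldt_sumZ.
apply: (@le_trans _ _ (log_fact N)).
  by apply: le_trans (log_fact_lower N0); rewrite mulrBr mulr1.
rewrite (log_fact_mangoldt NB); apply: mangoldt_sum_le => d d0.
rewrite /below; have [dN|dN] := leqP d N; last by rewrite divn_small // mul0r mulr0.
by rewrite mul1r ler_pdivlMr ?ltr0n // -natrM ler_nat leq_trunc_div.
Qed.

Lemma mertens_upper B N : (0 < N < B)%N -> V B (fun d => below N d / d%:R) <= ln N%:R + 4.
Proof.
move=> /andP[N0 NB]; have n0 : 0 < N%:R :> R by rewrite ltr0n.
rewrite -(ler_pM2l n0) -mangoldt_sumZ.
apply: (@le_trans _ _ (log_fact N + psi_sum B N)).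
  rewrite (log_fact_mangoldt (ltnW NB)) -mangoldt_sumD; apply: mangoldt_sum_le => d d0.
  rewrite /below; have [dN|dN] := leqP d N; last by rewrite mul0r mulr0 addr_ge0.
  rewrite mul1r ler_pdivrMr ?ltr0n // natr1 -natrM ler_nat ltnW // ltn_ceil //.
apply: (le_trans (lerD (log_fact_upper N) (psi_sum_bound NB))).
by rewrite mulrDr natrM [4 * _]mulrC.
Qed.
End Mertens.

(** * The sums twisted by the character modulo 3 *)

Section MertensChi.
Variable R : realType.
Local Notation V := (@mangoldt_sum R).
Local Notation chi3 := (@chi3 R).
Local Notation below := (@below R).

Lemma sum_multiples (g : nat -> R) d N : (0 < d)%N ->
  \sum_(1 <= n < N.+1) g n * (d %| n)%N%:R = \sum_(1 <= m < (N %/ d).+1) g (d * m)%N.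
Proof.
move=> d0; elim: N => [|N IH]; first by rewrite div0n !big_geq.
rewrite big_nat_recr //= IH divnS //.
have [dN|dN] := boolP (d %| N.+1)%N; last by rewrite mulr0 addr0 add0n.
rewrite add1n mulr1 [RHS]big_nat_recr //=.
by have := divnS N d0; rewrite dN add1n => <-; rewrite [(d * _)%N]mulnC divnK.
Qed.

Definition L_sum N : R := \sum_(1 <= m < N.+1) chi3 m * m%:R^-1.

Lemma L_sum_tail M N : (M <= N)%N -> `|L_sum N - L_sum M| <= M.+1%:R^-1.
Proof.
move=> MN; rewrite /L_sum (big_cat_nat _ (n := M.+1)) //= addrAC subrr add0r.
have := @alternating_chi3 R (fun m => m%:R^-1) M.+1 N.+1; rewrite /= => h.
have h1 m : (M.+1 <= m)%N -> 0 <= (m.+1%:R^-1 : R) <= m%:R^-1.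
  move=> Mm; rewrite invr_ge0 ler0n /= lef_pV2 ?posrE ?ltr0n ?ler_nat //.
  exact: leq_trans Mm.
have h2 m : (M.+1 <= m)%N -> 0 <= m%:R^-1 :> R by rewrite invr_ge0.
have := h h1 h2; move: (\sum_(_ <= _ < _) _) (M.+1%:R^-1 : R) (invr_ge0 (M.+1%:R : R)) => S x.
rewrite ler0n => x0; case: ifP => _; rewrite ler_norml; lra.
Qed.

(** 1 - 1/2 plus a nonnegative tail from 3 on. This replaces the nonvanishing of L(1, chi). *)
Lemma L_sum_lower N : (0 < N)%N -> 2^-1 <= L_sum N.
Proof.
case: N => // -[_|N _].
  by rewrite /L_sum big_nat1 /chi3 /= mul1r invr1; lra.
rewrite /L_sum big_ltn // big_ltn //=.
have := @alternating_chi3 R (fun m => m%:R^-1) 3 N.+3; rewrite /= => h.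
have h1 m : (3 <= m)%N -> 0 <= (m.+1%:R^-1 : R) <= m%:R^-1.
  move=> Mm; rewrite invr_ge0 ler0n /= lef_pV2 ?posrE ?ltr0n ?ler_nat //.
  exact: leq_trans Mm.
have h2 m : (3 <= m)%N -> 0 <= m%:R^-1 :> R by rewrite invr_ge0.
have := h h1 h2; move: (\sum_(_ <= _ < _) _) => S /andP[S0 _].
by rewrite /chi3 /= invr1; lra.
Qed.

(** Partial sums of -L'(1, chi). *)
Definition L_log_sum N : R := \sum_(1 <= n < N.+1) chi3 n * (ln n%:R / n%:R).

Lemma ln2_ge_half : 2^-1 <= ln 2 :> R.
Proof.
have := @le_ln1Dx R (- 2^-1).
have -> : 1 + - 2^-1 = 2^-1 :> R by lra.
rewrite lnV ?posrE //; have h : -1 < - 2^-1 :> R by lra.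
by move=> /(_ h); lra.
Qed.

(** The step from m to m + 1 uses ln m >= 1, which ln 2 >= 1/2 yields from 4 on. *)
Lemma ln_div_decreasing m : (4 <= m)%N -> ln m.+1%:R / m.+1%:R <= ln m%:R / m%:R :> R.
Proof.
move=> m4; have m0n : (0 < m)%N by apply: leq_trans m4.
have m0 : 0 < m%:R :> R by rewrite ltr0n.
have ln4 : 1 <= ln m%:R :> R.
  apply: (@le_trans _ _ (ln 4%:R)); last by apply: ler_ln_nat.
  have -> : 4%:R = 2 ^+ 2 :> R by rewrite -natrX.
  by rewrite lnXn // mulr2n; have := ln2_ge_half; lra.
rewrite ler_pdivrMr ?ltr0n // mulrAC ler_pdivlMr //.
have h : m%:R * (ln m.+1%:R - ln m%:R) <= 1 :> R.
  rewrite -ln_div ?posrE ?ltr0n // -(natr1 m) mulrDl mul1r mulfV ?gt_eqF //.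
  have := @le_ln1Dx R (m%:R^-1).
  rewrite (lt_trans _ (_ : 0 < _)) ?invr_gt0 ?ltrN10 // => /(_ isT) h.
  by rewrite mulrC -ler_pdivlMr // div1r.
have -> : m.+1%:R = m%:R + 1 :> R by rewrite natr1.
move: h; rewrite -(natr1 m).
by move: (ln (m%:R + 1)) (ln m%:R) ln4 => a b b1; rewrite mulrBr mulrDr mulr1 [a * _]mulrC [b * _]mulrC; lra.
Qed.

Lemma L_log_sum_bound N : `|L_log_sum N| <= 1.
Proof.
have l2 := ln2_le1 R; have l20 := ln2_ge_half.
have ln4 : ln 4 = 2 * ln 2 :> R.
  have -> : 4%:R = 2 ^+ 2 :> R by rewrite -natrX.
  by rewrite lnXn // mulr2n; lra.
case: N => [|[|[|N]]]; rewrite /L_log_sum.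
- by rewrite big_geq // normr0; lra.
- by rewrite big_nat1 ln1 mul0r mulr0 normr0.
- rewrite big_ltn // big_nat1 ln1 mul0r mulr0 add0r /chi3 /= ler_norml.
  by move: l2 l20; move: (ln 2) => x; lra.
rewrite big_ltn // big_ltn // big_ltn //= ln1 mul0r mulr0 add0r.
have := @alternating_chi3 R (fun m => ln m%:R / m%:R) 4 N.+4; rewrite /= => h.
have h2 m : (4 <= m)%N -> 0 <= ln m%:R / m%:R :> R by rewrite divr_ge0 ?ln_nat_ge0.
have h1 m : (4 <= m)%N -> 0 <= (ln m.+1%:R / m.+1%:R : R) <= ln m%:R / m%:R.
  by move=> m4; rewrite ln_div_decreasing // andbT h2 // leqW.
have := h h1 h2; move: (\sum_(_ <= _ < _) _) => S.
rewrite ln4 /chi3 /= ler_norml; move: l2 l20; move: (ln 2) (ln 3%:R / 3%:R) => x y; lra.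
Qed.

Definition chi_sum B N : R := V B (fun d => chi3 d * (below N d / d%:R)).

Lemma L_log_sum_mangoldt B N : (N <= B)%N ->
  L_log_sum N = V B (fun d => chi3 d / d%:R * L_sum (N %/ d)).
Proof.
move=> NB.
transitivity (\sum_(1 <= n < N.+1) (chi3 n / n%:R) * V B (fun d => (d %| n)%N%:R)).
  apply: eq_big_nat => n /andP[n0 nN]; rewrite -ln_nat_mangoldt ?n0 ?(leq_trans _ NB) //.
  by rewrite mulrAC -mulrA.
rewrite mangoldt_sum_sum; apply: eq_mangoldt_sum => d d0.
rewrite sum_multiples // /L_sum mulr_sumr; apply: eq_bigr => m _.
by rewrite chi3M natrM invfM; ring.
Qed.

(* The sum of chi(n) ln n / n is bounded; expanding ln n over prime powers it is
   L_sum N * chi_sum B N up to an error controlled by psi, and L_sum N >= 1/2. *)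
Lemma chi_sum_bound B N : (0 < N < B)%N -> `|chi_sum B N| <= 10.
Proof.
move=> /andP[N0 NB]; have n0 : 0 < N%:R :> R by rewrite ltr0n.
have key : `|L_log_sum N - L_sum N * chi_sum B N| <= 4.
  rewrite (L_log_sum_mangoldt (ltnW NB)) /chi_sum -mangoldt_sumZ -mangoldt_sumB.
  have psi : V B (fun d => N%:R^-1 * below N d) <= 4.
    by rewrite mangoldt_sumZ ler_pdivrMl // -natrM mulnC; exact: psi_sum_bound.
  (* The tail of [L_sum] beyond N/d is at most d/N, so each d contributes an error of at most 1/N,
     in total psi(N)/N <= 4. *)
  have pw d : (0 < d)%N -> `|chi3 d / d%:R * L_sum (N %/ d) -
      L_sum N * (chi3 d * (below N d / d%:R))| <= N%:R^-1 * below N d.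
    move=> d0; rewrite /below; have [dN|dN] := leqP d N; last first.
      by rewrite divn_small // /L_sum big_geq // !(mul0r,mulr0) subr0 normr0.
    rewrite mulr1 mul1r.
    have -> : chi3 d / d%:R * L_sum (N %/ d) - L_sum N * (chi3 d / d%:R) =
      chi3 d * (d%:R^-1 * (L_sum (N %/ d) - L_sum N)) by ring.
    rewrite !normrM; apply: (@le_trans _ _ (1 * (d%:R^-1 * ((N %/ d).+1%:R^-1)))).
      apply: ler_pM => //; rewrite ?mulr_ge0 // ?chi3_norm //.
      rewrite ger0_norm ?invr_ge0 // ler_wpM2l ?invr_ge0 // distrC.
      by apply: L_sum_tail; apply: leq_div.
    rewrite mul1r -invfM lef_pV2 ?posrE ?mulr_gt0 ?ltr0n //.
    by rewrite -natrM ler_nat mulnC ltnW // ltn_ceil.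
  rewrite ler_norml; apply/andP; split.
    apply: (@le_trans _ _ (V B (fun d => -1 * (N%:R^-1 * below N d)))).
      by rewrite mangoldt_sumZ mulN1r lerN2.
    apply: mangoldt_sum_le => d /pw; rewrite ler_norml mulN1r => /andP[//].
  apply: le_trans psi; apply: mangoldt_sum_le => d /pw; rewrite ler_norml => /andP[//].
have h1 := L_log_sum_bound N; have h2 := L_sum_lower N0.
have h3 : `|L_sum N * chi_sum B N| <= 5.
  have -> : L_sum N * chi_sum B N = L_log_sum N - (L_log_sum N - L_sum N * chi_sum B N) by ring.
  by apply: (le_trans (ler_normB _ _)); move: (`|_|) (`|_|) h1 key => u v; lra.
move: h3; rewrite normrM (ger0_norm (le_trans _ h2)); last by lra.
by move: (normr_ge0 (chi_sum B N)) h2; move: (`|_|) (L_sum N) => u v; nra.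
Qed.

(** The weight 1 - chi is 2 on the class 2, 1 on the powers of 3, and 0 on the class 1. *)
Definition class2_sum B N : R := V B (fun d => (1 - chi3 d) * (below N d / d%:R)).

(** The 25 is 1 + 4 from the two Mertens bounds and 10 + 10 from [chi_sum_bound]. *)
Lemma class2_sum_window B M N : (0 < M)%N -> (M <= N)%N -> (N < B)%N ->
  ln N%:R - ln M%:R - 25 <= class2_sum B N - class2_sum B M.
Proof.
move=> M0 MN NB.
have E K : class2_sum B K = V B (fun d => below K d / d%:R) - chi_sum B K.
  by rewrite -mangoldt_sumB; apply: eq_mangoldt_sum => d _; rewrite mulrBl mul1r.
rewrite !E.
have N0 : (0 < N)%N by apply: leq_trans MN.
have MB : (M < B)%N by apply: leq_ltn_trans NB.
have a1 : (0 < N <= B)%N by rewrite N0 ltnW.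
have a2 : (0 < M < B)%N by rewrite M0.
have a3 : (0 < N < B)%N by rewrite N0.
have := mertens_lower R a1; have := mertens_upper R a2.
have := chi_sum_bound a3; have := chi_sum_bound a2; rewrite !ler_norml.
move: (V _ _) (V _ _) (chi_sum _ _) (chi_sum _ _) (ln _) (ln _) => *; lra.
Qed.
End MertensChi.

(** * Counting primes in the class 2 modulo 3 *)

Definition class2_primes N := [seq p <- iota 1 N | prime p && (p %% 3 == 2)%N].

Lemma sum_ltn_le (s : seq nat) L : uniq s -> (\sum_(j <- s) (j < L) <= L)%N.
Proof.
move=> us; rewrite -big_mkcond sum1_count -size_filter -{2}(size_iota 0 L).
apply: uniq_leq_size; first exact: filter_uniq.
by move=> j; rewrite mem_filter mem_iota => /andP[->].
Qed.

(** In the window (M, N] with N = h^(2e) and M = N / h every term is at most 2 ln N / M, so a lower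
    bound for the sum becomes one for the number of terms. Proper powers p^j up to N have p <= h^e,
    which is why the exponent is even, and j < 2 e h because N < 2^(2eh). *)
Lemma class2_primes_window (R : realType) e h : (2 < e)%N -> (2 < h)%N ->
  ln h%:R - 25 <= 2 * (ln (h ^ (2 * e))%N%:R / (h ^ (2 * e).-1)%N%:R) *
     (size (class2_primes (h ^ (2 * e))) + (h ^ e).+1 * (h * (2 * e)))%N%:R :> R.
Proof.
move=> e2 h2; set E := (2 * e)%N; set M := (h ^ E.-1)%N; set N := (h ^ E)%N.
have h0 : (0 < h)%N by apply: leq_trans h2.
have E0 : (0 < E)%N by rewrite /E; lia.
have E1 : E = E.-1.+1 by rewrite prednK.
have NhM : N = (h * M)%N by rewrite /N {1}E1 expnS.
have M0 : (0 < M)%N by rewrite expn_gt0 h0.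
have MN : (M <= N)%N by rewrite NhM leq_pmull.
have M3 : (2 < M)%N.
  apply: (leq_trans h2); rewrite -{1}(expn1 h) leq_pexp2l // /E; lia.
have win := class2_sum_window R M0 MN (ltnSn N).
have lnN : ln N%:R - ln M%:R = ln h%:R :> R.
  by rewrite NhM natrM lnM ?posrE ?ltr0n // addrK.
rewrite lnN in win; apply: (le_trans win).
rewrite /class2_sum -mangoldt_sumB.
set c := 2 * (ln N%:R / M%:R).
have c0 : 0 <= c by rewrite /c mulr_ge0 // divr_ge0 // ln_nat_ge0.
have term d p : prime p -> (p %| d)%N -> (0 < d)%N ->
    ln p%:R * ((1 - chi3 R d) * (below R N d / d%:R) - (1 - chi3 R d) * (below R M d / d%:R))
    <= c * (M < d <= N)%N%:R.
  move=> pp pd d0; rewrite -mulrBr -mulrBl /below.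
  have -> : (d <= N)%N%:R - (d <= M)%N%:R = (M < d <= N)%N%:R :> R.
    have [dM|dM] := leqP d M; first by rewrite (leq_trans dM MN) subrr.
    by rewrite subr0.
  have [/andP[Md dN]|_] := boolP (M < d <= N)%N; last by rewrite mul0r !mulr0.
  rewrite mulr1 mul1r /c mulrCA; apply: ler_pM.
  - by have := chi3_norm R d; rewrite ler_norml; lra.
  - by rewrite mulr_ge0 ?ln_nat_ge0 ?invr_ge0.
  - by have := chi3_norm R d; rewrite ler_norml; lra.
  apply: ler_pM; rewrite ?ln_nat_ge0 ?invr_ge0 //.
    by apply: ler_ln_nat; rewrite prime_gt0 //= (leq_trans _ dN) // dvdn_leq.
  by rewrite lef_pV2 ?posrE ?ltr0n // ler_nat ltnW.
rewrite /mangoldt_sum.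
apply: (@le_trans _ _ (\sum_(1 <= p < N.+2 | prime p)
    (c * ((p %% 3 == 2) && (p <= N))%N%:R + c * ((p < (h ^ e).+1)%N%:R * (h * E)%:R)))).
  apply: ler_sum => p pp; rewrite big_ltn // expn1; apply: lerD.
    have [pN|pN] := leqP p N; last first.
      apply: (le_trans (term p p pp (dvdnn p) (prime_gt0 pp))).
      by rewrite [(p <= N)%N]leqNgt pN andbF andbF.
    rewrite andbT; have [p2|p2] := eqVneq (p %% 3)%N 2%N.
      apply: (le_trans (term p p pp (dvdnn p) (prime_gt0 pp))).
      by apply: ler_wpM2l => //; rewrite ler_nat leq_b1.
    rewrite mulr0.
    have [p1|p1] := eqVneq (p %% 3)%N 1%N.
      by rewrite /chi3 p1 eqxx subrr !mul0r subrr mulr0.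
    (* The prime 3 has positive weight too, but M > 2 keeps it out of the window. *)
    have p3 : p = 3%N.
      have : (3 %| p)%N by move: p1 p2; rewrite /dvdn; lia.
      by rewrite dvdn_prime2 // => /eqP.
    apply: (le_trans (term p p pp (dvdnn p) (prime_gt0 pp))).
    by rewrite p3 ltnNge M3 /= mulr0.
  apply: (@le_trans _ _ (\sum_(2 <= j < N.+2) c * ((p < (h ^ e).+1)%N%:R * (j < h * E)%N%:R))).
    rewrite [leLHS]big_nat [leRHS]big_nat; apply: ler_sum => j /andP[j2 jN].
    apply: (le_trans (term (p ^ j)%N p pp _ _)).
    - by rewrite -{1}(expn1 p) dvdn_exp2l // ltnW.
    - by rewrite expn_gt0 prime_gt0.
    apply: ler_wpM2l => //; rewrite -natrM ler_nat.
    have [/andP[_ pjN]|//] := boolP (M < p ^ j <= N)%N.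
    have -> : (p < (h ^ e).+1)%N.
      rewrite ltnS -(@leq_exp2r _ _ 2) // -expnM mulnC -/E -/N; apply: leq_trans pjN.
      by rewrite leq_pexp2l // prime_gt0.
    have -> // : (j < h * E)%N.
    rewrite -(@ltn_exp2l 2) //; apply: (@leq_ltn_trans (p ^ j)).
      by case: (j) => // j'; rewrite leq_exp2r // prime_gt1.
    apply: (leq_ltn_trans pjN); rewrite /N [(2 ^ (h * E))%N](expnM 2 h E).
    by rewrite (ltn_exp2r _ _ E0) ltn_expl.
  rewrite -mulr_sumr -mulr_sumr -natr_sum ler_wpM2l // ler_wpM2l // ler_nat.
  by apply: sum_ltn_le; exact: iota_uniq.
rewrite big_split /= -!mulr_sumr -mulr_suml -!natr_sum -mulrDr ler_wpM2l //.
rewrite -natrM -natrD ler_nat leq_add //.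
  rewrite -big_mkcondr sum1_count -size_filter.
  apply: uniq_leq_size; first exact/filter_uniq/iota_uniq.
  move=> p; rewrite !mem_filter mem_index_iota mem_iota add1n !ltnS.
  by move=> /andP[/andP[-> /andP[-> pN]] /andP[-> _]].
rewrite leq_mul2r; apply/orP; right; rewrite -big_filter.
by apply: sum_ltn_le; exact/filter_uniq/iota_uniq.
Qed.

(** A window of ratio h lets ln h beat all constants; the price is a factor h against N, which the
    later exponents can afford. *)
Lemma class2_primes_lower (R : realType) e : (2 < e)%N -> exists h0, forall h, (h0 <= h)%N ->
  (h ^ (2 * e).-1 <= 8 * e * size (class2_primes (h ^ (2 * e))))%N.
Proof.
(* Once ln h >= K, half of ln h remains after subtracting 25 and the share 4 E^2 of the proper prime
   powers. *)
move=> e2; pose E := (2 * e)%N; pose K := 50 + (8 * E ^ 2)%N%:R : R.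
have K0 : 0 < K by rewrite /K ltr_wpDr.
exists (Num.truncn (expR K)).+3 => h hh.
have h2 : (2 < h)%N by apply: leq_trans hh.
have h0 : (0 < h)%N by apply: leq_trans h2.
have h0R : 0 < h%:R :> R by rewrite ltr0n.
have lnK : K <= ln h%:R.
  rewrite -[K]expRK ler_ln ?posrE ?expR_gt0 //; apply: ltW.
  apply: (lt_le_trans (truncnS_gt (expR K))); rewrite ler_nat.
  by apply: leq_trans hh; do 2!apply: leqW.
have := class2_primes_window R e2 h2; rewrite -/E.
set P := size _; set M := (h ^ E.-1)%N.
have M0 : (0 < M)%N by rewrite expn_gt0 h0.
have M0R : 0 < M%:R :> R by rewrite ltr0n.
rewrite natrX lnXn // -[ln _ *+ _]mulr_natr natrD.
have small : ln h%:R * ((h ^ e).+1 * (h * E))%N%:R <= (2 * E)%N%:R * M%:R :> R.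
  apply: (@le_trans _ _ (h%:R * (2 * h ^ e * (h * E))%N%:R)).
    apply: ler_pM => //; first exact: ln_nat_ge0.
      by apply: ltW; apply: ln_sublinear.
    by rewrite ler_nat leq_mul2r mul2n -addnn -addn1 leq_add2l expn_gt0 h0 orbT.
  rewrite -!natrM ler_nat.
  have -> : (h * (2 * h ^ e * (h * E)) = 2 * E * (h ^ 2 * h ^ e))%N by rewrite expnS expn1; ring.
  by rewrite leq_mul2l -expnD leq_pexp2l ?orbT // /E; lia.
move=> win.
have {win}win : (ln h%:R - 25) * M%:R <= 2 * E%:R * (ln h%:R * P%:R)
    + 2 * E%:R * (ln h%:R * ((h ^ e).+1 * (h * E))%N%:R) :> R.
  rewrite -ler_pdivlMr //; apply: (le_trans win); rewrite le_eqVlt; apply/orP; left; apply/eqP.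
  move: (gt_eqF M0R) => /negbT; move: (ln h%:R : R) (M%:R : R) (P%:R : R) (E%:R : R)
    (((h ^ e).+1 * (h * E))%N%:R : R) => a b c d f b0.
  by field.
have s2 : 2 * E%:R * (ln h%:R * ((h ^ e).+1 * (h * E))%N%:R) <= (4 * E ^ 2)%N%:R * M%:R :> R.
  apply: (@le_trans _ _ (2 * E%:R * ((2 * E)%N%:R * M%:R))); first by rewrite ler_wpM2l // mulr_ge0.
  have -> : (4 * E ^ 2 = 2 * E * (2 * E))%N by rewrite expnS expn1; ring.
  by rewrite mulrA (natrM _ (2 * E)) (natrM _ 2 E).
have ln0 : 0 < ln h%:R :> R by apply: lt_le_trans lnK.
have half : ln h%:R / 2 * M%:R <= 2 * E%:R * (ln h%:R * P%:R) :> R.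
  have a : (ln h%:R - 25) * M%:R - (4 * E ^ 2)%N%:R * M%:R <= 2 * E%:R * (ln h%:R * P%:R) :> R.
    by move: win s2; lra.
  apply: le_trans a; rewrite -mulrBl ler_wpM2r //.
  have e8 : (8 * E ^ 2)%N%:R = 2 * (4 * E ^ 2)%N%:R :> R by rewrite -natrM mulnA.
  by move: lnK; rewrite /K e8; move: ((4 * E ^ 2)%N%:R : R) (ln h%:R : R) => u v; lra.
rewrite -(ler_nat R) -(ler_pM2l ln0) (_ : (8 * e * P = 4 * E * P)%N); last by rewrite /E; lia.
rewrite -/E -/M (natrM _ (4 * E)) (natrM _ 4 E); move: half.
rewrite (_ : 2 * E%:R * (ln h%:R * P%:R) = (ln h%:R * (4 * E%:R * P%:R)) / 2); last by field.
by move: (ln h%:R * (4 * E%:R * P%:R) : R); rewrite mulrAC; move: (ln h%:R * M%:R : R) => u v; lra.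
Qed.

(** * Local solubility *)

Lemma intZp_eq0 N (m : int) : (1 < N)%N -> (m%:~R == 0 :> 'Z_N) = (N%:Z %| m)%Z.
Proof.
move=> N1.
have nat_case k : (k%:R == 0 :> 'Z_N) = (N %| k)%N.
  by rewrite -val_eqE /= val_Zp_nat.
case: m => k; first by rewrite -pmulrn nat_case dvdzE.
by rewrite NegzE mulrNz oppr_eq0 -pmulrn nat_case dvdzE abszN.
Qed.

Lemma eq_intZp N (m m' : int) : (1 < N)%N ->
  (m%:~R = m'%:~R :> 'Z_N) <-> (N%:Z %| m - m')%Z.
Proof.
move=> N1; rewrite -intZp_eq0 // intrB subr_eq0.
by split=> [->|/eqP].
Qed.

Lemma ppow_gt1 p n : prime p -> (1 < p ^ n.+1)%N.
Proof. by move=> pp; rewrite -{1}(exp1n n.+1) ltn_exp2r // prime_gt1. Qed.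

Lemma Zpow_red_int p n (m : int) : prime p ->
  Zpow_red (m%:~R : 'Z_(p ^ n.+2)) = m%:~R.
Proof.
move=> pp; rewrite /Zpow_red.
set v := (m%:~R : 'Z_(p ^ n.+2)).
have e : (nat_of_ord v)%:~R = m%:~R :> 'Z_(p ^ n.+2) by rewrite -pmulrn natr_Zp.
have := (eq_intZp (nat_of_ord v)%:Z m (ppow_gt1 n.+1 pp)).1 e => d.
rewrite [LHS]pmulrn; apply/(eq_intZp _ _ (ppow_gt1 n pp)); apply: dvdz_trans d.
by rewrite dvdzE /= dvdn_exp2l.
Qed.

Section Padic.
Variables (p : nat) (p_pr : prime p).
Local Notation Zp := (padic_int p_pr).

Lemma padic_int_coord (m : int) n : (m%:~R : Zp) n = m%:~R.
Proof.
have nat_case k : (k%:R : Zp) n = k%:R.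
  by elim: k => // k IH; rewrite -natr1 -[RHS]natr1 -IH.
case: m => k; first by rewrite -pmulrn nat_case.
by rewrite NegzE !mulrNz -!pmulrn -nat_case.
Qed.

Lemma padic_exp_coord (x : Zp) k n : (x ^+ k) n = (x n) ^+ k.
Proof. by elim: k => // k IH; rewrite exprS [RHS]exprS -IH. Qed.

Lemma padic_limit (P : nat -> int -> Prop) (x0 : int) : P 0%N x0 ->
  (forall n x, P n x -> exists x', P n.+1 x' /\ ((p ^ n.+1)%N%:Z %| x' - x)%Z) ->
  exists z : Zp, forall n, exists x, P n x /\ z n = x%:~R.
Proof.
move=> P0 step.
pose T n := {x : int | P n x}.
have stepT n (s : T n) : {s' : T n.+1 | ((p ^ n.+1)%N%:Z %| sval s' - sval s)%Z}.
  apply: cid; case: s => x Px; have [x' [Px' d]] := step n x Px.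
  by exists (exist _ x' Px').
pose fix s n : T n := if n is m.+1 then sval (stepT m (s m)) else exist _ x0 P0.
have coh n : Zpow_red ((sval (s n.+1))%:~R : 'Z_(p ^ n.+2)) = (sval (s n))%:~R.
  rewrite Zpow_red_int //; apply/eq_intZp; first exact: ppow_gt1.
  exact: (svalP (stepT n (s n))).
exists (@PadicSeq p (fun n => (sval (s n))%:~R) coh) => n.
by exists (sval (s n)); split=> //; apply: (svalP (s n)).
Qed.

Lemma solvable_padic_of_coord k a b (x y : Zp) :
  (forall n, a%:~R * (x n) ^+ k + b%:~R * (y n) ^+ k = 1) -> solvable_over Zp k a b.
Proof.
move=> h; exists x, y; apply: padic_ext => n.
by rewrite -[RHS](h n) -!padic_exp_coord -!padic_int_coord.
Qed.

Lemma lift_digit (u e : int) : ~~ (p%:Z %| u)%Z -> exists s, (p%:Z %| e + u * s)%Z.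
Proof.
move=> pu; have /coprimezP[[c d] /= cd] : coprimez u p%:Z.
  by rewrite coprimez_sym coprimezE /= prime_coprime // -dvdzE.
exists (- (e * c)); apply/dvdzP; exists (e * d).
have -> : e + u * - (e * c) = e * (1 - c * u) by ring.
by rewrite -cd; ring.
Qed.

Lemma expr_add_mod_sq (y h : int) k : exists q, (y + h) ^+ k = y ^+ k + k%:Z * y ^+ k.-1 * h + h ^+ 2 * q.
Proof.
elim: k => [|k [q IH]]; first by exists 0; rewrite !expr0; ring.
exists (k%:Z * y ^+ k.-1 + q * (y + h)).
rewrite exprS IH /= -[k.+1]addn1 PoszD; case: k {IH} => [|k] /=; first by rewrite !expr0 !expr1; ring.
by rewrite addn1 !exprS; ring.
Qed.

(** Newton's step in y, with x0 fixed: the derivative b k y^(k-1) is a unit, so the next digit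
    solves a linear congruence. *)
Lemma hensel_power k (a b x0 y0 : int) : ~~ (p %| k)%N -> ~~ (p%:Z %| b)%Z ->
  ~~ (p%:Z %| y0)%Z -> (p%:Z %| a * x0 ^+ k + b * y0 ^+ k - 1)%Z -> solvable_over Zp k a b.
Proof.
move=> pk pb py0 h0.
pose P n y := ((p ^ n.+1)%N%:Z %| a * x0 ^+ k + b * y ^+ k - 1)%Z /\ ~~ (p%:Z %| y)%Z.
have [|n y [d py]|z zP] := @padic_limit P y0.
- by split=> //; rewrite expn1.
- have [e eE] := dvdzP d.
  have pu : ~~ (p%:Z %| b * (k%:Z * y ^+ k.-1))%Z.
    move: pb pk py; rewrite !dvdzE !abszM abszX /= => pb pk py.
    by rewrite !Euclid_dvdM // !negb_or pb pk /= Euclid_dvdX // negb_and py.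
  have [s sP] := lift_digit e pu.
  pose hh := (p ^ n.+1)%N%:Z * s.
  have [q qE] := expr_add_mod_sq y hh k.
  exists (y + hh); split; last by rewrite addrAC subrr add0r dvdz_mulr.
  split; last first.
    by rewrite rpredDr // /hh dvdz_mulr // dvdzE /= dvdn_exp.
  have -> : a * x0 ^+ k + b * (y + hh) ^+ k - 1 =
     (p ^ n.+1)%N%:Z * (e + b * (k%:Z * y ^+ k.-1) * s) + hh ^+ 2 * (b * q).
    rewrite qE; move: eE => /eqP; rewrite subr_eq => /eqP eE.
    have -> : a * x0 ^+ k = e * (p ^ n.+1)%N + 1 - b * y ^+ k by rewrite -eE; ring.
    by rewrite /hh; ring.
  apply: rpredD.
    have -> : (p ^ n.+2)%N%:Z = (p ^ n.+1)%N%:Z * p%:Z by rewrite expnSr PoszM.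
    exact: dvdz_mul.
  rewrite dvdz_mulr // /hh exprMn dvdz_mulr // expr2 -PoszM -expnD dvdzE /= dvdn_exp2l //.
  by rewrite addnS addSn !ltnS leq_addl.
apply: (@solvable_padic_of_coord k a b x0%:~R z) => n.
have [y [[d _] ->]] := zP n; rewrite padic_int_coord.
rewrite -!rmorphXn -!rmorphM -rmorphD -[RHS](rmorph1 (intmul 1)).
by apply/eq_intZp; first exact: ppow_gt1.
Qed.

Lemma solvable_overC (A : comNzRingType) k a b : solvable_over A k a b -> solvable_over A k b a.
Proof. by move=> [x [y e]]; exists y, x; rewrite addrC. Qed.

Lemma solvable_of_root (k : nat) (a b x0 : int) : (0 < k)%N -> ~~ (p %| k)%N ->
  ~~ (p%:Z %| a)%Z -> (p%:Z %| a * x0 ^+ k - 1)%Z -> solvable_over Zp k a b.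
Proof.
move=> k0 pk pa d; apply: solvable_overC.
apply: (@hensel_power k b a 0 x0) => //.
  apply: contraTN d => px; rewrite rpredDl.
    by rewrite dvdzE /= dvdn1; apply: contraTneq p_pr => ->.
  by rewrite dvdz_mull // -(prednK k0) exprS dvdz_mulr.
by rewrite expr0n gtn_eqF // mulr0 add0r.
Qed.
End Padic.

(** The derivative is divisible by 3, so one more power of 3 is carried along: y is settled modulo
    3^(n+1) while a y^3 = 1 holds modulo 3^(n+2), and adding 3^(n+1) s to y changes a y^3 by 3^(n+2)
    a y^2 s modulo 3^(n+3). The start y = 1 is the condition modulo 9. *)
Lemma cube_root_3adic (p_pr : prime 3) (a b : int) : (9 %| a - 1)%Z ->
  solvable_over (padic_int p_pr) 3 a b.
Proof.
move=> h9.
pose P n (y : int) := ((3 ^ n.+2)%N%:Z %| a * y ^+ 3 - 1)%Z.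
have [|n y d|z zP] := @padic_limit 3 p_pr P 1.
- by rewrite /P expr1n mulr1.
- have [e eE] := dvdzP d.
  have d3 : (3 %| a * y ^+ 3 - 1)%Z by apply: dvdz_trans d; rewrite dvdzE /= dvdn_exp.
  have pu : ~~ (3 %| a * y ^+ 2)%Z.
    apply: contraTN d3 => d3; rewrite (_ : a * y ^+ 3 = a * y ^+ 2 * y); last by ring.
    by rewrite rpredDl; [rewrite dvdzE|apply: dvdz_mulr].
  have [s sP] := lift_digit p_pr e pu.
  exists (y + (3 ^ n.+1)%N%:Z * s); split; last by rewrite addrAC subrr add0r dvdz_mulr.
  rewrite /P.
  have E2 : (3 ^ n.+2)%N%:Z = 3 * (3 ^ n.+1)%N%:Z by rewrite expnS PoszM.
  have E3 : (3 ^ n.+3)%N%:Z = 3 * (3 * (3 ^ n.+1)%N%:Z) by rewrite !expnS !PoszM.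
  have E1 : (3 ^ n.+1)%N%:Z = 3 * (3 ^ n)%N%:Z by rewrite expnS PoszM.
  have [r rE] := dvdzP sP.
  move/eqP: eE; rewrite subr_eq => /eqP eE.
  apply/dvdzP; rewrite E3; exists (r + a * y * s ^+ 2 * (3 ^ n)%N%:Z
     + a * s ^+ 3 * (3 ^ n)%N%:Z * (3 ^ n)%N%:Z).
  have -> : a * (y + (3 ^ n.+1)%N%:Z * s) ^+ 3 - 1 = (a * y ^+ 3)
    + 3 * (3 ^ n.+1)%N%:Z * (a * y ^+ 2 * s) + 3 * a * y * s ^+ 2 * (3 ^ n.+1)%N%:Z ^+ 2
    + a * s ^+ 3 * (3 ^ n.+1)%N%:Z ^+ 3 - 1 by ring.
  have rE' : a * y ^+ 2 * s = r * 3 - e by rewrite -rE; ring.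
  by rewrite eE E2 rE' E1; ring.
apply: (@solvable_padic_of_coord _ p_pr 3 a b z 0) => n.
have [y [d ->]] := zP n.
have -> : (0 : padic_int p_pr) n = 0 by [].
rewrite expr0n mulr0 addr0 -rmorphXn -rmorphM -[RHS](rmorph1 (intmul 1)).
apply/eq_intZp; first exact: ppow_gt1.
by apply: dvdz_trans d; rewrite dvdzE /= dvdn_exp2l.
Qed.

Lemma intFp_eq0 p (m : int) : prime p -> (m%:~R == 0 :> 'F_p) = (p%:Z %| m)%Z.
Proof.
move=> pp; have nat_case k : (k%:R == 0 :> 'F_p) = (p %| k)%N.
  by rewrite (dvdn_pcharf (pchar_Fp pp)).
case: m => k; first by rewrite -pmulrn nat_case dvdzE.
by rewrite NegzE mulrNz oppr_eq0 -pmulrn nat_case dvdzE abszN.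
Qed.

Lemma Fp_int p (x : 'F_p) : exists m : nat, x = m%:~R.
Proof. by exists x; rewrite -pmulrn natr_Zp. Qed.

Lemma expFp_pred p (x : 'F_p) : prime p -> x != 0 -> x ^+ p.-1 = 1.
Proof.
move=> pp x0; apply: (mulfI x0); rewrite -exprS prednK ?prime_gt0 // mulr1.
by have := expf_card x; rewrite card_Fp.
Qed.

Lemma inverse_mod p (c : int) : prime p -> ~~ (p%:Z %| c)%Z ->
  exists x : int, (p%:Z %| c * x - 1)%Z.
Proof.
move=> pp pc; have [m mE] := Fp_int ((c%:~R : 'F_p)^-1); exists m%:Z.
rewrite -intFp_eq0 // intrB intrM -mE mulfV ?subrr //.
by rewrite intFp_eq0.
Qed.

(** Cubing is bijective modulo p; explicitly, x = c^((p-2)/3) makes c x^3 equal to c^(p-1). *)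
Lemma cube_root_mod p (c : int) : prime p -> (p %% 3 = 2)%N -> ~~ (p%:Z %| c)%Z ->
  exists x : int, (p%:Z %| c * x ^+ 3 - 1)%Z.
Proof.
move=> pp p2 pc; exists (c ^+ (p %/ 3)).
rewrite -intFp_eq0 // intrB -exprM -exprS.
have -> : ((p %/ 3 * 3).+1 = p.-1)%N by lia.
rewrite rmorphXn /= expFp_pred ?subrr // intFp_eq0 //.
Qed.

(** * Pairs that are soluble at every place *)

Section LocalSolvability.
Variable R : realType.

Lemma real_solvable k a b (H : (0 < k)%N) : 0 < b -> solvable_over R k a b.
Proof.
move=> b0; have bR : 0 < b%:~R :> R by rewrite ltr0z.
exists 0, ((b%:~R^-1) `^ (k%:R^-1)).
rewrite expr0n gtn_eqF // mulr0 add0r -powR_mulrn ?powR_ge0 // -powRrM.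
by rewrite mulVf ?pnatr_eq0 -?lt0n // powRr1 ?invr_ge0 ?ltW // mulfV // gt_eqF.
Qed.

Lemma power_locally_solvable k u (b : nat) (w : 'F_u) : (0 < k)%N -> prime u -> (k < u)%N ->
  w != 0 -> (0 < b)%N -> b%:R = w ^+ k -> solvable_locally R k (u ^ k)%N%:Z b%:Z.
Proof.
move=> k0 up ku w0 b0 bw; split; first by apply: real_solvable; rewrite ?ltz_nat.
move=> p pp; have [pu|pu] := eqVneq p u.
  move: pp; rewrite pu => pp; apply: solvable_overC.
  have uk : ~~ (u %| k)%N by rewrite gtnNdvd.
  have wk : w ^+ k != 0 by rewrite expf_neq0.
  have [m mE] := Fp_int (w^-1).
  apply: (@solvable_of_root u pp k b%:Z (u ^ k)%N%:Z m%:Z) => //.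
    by rewrite -intFp_eq0 // -pmulrn bw.
  rewrite -intFp_eq0 // intrB intrM rmorphXn /= -mE -pmulrn bw.
  by rewrite -exprMn mulfV // expr1n subrr.
have pud : ~~ (p%:Z %| u%:Z)%Z by rewrite dvdzE /= dvdn_prime2.
have [x0 x0P] := inverse_mod pp pud.
(* The case of exponent 1 inverts u in the p-adic integers. *)
have [x [y e]] : solvable_over (padic_int pp) 1 u%:Z 0.
  by apply: (@solvable_of_root p pp 1 u%:Z 0 x0) => //; rewrite dvdn1; apply: contraTneq pp => ->.
exists x, 0; move: e; rewrite mul0r addr0 expr1 => e.
by rewrite expr0n gtn_eqF // mulr0 addr0 PoszX rmorphXn /= -exprMn e expr1n.
Qed.

(** The modulus 63 = 9 * 7 serves two primes: modulo 9 it makes a a cube in the 3-adic integers, and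
    modulo 7, where cyclotomy fails (2 x^3 + 2 y^3 is never 1), it allows x = 1. For l = 2 modulo 3
    every unit is a cube and a or b is a unit by coprimality; for l = 1 modulo 3 both are units. *)
Lemma cubic_locally_solvable (a b : nat) : (a %% 63 = 1)%N -> (0 < b)%N ->
  (forall l, prime l -> (l %| a)%N -> (l %% 3 = 2)%N) ->
  (forall l, prime l -> (l %| b)%N -> (l %% 3 = 2)%N) -> coprime a b ->
  solvable_locally R 3 a%:Z b%:Z.
Proof.
move=> a63 b0 la lb co; split; first by apply: real_solvable; rewrite ?ltz_nat.
move=> l pl.
have [l3|l3] := eqVneq l 3%N.
  move: pl; rewrite l3 => p3; apply: cube_root_3adic.
  by apply/dvdzP; exists (a %/ 63 * 7)%N%:Z; lia.
have nl3 : ~~ (l %| 3)%N by rewrite dvdn_prime2.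
have [l2|l2] := eqVneq (l %% 3)%N 2%N.
  have [d|d] := boolP (l %| a)%N; last first.
    have da : ~~ (l%:Z %| a%:Z)%Z by rewrite dvdzE.
    have [x xP] := cube_root_mod pl l2 da.
    by apply: (@solvable_of_root l pl 3 a%:Z b%:Z x).
  have db : ~~ (l%:Z %| b%:Z)%Z.
    by rewrite dvdzE /= -prime_coprime // (coprime_dvdl d).
  have [x xP] := cube_root_mod pl l2 db.
  by apply: solvable_overC; apply: (@solvable_of_root l pl 3 b%:Z a%:Z x).
have da : ~~ (l%:Z %| a%:Z)%Z by rewrite dvdzE /=; apply: contra l2 => /la ->.
have db : ~~ (l%:Z %| b%:Z)%Z by rewrite dvdzE /=; apply: contra l2 => /lb ->.
have l1 : (l %% 3 = 1)%N.
  have : ~~ (3 %| l)%N by rewrite dvdn_prime2 // eq_sym.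
  by move: l2; rewrite /dvdn; lia.
have [l7|l7] := eqVneq l 7%N.
  apply: (@solvable_of_root l pl 3 a%:Z b%:Z 1) => //; rewrite l7.
  by apply/dvdzP; exists (a %/ 63 * 9)%N%:Z; lia.
have cardF : #|'F_l| = (3 * (l %/ 3)).+1 by rewrite card_Fp //; lia.
have f3 : (2 < l %/ 3)%N.
  have l4 : l != 4%N by apply: contraTneq pl => ->.
  have : (1 < l)%N by exact: prime_gt1.
  by move: l7 l4 l1; clear; lia.
have [||x [y e]] := diagonal_cubic_solvable cardF f3 (a := a%:~R) (b := b%:~R).
- by rewrite intFp_eq0.
- by rewrite intFp_eq0.
have [xi xE] := Fp_int x; have [yi yE] := Fp_int y.
have d : (l%:Z %| a%:Z * xi%:Z ^+ 3 + b%:Z * yi%:Z ^+ 3 - 1)%Z.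
  by rewrite -intFp_eq0 // intrB intrD (intrM _ a%:Z) (intrM _ b%:Z) !rmorphXn /= -xE -yE e subrr.
have [y0|y0] := eqVneq y 0; last first.
  by apply: (@hensel_power l pl 3 a%:Z b%:Z xi%:Z yi%:Z) => //; rewrite -intFp_eq0 // -yE.
apply: solvable_overC; apply: (@hensel_power l pl 3 b%:Z a%:Z yi%:Z xi%:Z) => //.
  rewrite -intFp_eq0 // -xE; apply: contra_eq_neq e => ->.
  by rewrite y0 !expr0n !mulr0 addr0 eq_sym oner_neq0.
by rewrite [X in X - 1]addrC.
Qed.
End LocalSolvability.

(** * Lower bounds for the number of locally soluble pairs *)

Lemma class2_primes_gt m N :
  (size (class2_primes N) - m <= size [seq u <- class2_primes N | m < u])%N.
Proof.
rewrite leq_subLR -(count_predC (fun u => m < u)%N) size_filter addnC leq_add2r.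
rewrite -size_filter -[X in (_ <= X)%N](size_iota 1 m); apply: uniq_leq_size.
  by rewrite filter_uniq // filter_uniq // iota_uniq.
move=> u; rewrite mem_filter /= -leqNgt => /andP[uk]; rewrite mem_filter mem_iota.
by move=> /andP[_ /andP[u1 _]]; rewrite mem_iota u1 add1n ltnS.
Qed.

Section LocalCount.
Variable R : realType.

Definition locally_in (k n : nat) (z : int * int) :=
  [/\ 0 < `|z.1| <= n%:Z, 0 < `|z.2| <= n%:Z & solvable_locally R k z.1 z.2].

Lemma locally_lower_power k n h : (0 < k)%N -> (h ^ (6 * k) <= n)%N ->
  exists s : seq (int * int), [/\ uniq s, forall z, z \in s -> locally_in k n z &
    (n * (size (class2_primes (h ^ 6)) - k) <= 4 * k * size s)%N].
Proof.
move=> k0 hn; pose us := [seq u <- class2_primes (h ^ 6) | (k < u)%N].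
have usP u : u \in us -> [/\ prime u, (k < u)%N & (u ^ k <= n)%N].
  rewrite mem_filter mem_filter mem_iota => /and3P[ku /andP[up _] /andP[_ uh]]; split=> //.
  by apply: leq_trans hn; rewrite expnM leq_exp2r // -ltnS -add1n.
have P u : exists bs : seq nat, u \in us -> [/\ uniq bs, (n <= 4 * k * size bs)%N &
    forall b, b \in bs -> (0 < b <= n)%N /\ exists2 w : 'F_u, w != 0 & b%:R = w ^+ k].
  have [uu|_] := boolP (u \in us); last by exists [::].
  have [up ku ukn] := usP u uu.
  have [|bs bsP] := @power_residues_many k n u k0 up; last by exists bs.
  by apply: leq_trans ukn; rewrite -{1}(expn1 u) leq_pexp2l // prime_gt0.
have [bs bsP] := choice P.
exists [seq ((u ^ k)%N%:Z, (b : nat)%:Z) | u <- us, b <- bs u]; split.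
- apply: allpairs_uniq_dep.
  + by rewrite filter_uniq // filter_uniq // iota_uniq.
  + by move=> u /bsP[].
  move=> [u b] [u' b'] _ _ /= [e1 e2]; rewrite e2.
  by have -> // : u = u' by apply/eqP; rewrite -(eqn_exp2r _ _ k0); apply/eqP.
- move=> z /allpairsPdep[u [b [uu bb ->]]].
  have [up ku ukn] := usP u uu; have [_ _ /(_ b bb) [/andP[b0 bn] [w w0 bw]]] := bsP u uu.
  split; rewrite /= ?lez_nat ?ltz_nat ?bn ?ukn ?b0 ?andbT ?expn_gt0 ?(prime_gt0 up) //.
  exact: power_locally_solvable w0 b0 bw.
rewrite size_allpairs_dep.
have szus : (size (class2_primes (h ^ 6)) - k <= size us)%N by exact: class2_primes_gt.
apply: (@leq_trans (n * size us)); first by rewrite leq_mul2l szus orbT.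
elim: (us) bsP => [_|u r IH hb] /=; first by rewrite muln0.
rewrite mulnS mulnDr; apply: leq_add; last by apply: IH => v vr; apply: hb; rewrite inE vr orbT.
by have [] := hb u (mem_head _ _).
Qed.

(* 2 and 5, both 2 modulo 3, generate the units modulo 63. *)
Definition mult63 (r : nat) : nat * nat := head (0, 0)%N
  [seq ij <- [seq (i, j) | i <- iota 0 6, j <- iota 0 6] |
    ((r * ((2 ^ ij.1 * (5 ^ ij.2 %% 63)) %% 63)) %% 63 == 1)%N].

Lemma mult63_check : all (fun r => coprime r 63 ==> (((mult63 r).1 < 6) && ((mult63 r).2 < 6) &&
   ((r * ((2 ^ (mult63 r).1 * (5 ^ (mult63 r).2 %% 63)) %% 63)) %% 63 == 1)))%N (iota 0 63).
Proof. by vm_compute. Qed.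

Lemma mult63P r : coprime r 63 ->
  [/\ ((mult63 (r %% 63)).1 < 6)%N, ((mult63 (r %% 63)).2 < 6)%N &
    ((r * (2 ^ (mult63 (r %% 63)).1 * 5 ^ (mult63 (r %% 63)).2)) %% 63 = 1)%N].
Proof.
rewrite -coprime_modl => co.
have r63 : (r %% 63)%N \in iota 0 63 by rewrite mem_iota ltn_pmod.
have := allP mult63_check _ r63 => /implyP /(_ co).
move: (mult63 _) => [i j] /= /andP[/andP[-> ->] /eqP h]; split=> //.
by move: h; rewrite modnMm mulnA modnMmr -mulnA.
Qed.

Definition lift63 p : nat := (p * (2 ^ (mult63 (p %% 63)).1 * 5 ^ (mult63 (p %% 63)).2))%N.

(** The pairs are ([lift63 p], q) with distinct primes p, q > 7; p is recovered as the only prime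
    factor of [lift63 p] besides 2 and 5. Of the 8, at most 7 primes are lost by p > 7 and one by q
    != p. *)
Lemma locally_lower_cubic n z : (2 ^ 5 * 5 ^ 5 * z <= n)%N ->
  exists s : seq (int * int), [/\ uniq s, forall z, z \in s -> locally_in 3 n z &
    ((size (class2_primes z) - 8) ^ 2 <= size s)%N].
Proof.
move=> zn; pose ps := [seq u <- class2_primes z | (7 < u)%N].
have psP p : p \in ps -> [/\ prime p, (p %% 3 = 2)%N, (7 < p)%N & (p <= z)%N].
  rewrite mem_filter mem_filter mem_iota => /and3P[p7 /andP[pp /eqP p2] /andP[_ pz]]; split=> //.
have ups : uniq ps by rewrite filter_uniq // filter_uniq // iota_uniq.
have n25 p l : p \in ps -> prime l -> (l %| 2 ^ (mult63 (p %% 63)).1 * 5 ^ (mult63 (p %% 63)).2)%N ->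
    l = 2%N \/ l = 5%N.
  move=> _ lp; rewrite Euclid_dvdM // => /orP[|] /(fun h => dvdn_trans (dvdnn l) h).
    by rewrite Euclid_dvdX // => /andP[]; rewrite dvdn_prime2 // => /eqP; left.
  by rewrite Euclid_dvdX // => /andP[]; rewrite dvdn_prime2 // => /eqP; right.
have co63 p : p \in ps -> coprime p 63.
  move=> /psP[pp p2 p7 _]; rewrite -[63%N]/(3 ^ 2 * 7)%N coprimeMr coprimeXr //=.
    rewrite prime_coprime // dvdn_prime2 //; apply: contraTN p7 => /eqP->; done.
  rewrite prime_coprime // dvdn_prime2 //; apply: contraTN p7 => /eqP->; done.
have lift_primes p l : p \in ps -> prime l -> (l %| lift63 p)%N -> l = p \/ (l = 2%N \/ l = 5%N).
  move=> pps lp; rewrite /lift63 Euclid_dvdM // => /orP[|].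
    by have [pp _ _ _] := psP p pps; rewrite dvdn_prime2 // => /eqP; left.
  by move=> /(n25 p l pps lp); right.
exists [seq ((lift63 p)%:Z, (q : nat)%:Z) | p <- ps, q <- [seq q <- ps | q != p]]; split.
- apply: allpairs_uniq_dep => //; first by move=> p _; rewrite filter_uniq.
  move=> [p q] [p' q'] /allpairsPdep[p1 [q1 [p1s _ [-> _]]]] /allpairsPdep[p2 [q2 [p2s _ [-> _]]]].
  move=> /= [e1 e2]; rewrite e2; have -> // : p1 = p2.
  have [pp _ p7 _] := psP p1 p1s.
  have : (p1 %| lift63 p2)%N by rewrite -e1 /lift63 dvdn_mulr.
  by move=> /(lift_primes p2 p1 p2s pp) [//|[p12|p12]]; move: p7; rewrite p12.
- move=> zz /allpairsPdep[p [q [pps qps ->]]].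
  move: qps; rewrite mem_filter => /andP[qp qps].
  have [pp p2 p7 pz] := psP p pps; have [qpr q2 q7 qz] := psP q qps.
  have [i6 j6 e63] := mult63P (co63 p pps).
  have lift_le : (lift63 p <= n)%N.
    apply: leq_trans zn; rewrite /lift63 mulnC leq_mul //.
    by rewrite leq_mul // leq_exp2l.
  have lift0 : (0 < lift63 p)%N by rewrite /lift63 !muln_gt0 !expn_gt0 prime_gt0.
  split; rewrite /= ?lez_nat ?ltz_nat ?lift0 ?lift_le ?prime_gt0 //=.
    by apply: (leq_trans qz); apply: leq_trans zn; rewrite leq_pmull // muln_gt0 !expn_gt0.
  apply: cubic_locally_solvable => //; first exact: prime_gt0.
  + by move=> l lp /(lift_primes p l pps lp) [->|[->|->]].
  + by move=> l lp; rewrite dvdn_prime2 // => /eqP->.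
  rewrite coprime_sym prime_coprime //; apply/negP => /(lift_primes p q pps qpr).
  by move=> [/eqP|[q25|q25]]; [rewrite (negPf qp)|move: q7; rewrite q25|move: q7; rewrite q25].
rewrite size_allpairs_dep.
have szps : (size (class2_primes z) - 7 <= size ps)%N by exact: class2_primes_gt.
have sz p : p \in ps -> size [seq q <- ps | q != p] = (size ps).-1.
  by move=> pps; rewrite -rem_filter // size_rem.
have -> : [seq size [seq q <- ps | q != p] | p <- ps] = [seq (size ps).-1 | p <- ps].
  by apply/eq_in_map => p pps; rewrite sz.
have -> : sumn [seq (size ps).-1 | _ <- ps] = (size ps * (size ps).-1)%N.
  by elim: (ps) (size ps).-1 => //= _ r IH m; rewrite IH mulSn.
rewrite expnS expn1 leq_mul //; move: szps; move: (size _) (size ps) => u v; clear; lia.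
Qed.
End LocalCount.

(** * Comparison of the two counts *)

Lemma exists_root m n : (0 < m)%N -> exists h, (h ^ m <= n < h.+1 ^ m)%N.
Proof.
move=> m0; have ex : exists h, (h ^ m <= n)%N by exists 0%N; rewrite exp0n.
have bd h : (h ^ m <= n)%N -> (h <= n)%N.
  apply: leq_trans; case: h => // h.
  by rewrite -{1}(expn1 h.+1) leq_pexp2l.
case: (ex_maxnP ex bd) => h hn hmax; exists h; rewrite hn /=.
by rewrite ltnNge; apply/negP => /hmax; rewrite ltnn.
Qed.

Lemma exists_root_ge m h0 : (0 < m)%N -> exists n0, forall n, (n0 <= n)%N ->
  exists h, [/\ (h0 <= h)%N, (h ^ m <= n)%N & (n <= 2 ^ m * h ^ m)%N].
Proof.
move=> m0; exists (h0.+1 ^ m)%N => n hn; have [h /andP[h1 h2]] := exists_root n m0.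
have hh : (h0 < h)%N.
  by have := leq_ltn_trans hn h2; rewrite ltn_exp2r // ltnS.
exists h; split=> //; first exact: ltnW.
apply: (leq_trans (ltnW h2)); rewrite -expnMn leq_exp2r // mul2n -addnn -addn1 leq_add2l.
exact: leq_ltn_trans hh.
Qed.

Section Counting.
Variable R : realType.

Lemma norm_le_truncn (H : R) (a : int) : 0 <= H ->
  (`|a|%:~R <= H) = (`|a| <= (Num.truncn H)%:Z).
Proof.
move=> H0; rewrite -abszE lez_nat -pmulrn.
by rewrite truncn_ge_nat.
Qed.

Lemma coef_boxE (H : R) ab : 0 <= H -> coef_box H ab <->
  [/\ 0 < `|ab.1| <= (Num.truncn H)%:Z & 0 < `|ab.2| <= (Num.truncn H)%:Z].
Proof.
move=> H0; split=> [[a0 aH b0 bH]|[/andP[a0 aH] /andP[b0 bH]]].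
  by rewrite a0 b0 -!norm_le_truncn.
by split; rewrite ?norm_le_truncn.
Qed.

Lemma card_fset_set_le (A : set (int * int)) m : at_most A m -> (#|` fset_set A| <= m)%N.
Proof.
move=> [s [sm sA]]; apply: leq_trans sm.
have fA : finite_set A by apply: sub_finite_set (finite_seq s) => z /sA.
apply: uniq_leq_size; first exact: fset_uniq.
by move=> z; rewrite in_fset_set // => /set_mem /sA.
Qed.

Lemma card_fset_set_ge (A : set (int * int)) (s : seq (int * int)) : finite_set A ->
  uniq s -> (forall z, z \in s -> A z) -> (size s <= #|` fset_set A|)%N.
Proof.
move=> fA us sA; apply: uniq_leq_size => // z /sA Az.
by rewrite in_fset_set //; apply/mem_set.
Qed.

Lemma N_glob_le k (H : R) m : 0 <= H -> at_most (soluble_over_int k (Num.truncn H)) m ->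
  (N_glob k H <= m)%N.
Proof.
move=> H0 hm; apply: card_fset_set_le; apply: at_mostW hm _ (leqnn m) => z.
move=> [/(coef_boxE _ H0) [/andP[a0 aH] /andP[b0 bH]] [x [y e]]].
split=> //; first by rewrite -!normr_gt0.
by exists x, y; move: e; rewrite !intz.
Qed.

Lemma N_loc_ge k (H : R) s : 0 <= H -> uniq s ->
  (forall z, z \in s -> locally_in R k (Num.truncn H) z) -> (size s <= N_loc k H)%N.
Proof.
move=> H0 us sA; apply: card_fset_set_ge => //; last first.
  by move=> z /sA [h1 h2 h3]; split=> //; apply/coef_boxE.
have [r [_ rP]] := box_few (Num.truncn H) (Num.truncn H).
apply: sub_finite_set (finite_seq r) => z [/(coef_boxE _ H0) [/andP[_ aH] /andP[_ bH]] _].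
exact: rP.
Qed.

(** For k = 3 and n about z^1000 the exponents of z are 1990 above and 1992 below: z^998 leaves room
    for 2^5 5^5, the prime count loses one more z, constants a last one, and 996 occurs squared. For
    k >= 4 and n about h^(6k) they are 6 k + 2 and 6 k + 4. The gap absorbs [M]. *)
Lemma N_glob_small k M : (2 < k)%N -> abc_conjecture R ->
  exists n0 : nat, forall H : R, n0%:R <= H ->
    (M * N_glob k H <= N_loc k H)%N /\ (0 < N_loc k H)%N.
Proof.
move=> k2 abc; have k0 : (0 < k)%N by apply: leq_trans k2.
suff [n0 n0P] : exists n0 : nat, forall n, (n0 <= n)%N -> exists s m,
    [/\ at_most (soluble_over_int k n) m, uniq s, forall z, z \in s -> locally_in R k n z,
        (M * m <= size s)%N & (0 < size s)%N].
  exists n0 => H hH; have H0 : 0 <= H by apply: le_trans hH.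
  have hn : (n0 <= Num.truncn H)%N by rewrite (truncn_ge_nat _ H0).
  have [s [m [hm us sP le s0]]] := n0P _ hn.
  have h1 := N_glob_le H0 hm; have h2 := N_loc_ge H0 us sP.
  split; last exact: leq_trans h2.
  by apply: leq_trans h2; apply: leq_trans le; rewrite leq_mul2l h1 orbT.
move: k2; rewrite leq_eqVlt => /orP[/eqP k3|k3].
  rewrite -k3.
  have A0 : (0 < 2 ^ 1000)%N by rewrite expn_gt0.
  (* 2^1000 is made a variable so that nothing computes it. *)
  move: (2 ^ 1000)%N A0 (exists_root_ge (m := 1000)) => A A0 root.
  have [C [h0 gU]] := soluble_over_int_upper_3 abc A0.
  have [h1 pL] := class2_primes_lower R (e := 499) isT.
  have : exists c, (0 < c)%N /\ forall h, (h1 <= h)%N ->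
      (h ^ 997 <= c * size (class2_primes (h ^ 998)))%N.
    by exists (8 * 499)%N; split.
  move=> [c [c0 {}pL]].
  have [n0 n0P] := root (h0 + h1 + 2 ^ 5 * 5 ^ 5 + 8 * c + M * C * c ^ 2 + 2)%N isT.
  exists n0 => n /n0P [z [hz zn nz]].
  have [z0 z1 z2 z3 z4] : [/\ (h0 <= z)%N, (h1 <= z)%N, (2 ^ 5 * 5 ^ 5 <= z)%N, (8 * c <= z)%N &
      (M * C * c ^ 2 <= z)%N /\ (1 < z)%N].
    by move: hz; move: (2 ^ 5 * 5 ^ 5)%N (8 * c)%N (M * C * c ^ 2)%N => u v w; clear; split; [..|split]; lia.
  case: z4 => z4 z5; have zp : (0 < z)%N by apply: ltnW.
  have up : at_most (soluble_over_int 3 n) (C * z ^ 1990).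
    have := gU (z ^ 10)%N n; rewrite -!expnM; apply.
      by apply: (leq_trans z0); rewrite -{1}(expn1 z) leq_pexp2l.
    exact: nz.
  have zn' : (2 ^ 5 * 5 ^ 5 * z ^ 998 <= n)%N by apply: leq_trans zn; apply: pow_absorb.
  have [s [us sP sz]] := locally_lower_cubic R zn'.
  have := pL z z1; move: (size (class2_primes _)) sz => P sz hP.
  have w0 : (z <= z ^ 996)%N by rewrite -{1}(expn1 z) leq_pexp2l.
  have wP : (z ^ 996 <= c * (P - 8))%N.
    move: hP; rewrite (expnS z 996) mulnBr; move: (z ^ 996)%N w0 => w w0 hP.
    have : (2 * w <= c * P)%N by apply: leq_trans hP; rewrite leq_mul2r z5 orbT.
    by move: z3 w0; rewrite [(c * 8)%N]mulnC; move: (c * P)%N (8 * c)%N; clear; lia.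
  have key : (M * (C * z ^ 1990) * c ^ 2 <= size s * c ^ 2)%N.
    apply: (@leq_trans ((z ^ 996) ^ 2)).
      rewrite -expnM (_ : M * (C * z ^ 1990) * c ^ 2 = M * C * c ^ 2 * z ^ 1990)%N.
        by apply: pow_absorb.
      by move: (z ^ 1990)%N (c ^ 2)%N => u v; ring.
    apply: (@leq_trans ((c * (P - 8)) ^ 2)); first by rewrite leq_exp2r.
    by rewrite expnMn mulnC leq_mul2r sz orbT.
  exists s, (C * z ^ 1990)%N; split=> //.
    by move: key; rewrite leq_mul2r expn_eq0 (gtn_eqF c0).
  rewrite lt0n; apply/eqP => s0; move: sz; rewrite s0 leqn0 expn_eq0 => /andP[P0 _].
  by move: wP; rewrite (eqP P0) muln0 leqNgt expn_gt0 zp.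
have [C [h0 gU]] := soluble_over_int_upper_ge4 abc k3.
have [h1 pL] := class2_primes_lower R (e := 3) isT.
have m0 : (0 < 6 * k)%N by rewrite muln_gt0.
have [n0 n0P] := exists_root_ge (h0 + h1 + 24 * k + 96 * k * (M * C) + 2)%N m0.
exists n0 => n /n0P [h [hh hn nh]].
have [z0 z1 z2 z3 z4] : [/\ (h0 <= h)%N, (h1 <= h)%N, (24 * k <= h)%N, (96 * k * (M * C) <= h)%N &
      (1 < h)%N].
  by move: hh; move: (24 * k)%N (96 * k * (M * C))%N => u v; clear; split; lia.
have hp : (0 < h)%N by apply: ltnW.
have up := gU h n z0 nh.
have [s [us sP sz]] := locally_lower_power R k0 hn.
have := pL h z1; rewrite -[(2 * 3).-1]/5%N -[(2 * 3)%N]/6%N -[(8 * 3)%N]/24%N.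
move: (size (class2_primes _)) sz => P sz hP.
have w0 : (h <= h ^ 4)%N by rewrite -{1}(expn1 h) leq_pexp2l.
have wP : (h ^ 4 <= 24 * (P - k))%N.
  move: hP; rewrite (expnS h 4) mulnBr; move: (h ^ 4)%N w0 => w w0 hP.
  have : (2 * w <= 24 * P)%N by apply: leq_trans hP; rewrite leq_mul2r z4 orbT.
  by move: z2 w0; move: (24 * P)%N (24 * k)%N; clear; lia.
have low : (h ^ (6 * k + 4) <= 96 * k * size s)%N.
  rewrite expnD; apply: (@leq_trans (n * (24 * (P - k)))); first by rewrite leq_mul.
  rewrite mulnCA (_ : 96 * k * size s = 24 * (4 * k * size s))%N; last by ring.
  by rewrite leq_mul2l sz.
exists s, (C * h ^ (6 * k + 2))%N; split=> //.
  have : (96 * k * (M * (C * h ^ (6 * k + 2))) <= 96 * k * size s)%N.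
    apply: leq_trans low.
    rewrite (_ : _ * (M * _) = 96 * k * (M * C) * h ^ (6 * k + 2))%N.
      by apply: pow_absorb => //; rewrite ltn_add2l.
    by move: (h ^ _)%N => u; ring.
  by rewrite leq_mul2l muln_eq0 (gtn_eqF k0).
rewrite lt0n; apply/eqP => s0; move: low; rewrite s0 muln0 leqNgt expn_gt0 hp.
by [].
Qed.
End Counting.

Theorem theorem1 (R : realType) (k : nat) (hk : (3 <= k)%N)
    (habc : abc_conjecture R) :
  (N_glob k H)%:R / (N_loc k H)%:R @[H --> +oo_R] --> (0 : R).
Proof.
apply/cvgr0Pnorm_lt => e e0.
(* Then e M > 1, and M N_glob <= N_loc puts the quotient below e. *)
pose M := (Num.truncn (e^-1)).+1.
have [n0 n0P] := N_glob_small M hk habc.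
near=> H.
have [|le l0] := n0P H.
  by near: H; apply: nbhs_pinfty_ge; rewrite num_real.
rewrite ger0_norm ?divr_ge0 // ltr_pdivrMr ?ltr0n //.
have M0 : 0 < M%:R :> R by rewrite ltr0n.
rewrite -(ltr_pM2l M0) -natrM; apply: (@le_lt_trans _ _ (N_loc k H)%:R); first by rewrite ler_nat.
rewrite mulrA ltr_pMl ?ltr0n // -ltr_pdivrMr // div1r.
exact: truncnS_gt.
Unshelve. all: by end_near.
Qed.
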